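(* Given a closed polygonal chain $C = (p_1, p_2, \ldots, p_n)$ in $\mathbb{R}^d$ and a positive integer $k \geq 3$, a $\left(2 - \frac{1}{4k^3}\right)$-approximation for covering $C$ by $k$ closed curves can be computed in $O(n+k)$ time. Furthermore, for $k = 3, 4, 5, 6, 7, 8, 9, 10$, the approximation ratios $1.932$, $1.974$, $1.988$, $1.993$, $1.996$, $1.998$, $1.998$, $2$, respectively, can be obtained.
   Context: A closed polygonal chain $C=(p_1,\ldots,p_n)$ in $\mathbb{R}^d$ is the closed curve consisting of the segments $p_1p_2, p_2p_3, \ldots, p_{n-1}p_n, p_np_1$. The problem of covering $C$ by $k$ closed curves is: find $k$ closed curves in $\mathbb{R}^d$ that together cover $C$, so that the maximum length of an individual curve is minimized. Let $\mathrm{OPT}$ denote the minimum value of this maximum length. A $\rho$-approximation (equivalently, approximation ratio $\rho$) means a set of $k$ closed curves covering $C$, each of length at most $\rho\cdot \mathrm{OPT}$.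
   Formalization: ''Cover'' counts multiplicity, both in OPT and in the computed curves: a stretch that C traverses several times must be covered as many times (finitely many points exempt); for chains without overlapping stretches this is ordinary covering. *)

(* Defs.v *)
From HB Require Import structures.
From mathcomp Require Import all_boot all_order all_algebra.
From mathcomp Require Import all_classical all_reals all_analysis.

Set Implicit Arguments.
Unset Strict Implicit.
Unset Printing Implicit Defensive.

Import Order.TTheory GRing.Theory Num.Theory.
Import numFieldNormedType.Exports.

Local Open Scope classical_set_scope.
Local Open Scope ring_scope.

(** The library norm on ['rV[R]_d] is the sup norm, hence this definition.  The
    two norms induce the same topology, so continuity is the library's. *)
Definition edist (R : realType) (d : nat) (x y : 'rV[R]_d) : R :=
  Num.sqrt (\sum_(j < d) (x ord0 j - y ord0 j) ^+ 2).

Definition closed_curve (R : realType) (d : nat) (g : R -> 'rV[R]_d) : Prop :=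
  {within `[0, 1], continuous g} /\ g 0 = g 1.

Definition inscribed_length (R : realType) (d : nat) (g : R -> 'rV[R]_d)
    (s : seq R) : R :=
  let F := g \o nth 1 (0 :: s) in
  \sum_(0 <= i < size s) edist (F i.+1) (F i).

(** [+oo] if [g] is not rectifiable. *)
Definition curve_length (R : realType) (d : nat) (g : R -> 'rV[R]_d) : \bar R :=
  ereal_sup [set (inscribed_length g s)%:E | s in itv_partition 0 1].

(** The closed curve traversing p_1 p_2 ... p_n p_1, each of the n edges in
    time 1/n. *)
Definition chain_curve (R : realType) (d : nat) (p : seq 'rV[R]_d) (t : R) :
    'rV[R]_d :=
  let n := size p in
  let i := Num.truncn (t * n%:R) in
  let a := nth 0 p (i %% n) in
  let b := nth 0 p (i.+1 %% n) in
  a + (t * n%:R - i%:R) *: (b - a).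

Definition passages (R : realType) (d : nat) (g : R -> 'rV[R]_d)
    (x : 'rV[R]_d) : set R :=
  [set t | 0 <= t < 1 /\ g t = x].

(** A chain is a curve, so a stretch that it runs through several times has to
    be covered as many times.  Finitely many points (self-crossings, repeated
    vertices) are exempt from this count.  If the chain has no such stretch,
    then this is inclusion of point sets, by [covers_no_overlap] below. *)
Definition covers (R : realType) (d k : nat) (p : seq 'rV[R]_d)
    (g : 'I_k -> R -> 'rV[R]_d) : Prop :=
  (forall x, passages (chain_curve p) x !=set0 ->
     exists i, passages (g i) x !=set0) /\
  (exists2 E : set 'rV[R]_d, finite_set E &
     forall x, ~ E x ->
       (passages (chain_curve p) x #<=
        [set it : 'I_k * R | passages (g it.1) x it.2])%card).

Definition max_length (R : realType) (d k : nat) (g : 'I_k -> R -> 'rV[R]_d) :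
    \bar R :=
  \big[maxe/0%E]_(i < k) curve_length (g i).

(** An infimum, so that the existence of an optimal covering is not presupposed. *)
Definition opt (R : realType) (d : nat) (p : seq 'rV[R]_d) (k : nat) : \bar R :=
  ereal_inf [set max_length g | g in
    [set g : 'I_k -> R -> 'rV[R]_d | (forall i, closed_curve (g i)) /\
                                     covers p g]].

Definition is_approximation (R : realType) (d k : nat) (rho : R)
    (p : seq 'rV[R]_d) (g : 'I_k -> R -> 'rV[R]_d) : Prop :=
  [/\ forall i, closed_curve (g i), covers p g &
      forall i, (curve_length (g i) <= rho%:E * opt p k)%E].

(** [E]: the points at which the chain meets itself. *)
Lemma covers_no_overlap (R : realType) (d k : nat) (p : seq 'rV[R]_d)
    (g : 'I_k -> R -> 'rV[R]_d) (E : set 'rV[R]_d) :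
  finite_set E ->
  (forall x, ~ E x -> is_subset1 (passages (chain_curve p) x)) ->
  covers p g <->
  (forall x, passages (chain_curve p) x !=set0 ->
     exists i, passages (g i) x !=set0).
Proof.
move=> finE p1; split=> [[]//|pg]; split=> //; exists E => // x /p1 px1.
have [[t pt]|/set0P/negP/negPn/eqP ->] :=
  pselect (passages (chain_curve p) x !=set0); last exact: card_ge0.
have [i [s gs]] := pg x (ex_intro _ t pt).
have -> : passages (chain_curve p) x = [set t].
  by apply/seteqP; split=> u /= => [pu|->//]; exact: px1.
have -> : [set t] = (fun=> t) @` [set (i, s)] by rewrite image_set1.
apply: card_le_trans (card_image_le _ _) (subset_card_le _).
by move=> _ ->.
Qed.

(** Real RAM.  Memory consists of arrays of natural numbers and arrays of reals; arrays
    are named by constants of the program, so a program has finitely many of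
    them, and indices are computed (indirect addressing).  Reals are exact and
    support + - * /, square root and comparison; they cannot be rounded to
    integers.  Scalar variables are array cells with constant index. *)

Inductive nexp : Type :=
| NLit of nat
| NGet of nat & nexp
| NAdd of nexp & nexp
| NSub of nexp & nexp.

Inductive rexp : Type :=
| RNat of nexp
| RGet of nat & nexp
| RAdd of rexp & rexp
| RSub of rexp & rexp
| RMul of rexp & rexp
| RDiv of rexp & rexp
| RSqrt of rexp.

Inductive bexp : Type :=
| BNLe of nexp & nexp
| BRLe of rexp & rexp
| BNot of bexp
| BAnd of bexp & bexp.

Inductive cmd : Type :=
| Skip
| NSet of nat & nexp & nexp
| RSet of nat & nexp & rexp
| NOut of nexp
| ROut of rexp
| Seq of cmd & cmd
| If of bexp & cmd & cmd
| While of bexp & cmd.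

Record state (R : realType) : Type := State {
  nmem : nat -> nat -> nat;
  rmem : nat -> nat -> R;
  nout : seq nat;
  rout : seq R }.

Fixpoint neval (R : realType) (s : state R) (e : nexp) : nat :=
  match e with
  | NLit n => n
  | NGet a i => nmem s a (neval s i)
  | NAdd e1 e2 => neval s e1 + neval s e2
  | NSub e1 e2 => neval s e1 - neval s e2
  end%N.

Fixpoint reval (R : realType) (s : state R) (e : rexp) : R :=
  match e with
  | RNat e1 => (neval s e1)%:R
  | RGet a i => rmem s a (neval s i)
  | RAdd e1 e2 => reval s e1 + reval s e2
  | RSub e1 e2 => reval s e1 - reval s e2
  | RMul e1 e2 => reval s e1 * reval s e2
  | RDiv e1 e2 => reval s e1 / reval s e2
  | RSqrt e1 => Num.sqrt (reval s e1)
  end.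

Fixpoint beval (R : realType) (s : state R) (b : bexp) : bool :=
  match b with
  | BNLe e1 e2 => (neval s e1 <= neval s e2)%N
  | BRLe e1 e2 => reval s e1 <= reval s e2
  | BNot b1 => ~~ beval s b1
  | BAnd b1 b2 => beval s b1 && beval s b2
  end.

Definition update (T : Type) (m : nat -> nat -> T) (a i : nat) (v : T) :
    nat -> nat -> T :=
  fun a' i' => if (a' == a) && (i' == i) then v else m a' i'.

(** [exec c s t s']: from [s], [c] halts in [s'] after [t] steps.  Expressions
    have constant size in a given program, so one step per elementary command
    and per test is the unit-cost measure up to a constant factor. *)
Inductive exec (R : realType) : cmd -> state R -> nat -> state R -> Prop :=
| ExecSkip s : exec Skip s 1 s
| ExecNSet a i e s :
    exec (NSet a i e) s 1
      (State (update (nmem s) a (neval s i) (neval s e)) (rmem s)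
             (nout s) (rout s))
| ExecRSet a i e s :
    exec (RSet a i e) s 1
      (State (nmem s) (update (rmem s) a (neval s i) (reval s e))
             (nout s) (rout s))
| ExecNOut e s :
    exec (NOut e) s 1
      (State (nmem s) (rmem s) (rcons (nout s) (neval s e)) (rout s))
| ExecROut e s :
    exec (ROut e) s 1
      (State (nmem s) (rmem s) (nout s) (rcons (rout s) (reval s e)))
| ExecSeq c1 c2 s1 s2 s3 t1 t2 :
    exec c1 s1 t1 s2 -> exec c2 s2 t2 s3 -> exec (Seq c1 c2) s1 (t1 + t2) s3
| ExecIfT b c1 c2 s t s' :
    beval s b -> exec c1 s t s' -> exec (If b c1 c2) s t.+1 s'
| ExecIfF b c1 c2 s t s' :
    ~~ beval s b -> exec c2 s t s' -> exec (If b c1 c2) s t.+1 s'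
| ExecWhileT b c s1 s2 s3 t1 t2 :
    beval s1 b -> exec c s1 t1 s2 -> exec (While b c) s2 t2 s3 ->
    exec (While b c) s1 (t1 + t2).+1 s3
| ExecWhileF b c s : ~~ beval s b -> exec (While b c) s 1 s.

Definition coords (R : realType) (d : nat) (p : seq 'rV[R]_d) : seq R :=
  flatten [seq [seq x ord0 j | j <- enum 'I_d] | x : 'rV[R]_d <- p].

(** n and k are in cells 0 and 1 of integer array 0, the coordinates of
    p_1, ..., p_n in real array 0; all other cells are 0. *)
Definition input (R : realType) (d : nat) (p : seq 'rV[R]_d) (k : nat) :
    state R :=
  State (fun a i => if a == 0 then nth 0 [:: size p; k] i else 0)%N
        (fun a i => if a == 0%N then nth 0 (coords p) i else 0)
        [::] [::].

(** [c], started on (p, k), halts within [T] steps having written the k closed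
    chains [Q]: their numbers of vertices on the integer tape, and all their
    vertices in order on the real tape. *)
Definition computes_within (R : realType) (d k : nat) (c : cmd)
    (p : seq 'rV[R]_d) (T : nat) (Q : k.-tuple (seq 'rV[R]_d)) : Prop :=
  exists (t : nat) (s : state R),
    [/\ exec c (input p k) t s, (t <= T)%N,
        nout s = [seq size q | q <- Q] & rout s = coords (flatten Q)].

Definition chain_curves (R : realType) (d k : nat)
    (Q : k.-tuple (seq 'rV[R]_d)) (i : 'I_k) : R -> 'rV[R]_d :=
  chain_curve (tnth Q i).

Definition small_ratios (R : realType) : seq (nat * R) :=
  [:: (3%N, 1932 / 1000); (4%N, 1974 / 1000); (5%N, 1988 / 1000);
      (6%N, 1993 / 1000); (7%N, 1996 / 1000); (8%N, 1998 / 1000);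
      (9%N, 1998 / 1000); (10%N, 2)].

(* Main.v *)
Require Import Defs.
From mathcomp Require Import all_boot all_order all_algebra.
From mathcomp Require Import all_classical all_reals all_analysis.
From mathcomp Require Import measurable_realfun ring lra zify.

(** Write [L] for the length of the chain and [w = L / k].  The optimum is at
    least [w], and [k] closed arcs of the chain are constructed, each of length
    at most [(2 - 8 / (3 k^2 (k + 1))) w].

    Lower bound ([opt_ge]).  A covering counts multiplicities, so the lengths
    of its curves should add up to at least [L] ([chain_le_curves]).  As the
    curves are merely continuous, this is proved by integrating over the values
    [h] of a linear functional that is nonzero on all nondegenerate edges.  Each
    curve is cut into equal pieces of time, and each piece is charged to the
    line of one edge that it meets.  A piece is at least as long as its trace on that line, and
    for all but finitely many [h] and all fine enough subdivisions, the edges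
    over [h] are matched with different pieces charged to the right lines
    ([pointwise_bound]).  Fatou's lemma turns this into an inequality of
    lengths.

    Upper bound.  Closing an arc of length [w] by its chord gives length at most
    [2 w]; the excess of the arc over its chord is gained.  Consider [3 k]
    points at equal distances [w / 3] along the chain, and the chords of the
    windows of length [w] that start at them.  The steps between consecutive
    points add up to zero, hence their Fourier transform vanishes at frequency 0,
    and on the frequency [m] the sum of three consecutive steps acts as
    [1 + 2 cos (2 pi m / 3 k)], which is at most [3 - 4 / k^2] in absolute value
    ([wirtinger3]).  So the chords add up to at most [(3 - 4 / k^2) L]
    ([sum_chord]), and one of the three families of [k] consecutive windows has
    total deficit, i.e. window lengths minus chords, at least [4 w / (3 k)].

    The deficits may be concentrated in a few windows; they are distributed by
    moving the cuts.  Let the cut [j] be moved forward by [y j >= 0].  The arc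
    over the window [j], of deficit [dl j], then has length [w + y j.+1 - y j],
    and its chord is at most this length and at most
    [w - dl j + y j + y j.+1].  Hence the closed arc is at most [2 w - gain] as
    soon as [y j.+1 <= y j - gain / 2] or [y j.+1 <= (dl j - gain) / 2]: a
    window of large deficit admits a large shift, and the shift is used up by
    the following arcs, [gain / 2] by each.  Taking for [y j.+1] the larger of
    the two bounds, the shifts are nonnegative after one round and nondecreasing
    from one round to the next ([shift_ge0], [shift_period]), with
    [gain = 2 (sum of the deficits) / (k (k + 1))].  The arcs of the second
    round therefore cover a full lap.

    Computation.  All positions used lie in the first three laps of the chain.
    After unrolling these, the edges that contain the window points and the cuts
    are found by two monotone scans, and everything else is a loop over windows,
    shifts or output vertices.  The number of iterations of each loop is at most
    [10 (n + k)] ([program_correct]). *)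

Set Implicit Arguments.
Unset Strict Implicit.
Unset Printing Implicit Defensive.

Import Order.TTheory GRing.Theory Num.Theory.
Import numFieldNormedType.Exports.

Local Open Scope classical_set_scope.
Local Open Scope ring_scope.

Local Notation edist := Defs.edist.

(** * Discrete Fourier analysis *)

Section Trig.
Variable R : realType.
Implicit Types (x : nat -> R) (a b : R).

Lemma sin_pi_6 : sin (pi / 6) = 1 / 2 :> R.
Proof.
have pi0 : 0 < pi :> R by exact: pi_gt0.
set y := pi / 6; have s0 : 0 < sin y by apply: sin_gt0_pi; rewrite /y; lra.
have : sin (y *+ 2 + y) = 1 by rewrite -sin_pihalf; congr sin; rewrite /y; lra.
rewrite sinD sin_mulr2n cos_mulr2n; have := cos2Dsin2 y.
move: (sin y) (cos y) s0 => s c s0 cs E.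
have cE : c ^+ 2 = 1 - s ^+ 2 by rewrite -cs; ring.
have {}E : (2 * s - 1) ^+ 2 * (s + 1) = 0.
  transitivity (1 - (4 * c ^+ 2 * s - s)); first by rewrite cE; ring.
  by rewrite -[X in X - _]E; ring.
move/eqP: E; rewrite mulf_eq0 sqrf_eq0 => /orP[] /eqP; lra.
Qed.

Lemma sin_step (t : R) (j : nat) :
  sin (j.+2%:R * t) = 2 * cos t * sin (j.+1%:R * t) - sin (j%:R * t).
Proof.
have -> : j.+2%:R * t = j.+1%:R * t + t by rewrite -[in LHS]natr1; ring.
have -> : j%:R * t = j.+1%:R * t - t by rewrite -[in RHS]natr1; ring.
by rewrite sinB sinD; ring.
Qed.

(** The sequence [j |-> sin (j t)] is concave while it is nonnegative, its
    second differences being [- 2 (1 - cos t) sin (j t)], and it starts at 0. *)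
Lemma sin_ratio (t : R) (j : nat) : 0 <= t -> j%:R * t <= pi ->
  j%:R * sin (j.+1%:R * t) <= j.+1%:R * sin (j%:R * t).
Proof.
move=> t0; elim: j => [|j IH] jt; first by rewrite !mul0r sin0 mulr0.
have jt' : j%:R * t <= pi by rewrite (le_trans _ jt)// ler_wpM2r// ler_nat.
have s0 : 0 <= sin (j.+1%:R * t).
  by apply: sin_ge0_pi; rewrite jt andbT mulr_ge0.
have := IH jt'; rewrite sin_step; have := cos_le1 t; move: s0.
have : 0 <= j%:R :> R by [].
move: (sin (j.+1%:R * t)) (sin (j%:R * t)) (cos t) => S S' c.
rewrite -!(natr1 j.+1) -!(natr1 j).
move: (j%:R) => J J0 S0 c1 IHJ.
have : 0 <= (J + 1) * (S * (1 - c)) by apply: mulr_ge0; [lra|apply: mulr_ge0; lra].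
nra.
Qed.

(** With [t = pi / 6 k], concavity gives [sin (2 t) / 2 >= sin (k t) / k], and
    [sin (k t) = sin (pi / 6) = 1 / 2]. *)
Lemma sin_pi_3k (k : nat) : (2 <= k)%N -> k%:R^-1 <= sin (pi / (3 * k%:R)) :> R.
Proof.
move=> k2; have pi0 : 0 < pi :> R by exact: pi_gt0.
have k0 : 0 < k%:R :> R by rewrite ltr0n; case: k k2.
set t : R := pi / (6 * k%:R).
have t0 : 0 <= t by rewrite divr_ge0// ltW// mulr_gt0.
have kt : k%:R * t = pi / 6 by rewrite /t; field; rewrite gt_eqF.
have H j : (2 <= j <= k)%N -> 2 * sin (j%:R * t) <= j%:R * sin (2 * t).
  elim: j => // j IH /andP[j2 jk].
  have [->|j1] := eqVneq j 1%N; first by [].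
  have {}j2 : (2 <= j)%N by case: j j2 j1 {IH jk} => [|[]].
  have := IH _; rewrite j2 (ltnW jk) => /(_ isT) {}IH.
  have j0 : 0 < j%:R :> R by rewrite ltr0n; case: j j2 {IH jk j1}.
  have : j%:R * sin (j.+1%:R * t) <= j.+1%:R * sin (j%:R * t).
    apply: sin_ratio => //.
    apply: (@le_trans _ _ (k%:R * t)); last by rewrite kt; lra.
    by rewrite ler_wpM2r// ler_nat ltnW.
  move: IH j0.
  move: (sin (2 * t)) (sin (j%:R * t)) (sin (j.+1%:R * t)) => A B C.
  rewrite -!(natr1 j); move: (j%:R) => J IH J0 JC.
  have : 0 <= (J + 1) * (J * A - 2 * B) by apply: mulr_ge0; lra.
  by rewrite -(ler_pM2l J0 (2 * C)); nra.
have := H k; rewrite k2 leqnn => /(_ isT); rewrite kt sin_pi_6.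
have -> : 2 * t = pi / (3 * k%:R) by rewrite /t; field; rewrite gt_eqF.
rewrite mul1r mulfV// mulrC -ler_pdivrMr// mul1r; exact.
Qed.

(** The sine increases up to [pi / 2] and is symmetric about it, so the smallest
    value is that of [sin_pi_3k]. *)
Lemma sin_pi_frac (k m : nat) : (2 <= k)%N -> (0 < m < 3 * k)%N ->
  k%:R^-1 <= sin (m%:R * (pi / (3 * k%:R))) :> R.
Proof.
move=> k2; have pi0 : 0 < pi :> R by exact: pi_gt0.
have k0 : 0 < k%:R :> R by rewrite ltr0n; case: k k2.
set t : R := pi / (3 * k%:R).
have t0 : 0 < t by rewrite divr_gt0// mulr_gt0.
have NtE : (3 * k)%:R * t = pi by rewrite /t natrM; field; rewrite gt_eqF.
have base (j : nat) : (0 < j)%N -> j%:R * t <= pi / 2 -> k%:R^-1 <= sin (j%:R * t).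
  move=> j0 jt; apply: (le_trans (sin_pi_3k k2)); rewrite -/t.
  have tj : t <= j%:R * t by rewrite ler_peMl ?ler1n// ltW.
  move: tj; rewrite le_eqVlt => /orP[/eqP <-//|tj].
  by apply: ltW; rewrite ltr_sin// in_itv/=; apply/andP; split; lra.
case/andP=> m0 mN; have [le|gt] := leP (m%:R * t) (pi / 2); first exact: base.
have -> : sin (m%:R * t) = sin ((3 * k - m)%:R * t).
  rewrite natrB 1?ltnW// mulrBl NtE sinB sinpi cospi; ring.
apply: base; first by rewrite subn_gt0.
by rewrite natrB 1?ltnW// mulrBl NtE; lra.
Qed.

(** Each term times [2 sin (a / 2)] is a difference of sines (Dirichlet
    kernel). *)
Lemma sum_cos (a : R) (n : nat) :
  2 * sin (a / 2) * (\sum_(m < n) cos (m%:R * a)) =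
  sin (n%:R * a - a / 2) + sin (a / 2).
Proof.
elim: n => [|n IH]; first by rewrite big_ord0 mulr0 mul0r sub0r sinN addNr.
rewrite big_ord_recr /= mulrDr IH.
have -> : n.+1%:R * a - a / 2 = n%:R * a + a / 2 by rewrite -natr1; field.
by rewrite sinB sinD; ring.
Qed.

Lemma cos_periodn (a : R) (n : nat) : cos (a + n%:R * (2 * pi)) = cos a.
Proof.
elim: n => [|n IH]; first by rewrite mul0r addr0.
rewrite -[RHS]IH -[RHS]cosD2pi; congr cos; rewrite -natr1; ring.
Qed.

Lemma sin_periodn (a : R) (n : nat) : sin (a + n%:R * (2 * pi)) = sin a.
Proof.
elim: n => [|n IH]; first by rewrite mul0r addr0.
rewrite -[RHS]IH -[RHS]sinD2pi; congr sin; rewrite -natr1; ring.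
Qed.

(** In [sum_cos] the two sines cancel, because [n a] is a multiple of [2 pi]. *)
Lemma sum_cos_root (n d : nat) : (0 < d < n)%N ->
  \sum_(m < n) cos (m%:R * (d%:R * (2 * pi / n%:R))) = 0 :> R.
Proof.
case/andP=> d0 dn; have n0 : 0 < n%:R :> R by rewrite ltr0n (ltn_trans d0 dn).
set a := d%:R * _.
have s0 : 0 < sin (a / 2).
  have -> : a / 2 = pi * (d%:R / n%:R) by rewrite /a; field; rewrite gt_eqF.
  apply: sin_gt0_pi; rewrite mulr_gt0 ?pi_gt0 ?divr_gt0 ?ltr0n//= ?(ltn_trans d0 dn)//.
  by rewrite gtr_pMr ?pi_gt0// ltr_pdivrMr// mul1r ltr_nat.
have /eqP := sum_cos a n.
have -> : n%:R * a - a / 2 = - (a / 2) + d%:R * (2 * pi).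
  by rewrite /a; field; rewrite gt_eqF.
by rewrite sin_periodn sinN addNr mulf_eq0 mulf_eq0 (gt_eqF s0) pnatr_eq0/= => /eqP.
Qed.

Lemma sum_cos_diff (n j l : nat) : (j < n)%N -> (l < n)%N ->
  \sum_(m < n) cos (m%:R * ((j%:R - l%:R) * (2 * pi / n%:R))) =
  n%:R *+ (j == l) :> R.
Proof.
move=> jn ln; case: ltngtP => [jl|lj|->] /=.
- rewrite mulr0n -[RHS](@sum_cos_root n (l - j)); last by rewrite subn_gt0 jl (leq_ltn_trans (leq_subr _ _)).
  apply: eq_bigr => m _; rewrite -cosN natrB 1?ltnW//; congr cos; ring.
- rewrite mulr0n -[RHS](@sum_cos_root n (j - l)); last by rewrite subn_gt0 lj (leq_ltn_trans (leq_subr _ _)).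
  by apply: eq_bigr => m _; rewrite natrB 1?ltnW.
- rewrite subrr mul0r (eq_bigr (fun=> 1)); last by move=> m _; rewrite mulr0 cos0.
  by rewrite sumr_const card_ord mulr1n.
Qed.

(** Parseval's identity for the real discrete Fourier transform; the kernel
    may be sampled with any offset [c]. *)
Lemma parseval (x : nat -> R) (n : nat) (c : R) :
  \sum_(m < n) ((\sum_(j < n) x j * cos (m%:R * ((j%:R + c) * (2 * pi / n%:R)))) ^+ 2 +
                (\sum_(j < n) x j * sin (m%:R * ((j%:R + c) * (2 * pi / n%:R)))) ^+ 2)
  = n%:R * \sum_(j < n) x j ^+ 2.
Proof.
pose th : R := 2 * pi / n%:R.
transitivity (\sum_(m < n) \sum_(j < n) \sum_(l < n)
    x j * x l * cos (m%:R * ((j%:R - l%:R) * th))).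
  apply: eq_bigr => m _; rewrite !expr2 !mulr_suml -big_split; apply: eq_bigr => j _.
  rewrite !mulr_sumr -big_split; apply: eq_bigr => l _ /=.
  rewrite -/th; have -> : m%:R * ((j%:R - l%:R) * th) =
     m%:R * ((j%:R + c) * th) - m%:R * ((l%:R + c) * th) by ring.
  by rewrite cosB; ring.
rewrite exchange_big mulr_sumr; apply: eq_bigr => j _ /=.
rewrite exchange_big (bigD1 j)//= [X in _ + X]big1 => [|l lj].
  by rewrite -mulr_sumr sum_cos_diff// eqxx mulr1n addr0; ring.
have /negbTE jl : (j : nat) != l by rewrite eq_sym; exact: lj.
by rewrite -mulr_sumr sum_cos_diff// jl mulr0n mulr0.
Qed.

Lemma sum_shift (f : nat -> R) (n : nat) : f n = f 0%N ->
  \sum_(j < n) f j.+1 = \sum_(j < n) f j.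
Proof.
move=> fn; apply: (addrI (f 0%N)); rewrite -(big_ord_recl _ f).
by rewrite big_ord_recr/= fn addrC.
Qed.

(** Discrete Wirtinger inequality for the sum of three consecutive terms: on
    the frequency [m] this sum acts as multiplication by
    [1 + 2 cos (2 pi m / 3 k)], and the frequency [0] does not occur. *)
Lemma wirtinger3 (x : nat -> R) (k : nat) : (3 <= k)%N ->
  (forall j, x (j + 3 * k)%N = x j) -> \sum_(j < 3 * k) x j = 0 ->
  \sum_(j < 3 * k) (x j + x j.+1 + x j.+2) ^+ 2 <=
  (3 - 4 / k%:R ^+ 2) ^+ 2 * \sum_(j < 3 * k) x j ^+ 2.
Proof.
move=> k3 per s0; set n := (3 * k)%N.
have k0 : 0 < k%:R :> R by rewrite ltr0n; case: k k3 {per s0 n}.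
have n0 : 0 < n%:R :> R by rewrite natrM mulr_gt0.
pose th : R := 2 * pi / n%:R; pose lam (m : nat) : R := 1 + 2 * cos (m%:R * th).
have nth_ : n%:R * th = 2 * pi by rewrite /th; field; rewrite gt_eqF.
(* The transform of the sums is sampled with offset 1, the index of the middle
   term, so that the factor [lam m] is real. *)
have E (g : R -> R) (m : nat) : (forall t, g (t + m%:R * (2 * pi)) = g t) ->
    (forall t, g (t + m%:R * th) + g (t - m%:R * th) = 2 * cos (m%:R * th) * g t) ->
  \sum_(j < n) (x j + x j.+1 + x j.+2) * g (m%:R * ((j%:R + 1) * th)) =
  lam m * \sum_(j < n) x j * g (m%:R * ((j%:R + 0) * th)).
  move=> gp gs; pose f c j : R := x j * g (m%:R * ((j%:R + c) * th)).
  have fn c : f c n = f c 0%N.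
    rewrite /f -[n in x n]add0n per; congr (_ * _).
    rewrite -[RHS]gp; congr g; rewrite -nth_; ring.
  have sh c : \sum_(j < n) f c j.+1 = \sum_(j < n) f c j by exact: sum_shift.
  have -> : \sum_(j < n) (x j + x j.+1 + x j.+2) * g (m%:R * ((j%:R + 1) * th)) =
    \sum_(j < n) f 1 j + \sum_(j < n) f 0 j.+1 + \sum_(j < n) f (-1) j.+2.
    rewrite -!big_split; apply: eq_bigr => j _; rewrite /f (mulrDl (x j + x j.+1)) (mulrDl (x j)); congr (_ + _ + _).
      by congr (_ * g (_ * (_ * _))); rewrite -(natr1 j) addr0.
    by congr (_ * g (_ * (_ * _))); rewrite -(natr1 j.+1) -(natr1 j) addrK.
  rewrite (sum_shift (f := fun j => f (-1) j.+1)); last first.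
    rewrite /f -[n.+1]add1n per; congr (_ * _).
    rewrite -[RHS]gp; congr g; rewrite -nth_ natrD; ring.
  rewrite !sh mulr_sumr -!big_split; apply: eq_bigr => j _; rewrite /f /= /lam.
  set t := m%:R * ((j%:R + 0) * th).
  have -> : m%:R * ((j%:R + 1) * th) = t + m%:R * th by rewrite /t; ring.
  have -> : m%:R * ((j%:R + -1) * th) = t - m%:R * th by rewrite /t; ring.
  have := gs t; move: (g (t + m%:R * th)) (g (t - m%:R * th)) (g t) => u v w uv.
  transitivity (x j * (w + (u + v))); first by ring.
  by rewrite uv; ring.
have Ec m := E cos m (fun t => cos_periodn t m).
have Es m := E sin m (fun t => sin_periodn t m).
have lamle (m : 'I_n) : m != 0%N :> nat -> lam m ^+ 2 <= (3 - 4 / k%:R ^+ 2) ^+ 2.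
  move=> m0; have : k%:R^-1 <= sin (m%:R * (pi / (3 * k%:R))) :> R.
    by apply: sin_pi_frac; [exact: ltnW|rewrite lt0n m0 /= ltn_ord].
  have -> : 4 / k%:R ^+ 2 = 4 * (k%:R^-1) ^+ 2 :> R by rewrite exprVn.
  rewrite /lam; have -> : m%:R * th = (m%:R * (pi / (3 * k%:R))) *+ 2.
    by rewrite /th natrM; field; rewrite gt_eqF.
  rewrite cos_mulr2n cos2sin2; have := @sin_le1 R (m%:R * (pi / (3 * k%:R))).
  have : k%:R^-1 <= 3^-1 :> R by rewrite lef_pV2 ?posrE// ler_nat.
  have : 0 < k%:R^-1 :> R by rewrite invr_gt0.
  move: (sin _) (k%:R^-1) => s q q0 q3 s1 qs.
  have s0' : 0 <= s by lra.
  have s2 : q ^+ 2 <= s ^+ 2 by rewrite !expr2; apply: ler_pM => //; exact: ltW.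
  have s3 : s ^+ 2 <= 1 by rewrite expr2 -[leRHS]mulr1; apply: ler_pM.
  have q2 : q ^+ 2 <= 3^-1 * 3^-1 by rewrite expr2; apply: ler_pM => //; exact: ltW.
  have -> : 1 + 2 * ((1 - s ^+ 2) *+ 2 - 1) = 3 - 4 * s ^+ 2 by ring.
  move: (s ^+ 2) (q ^+ 2) s2 s3 q2 => A B AB A1 B9.
  have : 0 <= (A - B) * (6 - 4 * B - 4 * A) by apply: mulr_ge0; lra.
  by rewrite !expr2; nra.
have P1 := parseval (fun j => x j + x j.+1 + x j.+2) n 1.
rewrite -(ler_pM2l n0) -P1 mulrCA -(parseval x n 0).
rewrite mulr_sumr; apply: ler_sum => m _.
rewrite -/th Ec; last by move=> t; rewrite cosD cosB; ring.
rewrite Es; last by move=> t; rewrite sinD sinB; ring.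
rewrite !exprMn -mulrDr.
have [m0|m0] := eqVneq (m : nat) 0%N; last first.
  by rewrite ler_wpM2r ?lamle// addr_ge0// sqr_ge0.
have -> : \sum_(j < n) x j * cos (m%:R * ((j%:R + 0) * th)) = 0.
  by rewrite -[RHS]s0; apply: eq_bigr => j _; rewrite m0 mul0r cos0 mulr1.
rewrite [X in _ + X ^+ 2]big1 => [|j _]; last by rewrite m0 mul0r sin0 mulr0.
by rewrite expr0n addr0 !mulr0.
Qed.

End Trig.

(** * Euclidean norm, polygonal paths and chain curves *)

Section Euclid.
Variables (R : realType) (d : nat).
Implicit Types (x y z v : 'rV[R]_d) (t s : R).

Definition enorm v : R := edist v 0.

Lemma enormE v : enorm v = Num.sqrt (\sum_(j < d) v ord0 j ^+ 2).
Proof. by congr Num.sqrt; apply: eq_bigr => j _; rewrite mxE subr0. Qed.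

Lemma edistE x y : edist x y = enorm (x - y).
Proof. by rewrite enormE; congr Num.sqrt; apply: eq_bigr => j _; rewrite !mxE. Qed.

Lemma enorm_ge0 v : 0 <= enorm v. Proof. exact: sqrtr_ge0. Qed.

Lemma edist_ge0 x y : 0 <= edist x y. Proof. exact: sqrtr_ge0. Qed.

Lemma enorm_sq v : enorm v ^+ 2 = \sum_(j < d) v ord0 j ^+ 2.
Proof. by rewrite enormE sqr_sqrtr// sumr_ge0// => j _; exact: sqr_ge0. Qed.

Lemma enormZ t v : enorm (t *: v) = `|t| * enorm v.
Proof.
rewrite !enormE -sqrtr_sqr -sqrtrM ?sqr_ge0// mulr_sumr.
by congr Num.sqrt; apply: eq_bigr => j _; rewrite mxE exprMn.
Qed.

Lemma enormN v : enorm (- v) = enorm v.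
Proof. by rewrite -scaleN1r enormZ normrN1 mul1r. Qed.

Lemma enorm0 : enorm 0 = 0 :> R.
Proof. by rewrite -[0 in LHS](scale0r 0) enormZ normr0 mul0r. Qed.

Lemma enorm_eq0 v : enorm v = 0 -> v = 0.
Proof.
move=> v0; have := enorm_sq v; rewrite v0 expr0n/= => /esym/eqP.
rewrite psumr_eq0 => [/allP v0'|j _]; last exact: sqr_ge0.
apply/rowP => j; rewrite mxE; apply/eqP.
by have := v0' j (mem_index_enum _); rewrite sqrf_eq0.
Qed.

Lemma le_coord_enorm v j : `|v ord0 j| <= enorm v.
Proof.
rewrite -[leRHS]ger0_norm ?enorm_ge0// -ler_sqr ?nnegrE// !real_normK ?num_real//.
by rewrite enorm_sq (bigD1 j)//= lerDl sumr_ge0// => i _; exact: sqr_ge0.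
Qed.

(** The difference of the two sides is half a sum of squares (Lagrange's
    identity). *)
Lemma cauchy_schwarz (n : nat) (a b : 'I_n -> R) :
  (\sum_i a i * b i) ^+ 2 <= (\sum_i a i ^+ 2) * (\sum_i b i ^+ 2).
Proof.
have : 0 <= \sum_i \sum_j (a i * b j - a j * b i) ^+ 2.
  by apply: sumr_ge0 => i _; apply: sumr_ge0 => j _; exact: sqr_ge0.
have -> : \sum_i \sum_j (a i * b j - a j * b i) ^+ 2 =
    \sum_i \sum_j (a i ^+ 2 * b j ^+ 2) + \sum_i \sum_j (a j ^+ 2 * b i ^+ 2)
    - 2 * \sum_i \sum_j (a i * b i) * (a j * b j).
  rewrite mulr_sumr -big_split -sumrB; apply: eq_bigr => i _ /=.
  rewrite mulr_sumr -big_split -sumrB; apply: eq_bigr => j _ /=; ring.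
rewrite [X in _ + X - _]exchange_big/=.
have -> : \sum_i \sum_j (a i ^+ 2 * b j ^+ 2) = (\sum_i a i ^+ 2) * (\sum_i b i ^+ 2).
  by rewrite mulr_suml; apply: eq_bigr => i _; rewrite mulr_sumr.
have -> : \sum_i \sum_j (a i * b i) * (a j * b j) = (\sum_i a i * b i) ^+ 2.
  by rewrite expr2 mulr_suml; apply: eq_bigr => i _; rewrite mulr_sumr.
lra.
Qed.

Lemma enormD x y : enorm (x + y) <= enorm x + enorm y.
Proof.
rewrite -ler_sqr ?nnegrE ?addr_ge0 ?enorm_ge0//.
have -> : enorm (x + y) ^+ 2 = enorm x ^+ 2 + 2 * (\sum_j x ord0 j * y ord0 j) + enorm y ^+ 2.
  rewrite !enorm_sq mulr_sumr -!big_split; apply: eq_bigr => j _ /=; rewrite mxE; ring.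
have : \sum_j x ord0 j * y ord0 j <= enorm x * enorm y.
  apply: (le_trans (ler_norm _)).
  rewrite -ler_sqr ?nnegrE ?mulr_ge0 ?enorm_ge0// real_normK ?num_real//.
  by rewrite exprMn !enorm_sq; exact: cauchy_schwarz.
by move=> h; rewrite sqrrD; lra.
Qed.

Lemma edistxx x : edist x x = 0.
Proof. by rewrite edistE subrr enorm0. Qed.

Lemma edistC x y : edist x y = edist y x.
Proof. by rewrite !edistE -enormN opprB. Qed.

Lemma edist_triangle y x z : edist x z <= edist x y + edist y z.
Proof. by rewrite !edistE -(subrK y x) -addrA addrK enormD. Qed.

Lemma edist_eq0 x y : edist x y <= 0 -> x = y.
Proof.
move=> xy; apply/eqP; rewrite -subr_eq0; apply/eqP; apply: enorm_eq0.
by rewrite -edistE; apply: le_anti; rewrite xy edist_ge0.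
Qed.

Lemma mx_norm_le_enorm v : `|v| <= enorm v.
Proof.
rewrite -[leLHS]/(mx_norm v) mx_normrE; apply: bigmax_le => [|[i j] _ /=]; first exact: enorm_ge0.
by rewrite ord1; exact: le_coord_enorm.
Qed.

End Euclid.

Section Path.
Variables (R : realType) (d : nat) (V : nat -> 'rV[R]_d).
Implicit Types (t s : R) (i j : nat).

Definition edge_len i : R := edist (V i.+1) (V i).
Definition prefix_len i : R := \sum_(j < i) edge_len j.
Definition pt i t : 'rV[R]_d := V i + t *: (V i.+1 - V i).
Definition pos i t : R := prefix_len i + t * edge_len i.

Lemma edge_len_ge0 i : 0 <= edge_len i. Proof. exact: edist_ge0. Qed.

Lemma prefix_lenS i : prefix_len i.+1 = prefix_len i + edge_len i.
Proof. by rewrite /prefix_len big_ord_recr. Qed.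

Lemma prefix_len_le : {homo prefix_len : i j / (i <= j)%N >-> i <= j}.
Proof.
by apply: homo_leq => [//|? ? ?|i]; [exact: le_trans|rewrite prefix_lenS lerDl edge_len_ge0].
Qed.

Lemma pt0 i : pt i 0 = V i. Proof. by rewrite /pt scale0r addr0. Qed.

Lemma pt1 i : pt i 1 = V i.+1. Proof. by rewrite /pt scale1r subrKC. Qed.

Lemma pos0 i : pos i 0 = prefix_len i. Proof. by rewrite /pos mul0r addr0. Qed.

Lemma edist_pt i s t : edist (pt i t) (pt i s) = `|t - s| * edge_len i.
Proof.
rewrite /edge_len !edistE -enormZ /pt; congr enorm.
by rewrite opprD addrACA subrr add0r scalerBl.
Qed.

Definition before i s j t := (i < j)%N \/ i = j /\ s <= t.

Lemma edist_V i j : (i <= j)%N -> edist (V j) (V i) <= prefix_len j - prefix_len i.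
Proof.
elim: j => [|j IH]; first by rewrite leqn0 => /eqP ->; rewrite edistxx subrr.
rewrite leq_eqVlt => /orP[/eqP ->|]; first by rewrite edistxx subrr.
rewrite ltnS => /IH {}IH; apply: (le_trans (edist_triangle (V j) _ _)).
by rewrite prefix_lenS -/(edge_len j); lra.
Qed.

(** The upper bound makes the position Lipschitz in time for a path with edges
    of bounded length, hence [chain_continuous]. *)
Lemma before_pos (K : R) i s j t : before i s j t -> 0 <= s <= 1 -> 0 <= t <= 1 ->
  (forall a, edge_len a <= K) ->
  pos i s <= pos j t <= pos i s + K * ((j%:R + t) - (i%:R + s)).
Proof.
move=> + /andP[s0 s1] /andP[t0 t1] lenK; case=> [ij|[-> st]]; rewrite /pos; last first.
  have := edge_len_ge0 j; have := lenK j; move: (edge_len j) => l lK l0.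
  have : 0 <= (t - s) * l /\ 0 <= (t - s) * (K - l) by split; apply: mulr_ge0; lra.
  by nra.
have H : prefix_len i.+1 <= prefix_len j <= prefix_len i.+1 + K * (j%:R - i.+1%:R).
  elim: j ij => // j IH; rewrite ltnS leq_eqVlt => /orP[/eqP ->|/IH].
    by rewrite subrr mulr0 addr0 lexx.
  rewrite (prefix_lenS j) -(natr1 j); have := edge_len_ge0 j; have := lenK j; nra.
move: H; rewrite prefix_lenS -(natr1 i).
have := edge_len_ge0 i; have := edge_len_ge0 j; have := lenK i; have := lenK j.
have : 0 <= (1 - s) * edge_len i by rewrite mulr_ge0 ?edge_len_ge0// subr_ge0.
have : 0 <= (1 - s) * (K - edge_len i) by rewrite mulr_ge0 ?subr_ge0.
have : 0 <= t * (K - edge_len j) by rewrite mulr_ge0 ?subr_ge0.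
have : 0 <= t * edge_len j by rewrite mulr_ge0 ?edge_len_ge0.
by nra.
Qed.

Lemma edist_path i s j t : before i s j t -> 0 <= s <= 1 -> 0 <= t <= 1 ->
  edist (pt j t) (pt i s) <= pos j t - pos i s.
Proof.
case=> [ij|[-> st]] /andP[s0 s1] /andP[t0 t1]; rewrite /pos; last first.
  by rewrite edist_pt ger0_norm ?subr_ge0//; lra.
apply: (le_trans (edist_triangle (V j) _ _)).
rewrite -[V j]pt0 edist_pt subr0 ger0_norm// pt0.
apply: (@le_trans _ _ (t * edge_len j + (edist (V j) (V i.+1) + edist (V i.+1) (pt i s)))).
  by rewrite lerD2l edist_triangle.
have -> : edist (V i.+1) (pt i s) = (1 - s) * edge_len i.
  by rewrite -pt1 edist_pt ger0_norm ?subr_ge0.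
by have := edist_V ij; rewrite prefix_lenS; lra.
Qed.

End Path.

Section ChainCurve.
Variables (R : realType) (d : nat) (p : seq 'rV[R]_d).

Definition cyc (i : nat) : 'rV[R]_d := nth 0 p (i %% size p).

Hypothesis p0 : (0 < size p)%N.
Let n := size p.

Lemma truncn_frac (u : R) : 0 <= u -> 0 <= u - (Num.truncn u)%:R <= 1.
Proof. by move=> /truncn_itv /andP[h1 h2]; rewrite -natr1 in h2; lra. Qed.

Lemma before_trunc (u v : R) : 0 <= u -> u <= v ->
  before (Num.truncn u) (u - (Num.truncn u)%:R) (Num.truncn v) (v - (Num.truncn v)%:R).
Proof.
move=> u0 uv; have := le_truncn uv; rewrite leq_eqVlt => /orP[/eqP E|]; last by left.
by right; split => //; rewrite E lerD2r.
Qed.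

(** The length run through up to the time [t]. *)
Definition cpos (t : R) : R :=
  pos cyc (Num.truncn (t * n%:R)) (t * n%:R - (Num.truncn (t * n%:R))%:R).

Lemma chain_curveE (t : R) : chain_curve p t =
  pt cyc (Num.truncn (t * n%:R)) (t * n%:R - (Num.truncn (t * n%:R))%:R).
Proof. by []. Qed.

Lemma chain_curve_dist (s t : R) : 0 <= s -> s <= t ->
  edist (chain_curve p t) (chain_curve p s) <= cpos t - cpos s.
Proof.
move=> s0 st; have sn0 : 0 <= s * n%:R by rewrite mulr_ge0.
have stn : s * n%:R <= t * n%:R by rewrite ler_wpM2r.
rewrite !chain_curveE; apply: edist_path; first exact: before_trunc.
- exact: truncn_frac.
- by apply: truncn_frac; exact: le_trans stn.
Qed.

Lemma cpos0 : cpos 0 = 0.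
Proof. by rewrite /cpos mul0r truncn0 subrr pos0 /prefix_len big_ord0. Qed.

Lemma cpos1 : cpos 1 = prefix_len cyc n.
Proof. by rewrite /cpos mul1r natrK subrr pos0. Qed.

Lemma chain_closed : chain_curve p 0 = chain_curve p 1.
Proof.
rewrite !chain_curveE mul0r truncn0 subrr mul1r natrK subrr !pt0.
by rewrite /cyc mod0n modnn.
Qed.

Lemma chain_continuous : {within `[0, 1]%classic, continuous (chain_curve p)}.
Proof.
pose K := \sum_(j < n) edge_len cyc j.
have lenK i : edge_len cyc i <= K.
  have -> : edge_len cyc i = edge_len cyc (i %% n).
    have E : ((i %% n).+1 %% size p = i.+1 %% size p)%N by rewrite -(addn1 (i %% n)) -(addn1 i) modnDml.
    have E' : ((i %% n) %% size p = i %% size p)%N by rewrite modn_mod.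
    rewrite /edge_len; congr (edist _ _); first by rewrite /cyc E.
    by rewrite /cyc E'.
  rewrite /K (bigD1 (Ordinal (ltn_pmod i p0)))//= lerDl sumr_ge0// => j _.
  exact: edge_len_ge0.
have K0 : 0 <= K by exact: (le_trans (edge_len_ge0 _ 0)).
have lip s t : 0 <= s -> s <= t ->
    `|chain_curve p t - chain_curve p s| <= (K * n%:R) * (t - s).
  move=> s0 st; have sn0 : 0 <= s * n%:R by rewrite mulr_ge0.
  have stn : s * n%:R <= t * n%:R by rewrite ler_wpM2r.
  apply: (le_trans (mx_norm_le_enorm _)); rewrite -edistE.
  apply: (le_trans (chain_curve_dist s0 st)).
  have /andP[_] := before_pos (before_trunc sn0 stn) (truncn_frac sn0)
    (truncn_frac (le_trans sn0 stn)) lenK.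
  rewrite -/(cpos _) -/(cpos _); lra.
have {}lip s t : s \in `[0, 1] -> t \in `[0, 1] ->
    `|chain_curve p s - chain_curve p t| <= (K * n%:R) * `|s - t|.
  rewrite !in_itv/= => /andP[s0 _] /andP[t0 _].
  case: (leP s t) => [st|/ltW ts].
    by rewrite distrC [`|s - t|]distrC (ger0_norm (_ : 0 <= t - s)) ?subr_ge0// lip.
  by rewrite (ger0_norm (_ : 0 <= s - t)) ?subr_ge0// lip.
apply/subspace_continuousP => s s01; apply/cvgrPdist_lt => e e0.
have M0 : 0 < K * n%:R + 1 by rewrite ltr_wpDl// mulr_ge0.
near=> t.
apply: (le_lt_trans (lip s t s01 _)); first by near: t; exact: withinT.
have st : `|s - t| < e / (K * n%:R + 1).
  near: t; apply: (cvg_within (F := nbhs s)); apply/nbhs_ballP.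
  by exists (e / (K * n%:R + 1)) => //=; rewrite divr_gt0.
rewrite ltr_pdivlMr// in st; apply: le_lt_trans st.
by rewrite mulrC ler_wpM2l// lerDl.
Unshelve. all: by end_near. Qed.

(** By [chain_curve_dist], every inscribed length telescopes to at most the
    total length. *)
Lemma chain_length : (curve_length (chain_curve p) <= (prefix_len cyc n)%:E)%E.
Proof.
apply: ge_ereal_sup => /= _ [s [ps /eqP ls] <-]; rewrite lee_fin /inscribed_length.
have -> : prefix_len cyc n = cpos (nth 1 (0 :: s) (size s)) - cpos (nth 1 (0 :: s) 0).
  by rewrite -(last_nth 1) ls cpos1 /= cpos0 subr0.
rewrite -(telescope_sumr (cpos \o nth 1 (0 :: s))) //.
rewrite ler_sum_nat// => i /andP[_ ilt].
have srt : sorted <=%R (0 :: s) by apply: sub_path ps => ? ? /ltW.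
have nth_le a b : (a <= b <= size s)%N -> nth 1 (0 :: s) a <= nth 1 (0 :: s) b.
  by case/andP=> ab bs; apply: (sorted_leq_nth le_trans le_refl) => //=; rewrite inE ltnS// (leq_trans ab).
apply: chain_curve_dist; last by apply: nth_le; rewrite leqnSn.
exact: (nth_le 0%N i (ltnW ilt)).
Qed.
End ChainCurve.

(** * Lengths of subdivided curves *)

Section PathSum.
Variables (T : Type) (V : nmodType) (f : T -> T -> V).

Fixpoint pathsum (x : T) (s : seq T) : V :=
  if s is y :: r then f x y + pathsum y r else 0.

Lemma pathsumE (x0 x : T) (s : seq T) :
  pathsum x s = \sum_(0 <= i < size s) f (nth x0 (x :: s) i) (nth x0 (x :: s) i.+1).
Proof.
elim: s x => [|y r IH] x /=; first by rewrite big_geq.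
by rewrite big_nat_recl// IH.
Qed.

Lemma pathsum_cat x s1 s2 : pathsum x (s1 ++ s2) = pathsum x s1 + pathsum (last x s1) s2.
Proof. by elim: s1 x => [|y r IH] x /=; rewrite ?add0r// IH addrA. Qed.

End PathSum.

Section CurvePieces.
Variables (R : realType) (d : nat) (g : R -> 'rV[R]_d) (L : R).
Hypothesis gL : (curve_length g <= L%:E)%E.

Let gd (s t : R) : R := edist (g t) (g s).

(** Repeated subdivision points contribute nothing, so subdivisions need not be
    strict, nor reach the endpoints. *)
Lemma length_subdivision (s : seq R) : path <=%R 0 s -> all (fun t => t <= 1) s ->
  pathsum gd 0 s <= L.
Proof.
move=> ps s1; suff [s' [ps' ls' le]] : exists s', [/\ path <%R 0 s', last 0 s' == 1 &
    pathsum gd 0 s <= pathsum gd 0 s'].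
  apply: (le_trans le); rewrite -lee_fin; apply: le_trans gL.
  apply: ereal_sup_ubound; exists s'; first by split.
  by rewrite /inscribed_length (pathsumE _ 1).
have : 0 <= 1 :> R by [].
elim: s 0 ps s1 => [|y r IH] x /=.
  move=> _ _; rewrite le_eqVlt => /orP[/eqP <-|x1]; first by exists [::].
  exists [:: 1]; split; rewrite /= ?x1// addr0. exact: edist_ge0.
case/andP=> xy pr /andP[y1 r1] x1; have [s' [ps' ls' le]] := IH y pr r1 y1.
move: xy; rewrite le_eqVlt => /orP[/eqP E|xy].
  by exists s'; rewrite E; split => //; rewrite /gd edistxx add0r.
by exists (y :: s'); rewrite /= xy; split => //; rewrite lerD2l.
Qed.

Lemma length_ge0 : 0 <= L.
Proof. exact: (@length_subdivision [::]). Qed.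

Lemma length_chord (s t : R) : 0 <= s <= 1 -> 0 <= t <= 1 -> edist (g s) (g t) <= L.
Proof.
wlog st : s t / t <= s => [H|/andP[s0 s1] /andP[t0 t1]].
  by move=> s01 t01; case: (leP t s) => [|/ltW] st; [|rewrite edistC]; exact: H.
have := @length_subdivision [:: t; s]; rewrite /= t0 st s1 t1 => /(_ isT isT).
by rewrite addr0; apply: le_trans; rewrite lerDr edist_ge0.
Qed.

Definition piece (n m : nat) : set R := `[m%:R / n.+1%:R, m.+1%:R / n.+1%:R].

Lemma piece01 n m t : (m <= n)%N -> piece n m t -> 0 <= t <= 1.
Proof.
rewrite /piece/= in_itv/= => mn /andP[h1 h2]; apply/andP; split.
  by apply: le_trans h1; rewrite divr_ge0.
by rewrite (le_trans h2)// ler_pdivrMr// mul1r ler_nat.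
Qed.

(** The chords chosen in the pieces, at the cost of an arbitrarily small total
    error, are steps of one subdivision of the curve. *)
Lemma length_pieces (n : nat) (B : nat -> R) :
  (forall m e, (m <= n)%N -> 0 < e -> exists s t,
     [/\ piece n m s, piece n m t & B m - e <= edist (g s) (g t)]) ->
  \sum_(m < n.+1) B m <= L.
Proof.
move=> HB; apply/ler_addgt0Pr => e e0.
pose e' := e / n.+1%:R; have e'0 : 0 < e' by rewrite divr_gt0.
suff : \sum_(m < n.+1) (B m - e') <= L.
  rewrite sumrB sumr_const card_ord -mulr_natl mulrCA mulfV// mulr1; lra.
have [u [v uv]] : exists u v : nat -> R, forall m, (m <= n)%N ->
    [/\ piece n m (u m), piece n m (v m), u m <= v m & B m - e' <= gd (u m) (v m)].
  have /choice[uv Huv] : forall m, exists uv : R * R, (m <= n)%N ->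
    [/\ piece n m uv.1, piece n m uv.2, uv.1 <= uv.2 & B m - e' <= gd uv.1 uv.2].
    move=> m; case: (leqP m n) => [mn|_]; last by exists (0, 0).
    have [s [t [ms mt Bst]]] := HB _ _ mn e'0.
    have [st|/ltW ts] := leP s t; first by exists (s, t) => _; split => //; rewrite /gd edistC.
    by exists (t, s) => _; split.
  by exists (fun m => (uv m).1), (fun m => (uv m).2).
pose S a M := flatten [seq [:: u m; v m] | m <- iota a M].
suff H M a x : (a + M <= n.+1)%N -> x <= a%:R / n.+1%:R ->
    [/\ path <=%R x (S a M), all (fun t => t <= 1) (S a M) &
     \sum_(a <= m < a + M) (B m - e') <= pathsum gd x (S a M)].
  have [||h1 h2] := H n.+1 0%N 0; rewrite ?mul0r//.
  by rewrite add0n big_mkord => /le_trans; apply; exact: length_subdivision.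
elim: M a x => [|M IH] a x aM xa; first by rewrite addn0 big_geq.
have an : (a <= n)%N by rewrite -ltnS (leq_trans _ aM)// addnS ltnS leq_addr.
have [pu pv auv Bgd] := uv _ an.
have [/andP[u0 u1] /andP[v0 v1]] := (piece01 an pu, piece01 an pv).
move: pu pv; rewrite /piece/= !in_itv/= => /andP[au _] /andP[_ va].
have [|ih1 ih2 ih3] := IH a.+1 (v a) _ va; first by rewrite addSnnS.
rewrite /= (le_trans xa au) auv ih1 u1 v1 ih2; split => //.
rewrite big_ltn ?addnS ?ltnS ?leq_addr// -addSn.
apply: (le_trans (lerD Bgd ih3)); rewrite lerDr; exact: edist_ge0.
Qed.

End CurvePieces.

Section Measure.
Variable R : realType.

(** A set of diameter [D] lies in the interval of length [D] that starts at its
    infimum. *)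
Lemma measure_diam (H : set R) (D : R) : measurable H ->
  (forall h h', H h -> H h' -> `|h - h'| <= D) -> 0 <= D ->
  (lebesgue_measure H <= D%:E)%E.
Proof.
move=> mH HD D0; have [->|/set0P[h0 Hh0]] := eqVneq H set0.
  by rewrite measure0 lee_fin.
have lb : has_lbound H.
  by exists (h0 - D) => h Hh; have := HD _ _ Hh0 Hh; rewrite ler_norml => /andP[]; lra.
have sub : H `<=` `[inf H, inf H + D].
  move=> h Hh; rewrite /= in_itv/=; rewrite ge_inf//= -lerBlDr; apply: lb_le_inf; first by exists h0.
  by move=> h' Hh'; have := HD _ _ Hh Hh'; rewrite ler_norml => /andP[]; lra.
apply: (@le_trans _ _ (lebesgue_measure (`[inf H, inf H + D] : set R))).
  by apply: le_measure; rewrite ?inE.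
rewrite lebesgue_measure_itv/= lte_fin; case: ifP => _.
  by rewrite -EFinB lee_fin; lra.
by rewrite lee_fin.
Qed.

End Measure.

(** * Traces of a curve on a line *)

Section Trace.
Variables (R : realType) (d : nat) (g : R -> 'rV[R]_d) (L : R).
Hypothesis gc : {within `[0, 1], continuous g}.
Hypothesis gL : (curve_length g <= L%:E)%E.

(** The part of the line [h |-> o + h *: r] that a piece of the curve meets, in
    terms of [h]. *)
Definition trace (n m : nat) (o r : 'rV[R]_d) : set R :=
  [set h | exists2 t, piece n m t & g t = o + h *: r].

Lemma line_continuous (o r : 'rV[R]_d) : continuous (fun h : R => o + h *: r).
Proof.
by move=> h; apply: cvgD; [exact: cvg_cst|apply: cvgZr_tmp; exact: cvg_id].
Qed.

Lemma trace_closed n m o r : (m <= n)%N -> closed (trace n m o r).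
Proof.
move=> mn.
have -> : trace n m o r = (fun h => o + h *: r) @^-1` (g @` piece n m).
  by apply/seteqP; split=> h /= [t pt gt]; exists t.
apply: closed_comp; first by move=> h _; exact: line_continuous.
apply: compact_closed; first exact: norm_hausdorff.
apply: continuous_compact; last exact: segment_compact.
apply: continuous_subspaceW gc => t /(piece01 mn).
by rewrite /= in_itv.
Qed.

Lemma measurable_trace n m o r : (m <= n)%N -> measurable (trace n m o r).
Proof. by move=> mn; apply: closed_measurable; exact: trace_closed. Qed.

Lemma trace_dist n m o r h h' : trace n m o r h -> trace n m o r h' ->
  exists s t, [/\ piece n m s, piece n m t & edist (g s) (g t) = `|h - h'| * enorm r].
Proof.
move=> [s ps gs] [t pt gt]; exists s, t; split => //.
by rewrite edistE gs gt opprD addrACA subrr add0r -scalerBl enormZ.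
Qed.

Lemma trace_diam n m o r D : (m <= n)%N -> 0 < enorm r -> 0 <= D ->
  (forall s t, piece n m s -> piece n m t -> edist (g s) (g t) <= D) ->
  (lebesgue_measure (trace n m o r) <= (D / enorm r)%:E)%E.
Proof.
move=> mn r0 D0 HD; apply: measure_diam; first exact: measurable_trace.
  move=> h h' Hh Hh'; have [s [t [ps pt st]]] := trace_dist Hh Hh'.
  by rewrite ler_pdivlMr// -st HD.
by rewrite divr_ge0// ltW.
Qed.

Lemma trace_fin n m o r : (m <= n)%N -> 0 < enorm r ->
  lebesgue_measure (trace n m o r) \is a fin_num.
Proof.
move=> mn r0; rewrite ge0_fin_numE//.
apply: (le_lt_trans (trace_diam o mn r0 (length_ge0 gL) _)); last exact: ltry.
move=> s t ps pt; apply: (length_chord gL); exact: piece01 mn _.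
Qed.

(** A piece has chords as long as [enorm r] times the measure of its trace, up
    to any error; otherwise the diameter of the trace, and so its measure, would
    be smaller. The lines may differ from piece to piece. *)
Lemma length_traces n (o r : nat -> 'rV[R]_d) :
  (\sum_(m < n.+1) (enorm (r m))%:E * lebesgue_measure (trace n m (o m) (r m)) <= L%:E)%E.
Proof.
pose B m := enorm (r m) * fine (lebesgue_measure (trace n m (o m) (r m))).
rewrite (eq_bigr (fun m : 'I_n.+1 => (B m)%:E)); last first.
  move=> m _; have mn : (m <= n)%N by rewrite -ltnS.
  have := enorm_ge0 (r m); rewrite le_eqVlt /B => /orP[/eqP <-|r0].
    by rewrite mul0e mul0r.
  by rewrite EFinM fineK// trace_fin.
rewrite sumEFin lee_fin; apply: (length_pieces gL) => m e mn e0.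
apply: contrapT => H.
have ps : piece n m (m%:R / n.+1%:R : R).
  by rewrite /piece/= in_itv/= lexx/= ler_wpM2r// ler_nat.
have r0 : 0 < enorm (r m).
  rewrite lt0r enorm_ge0 andbT; apply/eqP => r0; apply: H.
  by exists (m%:R / n.+1%:R), (m%:R / n.+1%:R); rewrite /B r0 mul0r edistxx sub0r oppr_le0 ltW.
have lt s t : piece n m s -> piece n m t -> edist (g s) (g t) <= B m - e.
  move=> ps' pt'; rewrite leNgt; apply/negP => lt; apply: H.
  by exists s, t; split => //; exact: ltW.
have D0 : 0 <= B m - e by apply: le_trans (lt _ _ ps ps); rewrite edistxx.
have := trace_diam (o m) mn r0 D0 lt.
rewrite -(fineK (trace_fin (o m) mn r0)) lee_fin ler_pdivlMr// mulrC -/(B m).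
by lra.
Qed.

End Trace.

Lemma card_le_fun (T U : Type) (A : set T) (B : set U) (a0 : T) : (A #<= B)%card -> A a0 ->
  exists f : T -> U, (forall a, A a -> B (f a)) /\
    (forall a b, A a -> A b -> f a = f b -> a = b).
Proof.
move=> /card_leP[phi] Aa0.
pose el a (Aa : A a) : A := SigSub (mem_set Aa).
pose f a : U := match pselect (A a) with
  | left Aa => \val (phi (el a Aa)) | right _ => \val (phi (el a0 Aa0)) end.
exists f; split=> [a Aa|a b Aa Ab].
  by rewrite /f; case: pselect => // Aa'; exact: set_valP.
rewrite /f; case: pselect => // Aa'; case: pselect => // Ab' /val_inj.
by move=> /(inj (in_setT _) (in_setT _)) /(congr1 val).
Qed.

(** Two different times lie in different pieces of every fine enough
    subdivision. *)
Lemma near_truncn_neq (R : realType) (s t : R) : 0 <= s -> 0 <= t -> s != t ->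
  \forall n \near \oo, Num.truncn (s * n.+1%:R) != Num.truncn (t * n.+1%:R).
Proof.
move=> s0 t0 st; have st0 : 0 < `|s - t| by rewrite normr_gt0 subr_eq0.
near=> n; apply/eqP => E.
have n1 : (`|s - t|)^-1 < n.+1%:R.
  near: n; exists (Num.truncn (`|s - t|^-1)).+1 => // n /= ln.
  apply: (lt_le_trans (truncnS_gt _)); rewrite ler_nat; exact: ltnW.
have ns : 0 <= s * n.+1%:R by rewrite mulr_ge0.
have nt : 0 <= t * n.+1%:R by rewrite mulr_ge0.
have := truncn_itv ns; have := truncn_itv nt; rewrite E.
move=> /andP[a1 a2] /andP[b1 b2].
have : `|s - t| * n.+1%:R < 1.
  rewrite -[n.+1%:R]ger0_norm// -normrM mulrBl ltr_norml; rewrite -(natr1 (Num.truncn _)) in a2 b2.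
  by apply/andP; split; lra.
rewrite -ltr_pdivlMl// mulr1; lra.
Unshelve. all: by end_near. Qed.

(** * A covering is at least as long as the chain *)

(** The multiples [i%:R] with [i < size q] are too many points to be all
    roots. *)
Lemma poly_nonroot (R : numFieldType) (q : {poly R}) : q != 0 -> exists W, q.[W] != 0.
Proof.
move=> q0; apply: contrapT => H.
pose rs : seq R := [seq i%:R | i <- iota 0 (size q)].
have := @max_poly_roots _ q rs q0; rewrite size_map size_iota ltnn; case/(_ _ _)/notF.
  apply/allP => x _; apply/rootP/eqP/negPn/negP => qx; apply: H; by exists x.
by rewrite map_inj_uniq ?iota_uniq// => i j /eqP; rewrite eqr_nat => /eqP.
Qed.

Section LowerBound.
Variables (R : realType) (d : nat) (p : seq 'rV[R]_d).
Hypothesis p0 : (0 < size p)%N.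
Local Notation N := (size p).
Local Notation a j := (cyc p j).
Local Notation v j := (cyc p j.+1 - cyc p j).
Variable W : R.
Let w (x : 'rV[R]_d) : R := (rVpoly x).[W].
Hypothesis Wv : forall j, (j < N)%N -> v j != 0 -> w (v j) != 0.

Let wD x y : w (x + y) = w x + w y. Proof. by rewrite /w linearD hornerD. Qed.
Let wZ t x : w (t *: x) = t * w x. Proof. by rewrite /w linearZ hornerZ. Qed.
Let wB x y : w (x - y) = w x - w y.
Proof. by rewrite wD -scaleN1r wZ mulN1r. Qed.

(** The line through the edge [j] is [h |-> org j + h *: dir j], where [h] is
    the value of [w]. Edges on the same line get equal [org] and [dir], so that
    pieces need to be charged only to lines. *)
Definition dir j : 'rV[R]_d := (w (v j))^-1 *: v j.
Definition org j : 'rV[R]_d := a j - w (a j) *: dir j.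

Lemma w_line j h : (j < N)%N -> v j != 0 -> w (org j + h *: dir j) = h.
Proof.
move=> jN vj; rewrite /org wD wB !(wZ _ (dir j)).
have -> : w (dir j) = 1 by rewrite /dir wZ mulVf// Wv.
by ring.
Qed.

Lemma pt_line j t : (j < N)%N -> v j != 0 ->
  pt (cyc p) j t = org j + w (pt (cyc p) j t) *: dir j.
Proof.
move=> jN vj; rewrite /pt wD wZ /org scalerDl -addrA [X in _ = _ + X]addrA addNr add0r.
by rewrite /dir scalerA -mulrA mulfV ?mulr1// Wv.
Qed.

Lemma edge_len_dir j : (j < N)%N -> v j != 0 -> edge_len (cyc p) j = enorm (dir j) * `|w (v j)|.
Proof.
move=> jN vj; rewrite /dir enormZ normfV mulrAC mulVf ?mul1r ?normr_eq0 ?Wv//.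
by rewrite /edge_len edistE.
Qed.

(** The values of [w] on the interior of the edge. A degenerate edge has an
    empty shadow, the quotient being 0. *)
Definition shadow j : set R := [set h | 0 < (h - w (a j)) / w (v j) < 1].

Lemma shadow_itv j : shadow j =
  `]Num.min (w (a j)) (w (a j) + w (v j)), Num.max (w (a j)) (w (a j) + w (v j))[%classic.
Proof.
apply/seteqP; split=> h; rewrite /shadow /= in_itv/=;
  have [v0|v0|v0] := ltgtP (w (v j)) 0.
- rewrite ltr_ndivlMr// ltr_ndivrMr// mul0r mul1r => /andP[h1 h2].
  rewrite gt_min lt_max; apply/andP; split; apply/orP; [right|left]; lra.
- rewrite ltr_pdivlMr// ltr_pdivrMr// mul0r mul1r => /andP[h1 h2].
  rewrite gt_min lt_max; apply/andP; split; apply/orP; [left|right]; lra.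
- by rewrite v0 invr0 mulr0 ltxx.
- rewrite ltr_ndivlMr// ltr_ndivrMr// mul0r mul1r gt_min lt_max.
  by move=> /andP[/orP[]h1/orP[]h2]; apply/andP; split; lra.
- rewrite ltr_pdivlMr// ltr_pdivrMr// mul0r mul1r gt_min lt_max.
  by move=> /andP[/orP[]h1/orP[]h2]; apply/andP; split; lra.
- by rewrite v0 addr0 minxx maxxx => /andP[h1 /(lt_trans h1)]; rewrite ltxx.
Qed.

Lemma measurable_shadow j : measurable (shadow j).
Proof. by rewrite shadow_itv; exact: measurable_itv. Qed.

Lemma shadow_measure j (F : set R) : finite_set F ->
  (lebesgue_measure (shadow j `\` F) = `|w (v j)|%:E)%E.
Proof.
move=> finF.
have mF : measurable F.
  by apply: countable_measurable => //; exact: finite_set_countable.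
have F0 : lebesgue_measure F = 0%E.
  by apply: countable_lebesgue_measure0; exact: finite_set_countable.
have mS := measurable_shadow j.
have Sfin : (lebesgue_measure (shadow j) < +oo)%E.
  rewrite shadow_itv lebesgue_measure_itv/=; case: ifP => _; exact: ltry.
have -> : lebesgue_measure (shadow j `\` F) = lebesgue_measure (shadow j).
  rewrite measureD//; set x := (X in (_ - X)%E); suff -> : x = 0%E by rewrite sube0.
  apply/eqP; rewrite -measure_le0 -F0; apply: le_measure; rewrite ?inE//.
  exact: measurableI.
rewrite shadow_itv lebesgue_measure_itv/= lte_fin.
have [v0|v0|v0] := ltgtP (w (v j)) 0.
- rewrite min_r ?max_l; [|lra|lra]; rewrite ifT; last lra.
  by rewrite -EFinB ltr0_norm//; congr EFin; lra.
- rewrite min_l ?max_r; [|lra|lra]; rewrite ifT; last lra.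
  by rewrite -EFinB gtr0_norm//; congr EFin; lra.
- by rewrite v0 addr0 minxx maxxx ltxx normr0.
Qed.

(** The values of [w] at which two different lines meet. Two such lines meet for
    at most one value, since both are parametrized by [w]. *)
Definition crossings : set R :=
  \bigcup_(jj in [set: 'I_N * 'I_N]) [set h | (org jj.1, dir jj.1) <> (org jj.2, dir jj.2) /\
     org jj.1 + h *: dir jj.1 = org jj.2 + h *: dir jj.2].

Lemma crossings_finite : finite_set crossings.
Proof.
apply: bigcup_finite => // -[i j] _ /=; set S := [set h | _].
have S1 : is_subset1 S.
  move=> h h' [ne E] [_ E']; apply: contrapT => hh'; apply: ne.
  have {E'} : (h - h') *: (dir i - dir j) = 0.
    have : (org i + h *: dir i) - (org i + h' *: dir i) =
           (org j + h *: dir j) - (org j + h' *: dir j) by rewrite E E'.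
    have e (o x y : 'rV[R]_d) : (o + x) - (o + y) = x - y.
      by rewrite opprD addrACA subrr add0r.
    rewrite !e -!scalerBl => D.
    by rewrite scalerBr D subrr.
  move/eqP; rewrite scaler_eq0 !subr_eq0 => /orP[/eqP//|/eqP D].
  by rewrite D in E *; rewrite (addIr _ E).
have [->|/set0P[h Sh]] := eqVneq S set0; first exact: finite_set0.
apply: (sub_finite_set (B := [set h])); last exact: finite_set1.
by move=> h' Sh'; rewrite (S1 _ _ Sh' Sh).
Qed.

Lemma edge_closed j : closed ([set x | exists2 t, 0 <= t <= 1 & x = pt (cyc p) j t]).
Proof.
have -> : [set x | exists2 t, 0 <= t <= 1 & x = pt (cyc p) j t] =
    (pt (cyc p) j) @` `[0, 1].
  by apply/seteqP; split=> x /= [t t01 xt]; exists t => //; move: t01; rewrite in_itv.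
apply: compact_closed; first exact: norm_hausdorff.
apply: continuous_compact; last exact: segment_compact.
by apply: continuous_subspaceT => t; exact: line_continuous.
Qed.

Variables (k : nat) (g : 'I_k -> R -> 'rV[R]_d) (L : 'I_k -> R).
Hypothesis k0 : (0 < k)%N.
Hypothesis gc : forall i, {within `[0, 1], continuous (g i)}.
Hypothesis gL : forall i, (curve_length (g i) <= (L i)%:E)%E.
Variable E : set 'rV[R]_d.
Hypothesis finE : finite_set E.
Hypothesis gE : forall x, ~ E x ->
  (passages (chain_curve p) x #<= [set it : 'I_k * R | passages (g it.1) x it.2])%card.

Definition bad : set R := crossings `|` w @` E.

Lemma bad_finite : finite_set bad.
Proof. by rewrite finite_setU; split; [exact: crossings_finite|exact: finite_image]. Qed.

(** For the pieces that matter in [pointwise_bound], all edges met lie on one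
    line, so that the choice is harmless. *)
Definition met_edge (i : 'I_k) (n m : nat) : option 'I_N :=
  [pick j : 'I_N | `[< v j != 0 /\ exists2 t, piece n m t &
     exists2 s, 0 <= s <= 1 & g i t = pt (cyc p) j s >]].

Definition morg i n m := if met_edge i n m is Some j then org j else 0.
Definition mdir i n m := if met_edge i n m is Some j then dir j else 0.

Lemma chain_passage j h : (j < N)%N -> shadow j h ->
  exists2 t, passages (chain_curve p) (org j + h *: dir j) t &
    [/\ v j != 0, Num.truncn (t * N%:R) = j &
       exists2 s, 0 <= s <= 1 & org j + h *: dir j = pt (cyc p) j s].
Proof.
move=> jN; rewrite /shadow/=; set s := _ / _ => /andP[s0 s1].
have N0 : 0 < N%:R :> R by rewrite ltr0n.
have vj : v j != 0.
  by apply/eqP => vj; move: s0; rewrite /s vj /w linear0 horner0 invr0 mulr0 ltxx.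
have E1 : org j + h *: dir j = pt (cyc p) j s.
  rewrite [RHS]pt_line//; congr (_ + _ *: _).
  by rewrite /pt wD wZ /s divfK ?Wv//; ring.
have tr : Num.truncn (j%:R + s) = j.
  by apply/truncn_def; rewrite -natr1; apply/andP; split; lra.
exists ((j%:R + s) / N%:R); last first.
  by split => //; [rewrite divfK// gt_eqF|exists s => //; apply/andP; split; exact: ltW].
rewrite /passages/= divr_ge0 ?addr_ge0 ?(ltW s0)//= ltr_pdivrMr// mul1r.
split; last by rewrite chain_curveE divfK ?gt_eqF// tr E1; congr pt; ring.
have : j.+1%:R <= N%:R :> R by rewrite ler_nat.
by rewrite -(natr1 j); lra.
Qed.

Lemma near_piece (e : R) : 0 < e -> \forall n \near \oo, forall m (s t : R),
  piece n m s -> piece n m t -> `|s - t| < e.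
Proof.
move=> e0; near=> n => m s t; rewrite /piece/= !in_itv/= => /andP[s1 s2] /andP[t1 t2].
have n1 : e^-1 < n.+1%:R.
  near: n; exists (Num.truncn e^-1).+1 => // n /= ln.
  apply: (lt_le_trans (truncnS_gt _)); rewrite ler_nat; exact: ltnW.
have n2 : n.+1%:R^-1 < e by rewrite invf_plt ?posrE.
have : m.+1%:R / n.+1%:R = m%:R / n.+1%:R + n.+1%:R^-1 :> R.
  by rewrite -(natr1 m) mulrDl mul1r.
move=> E1; rewrite E1 in s2 t2; move: s1 t1 s2 t2 n2.
move: (m%:R / n.+1%:R) => z; move: (n.+1%:R^-1) => q s1 t1 s2 t2 n2.
by rewrite ltr_norml; apply/andP; split; lra.
Unshelve. all: by end_near. Qed.

(** Edges are closed, so a short enough piece through a point off the edge [j]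
    avoids this edge. *)
Lemma near_off_edge i s j : 0 <= s < 1 ->
  (forall u, 0 <= u <= 1 -> g i s <> pt (cyc p) j u) ->
  \forall n \near \oo, forall m t, (m <= n)%N -> piece n m s -> piece n m t ->
    forall u, 0 <= u <= 1 -> g i t <> pt (cyc p) j u.
Proof.
move=> /andP[s0 s1] off.
set Ed := [set x | exists2 t, 0 <= t <= 1 & x = pt (cyc p) j t].
have nbh : nbhs (g i s) (~` Ed).
  apply: open_nbhs_nbhs; split; first by rewrite openC; exact: edge_closed.
  by move=> [u u01]; exact: off.
have /subspace_continuousP/(_ s) := @gc i.
rewrite /= in_itv/= s0 (ltW s1) => /(_ isT _ nbh).
rewrite /nbhs/= /within/= => /nbhs_ballP[e /= e0 He].
apply: filterS (near_piece e0) => n Hn m t mn ps pt' u u01 gt.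
apply: (He t (Hn m s t ps pt')).
  by rewrite in_itv/=; exact: piece01 mn pt'.
by exists u.
Qed.

(** Let [x j] be the point over [h] on the edge [j]. As [h] is not bad,
    multiplicities are covered at [x j], which gives distinct pairs of a curve
    [i j] and a time [s j] at which it passes [x j]. In a fine subdivision these
    times lie in distinct pieces, and the piece around [s j] meets only edges
    through [x j]. Since [h] is not a crossing, these edges lie on the line of
    the edge [j], to which the piece is then charged. *)
Lemma pointwise_bound h : ~ bad h -> \forall n \near \oo,
  \sum_(j < N | `[< shadow j h >]) enorm (dir j) <=
  \sum_(im : 'I_k * 'I_n.+1) enorm (mdir im.1 n im.2) *
     \1_(trace (g im.1) n im.2 (morg im.1 n im.2) (mdir im.1 n im.2)) h.
Proof.
move=> hbad; pose x j := org j + h *: dir j.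
pose A : {set 'I_N} := [set j : 'I_N | `[< shadow j h >]]%SET.
have AP (j : 'I_N) : j \in A -> shadow j h by rewrite inE => /asboolP.
have /choice[t Ht] : forall j : 'I_N, exists t, j \in A ->
    [/\ passages (chain_curve p) (x j) t, v j != 0, Num.truncn (t * N%:R) = j &
       exists2 s, 0 <= s <= 1 & x j = pt (cyc p) j s].
  move=> j; have [/AP jA|_] := boolP (j \in A); last by exists 0.
  by have [t pt [? ? ?]] := chain_passage (ltn_ord j) jA; exists t.
have wx (j : 'I_N) : j \in A -> w (x j) = h.
  by move=> /Ht[_ vj _ _]; rewrite w_line.
have /choice[f Hf] : forall y : 'rV[R]_d, exists f : R -> 'I_k * R,
    w y = h -> (exists t, passages (chain_curve p) y t) ->
    (forall t, passages (chain_curve p) y t -> passages (g (f t).1) y (f t).2) /\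
    (forall t t', passages (chain_curve p) y t -> passages (chain_curve p) y t' ->
       f t = f t' -> t = t').
  move=> y; have [[t0 pt0]|no] := pselect (exists t, passages (chain_curve p) y t); last first.
    by exists (fun=> (Ordinal k0, 0)).
  have [wy|wy] := eqVneq (w y) h; last first.
    by exists (fun=> (Ordinal k0, 0)) => E1; rewrite E1 eqxx in wy.
  have Ey : ~ E y by move=> Ey; apply: hbad; right; exists y.
  by have [f [f1 f2]] := card_le_fun (gE Ey) pt0; exists f.
pose i (j : 'I_N) := (f (x j) (t j)).1; pose s (j : 'I_N) := (f (x j) (t j)).2.
have gs (j : 'I_N) : j \in A -> 0 <= s j < 1 /\ g (i j) (s j) = x j.
  move=> jA; have [pj _ _ _] := Ht _ jA.
  by have [H _] := Hf (x j) (wx _ jA) (ex_intro _ _ pj); exact: H.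
have is_inj (j j' : 'I_N) : j \in A -> j' \in A -> i j = i j' -> s j = s j' -> j = j'.
  move=> jA j'A ii ss; have [[_ gj] [_ gj']] := (gs _ jA, gs _ j'A).
  have xx : x j = x j' by rewrite -gj -gj' ii ss.
  have [pj _ tj _] := Ht _ jA; have [pj' _ tj' _] := Ht _ j'A.
  have [_ H] := Hf (x j) (wx _ jA) (ex_intro _ _ pj).
  have tt : t j = t j'.
    apply: H => //; first by rewrite xx.
    rewrite [in RHS]xx; move: ii ss; rewrite /i /s.
    by case: (f _ _) => ? ?; case: (f _ _) => ? ? /= -> ->.
  by apply: val_inj; rewrite /= -tj -tj' tt.
have near_inj : \forall n \near \oo, forall j j' : 'I_N, j \in A -> j' \in A ->
    i j = i j' -> Num.truncn (s j * n.+1%:R) = Num.truncn (s j' * n.+1%:R) -> j = j'.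
  apply: filter_forall => j; apply: filter_forall => j'.
  have [jA|_] := boolP (j \in A); last by near=> n.
  have [j'A|_] := boolP (j' \in A); last by near=> n.
  have [ss|ss] := eqVneq (s j) (s j').
    by near=> n => _ _ ii _; exact: is_inj.
  have [[/andP[sj _] _] [/andP[sj' _] _]] := (gs _ jA, gs _ j'A).
  by apply: filterS (near_truncn_neq sj sj' ss) => n + _ _ _ E1; rewrite E1 eqxx.
have near_off : \forall n \near \oo, forall j j' : 'I_N, j \in A ->
    (forall u, 0 <= u <= 1 -> x j <> pt (cyc p) j' u) ->
    forall m t, (m <= n)%N -> piece n m (s j) -> piece n m t ->
      forall u, 0 <= u <= 1 -> g (i j) t <> pt (cyc p) j' u.
  apply: filter_forall => j; apply: filter_forall => j'.
  have [jA|_] := boolP (j \in A); last by near=> n.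
  have [off|on] := pselect (forall u, 0 <= u <= 1 -> x j <> pt (cyc p) j' u); last by near=> n.
  have [s01 gx] := gs _ jA; rewrite -gx in off.
  by apply: filterS (near_off_edge s01 off) => n Hn _ _; exact: Hn.
near=> n.
have inj_n : forall j j' : 'I_N, j \in A -> j' \in A ->
    i j = i j' -> Num.truncn (s j * n.+1%:R) = Num.truncn (s j' * n.+1%:R) -> j = j'.
  by near: n.
have off_n : forall j j' : 'I_N, j \in A ->
    (forall u, 0 <= u <= 1 -> x j <> pt (cyc p) j' u) ->
    forall m t, (m <= n)%N -> piece n m (s j) -> piece n m t ->
      forall u, 0 <= u <= 1 -> g (i j) t <> pt (cyc p) j' u.
  by near: n.
have mle (j : 'I_N) : j \in A -> (Num.truncn (s j * n.+1%:R) < n.+1)%N.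
  move=> /gs[/andP[sj0 sj1] _]; rewrite -(ltr_nat R).
  apply: (@le_lt_trans _ _ (s j * n.+1%:R)); first by rewrite truncn_le// mulr_ge0.
  by rewrite gtr_pMl.
pose phi (j : 'I_N) : 'I_k * 'I_n.+1 := (i j, inord (Num.truncn (s j * n.+1%:R))).
have phi2 (j : 'I_N) : j \in A -> (phi j).2 = Num.truncn (s j * n.+1%:R) :> nat.
  by move=> jA; rewrite /= inordK// mle.
have ps (j : 'I_N) : j \in A -> piece n (phi j).2 (s j).
  move=> jA; rewrite phi2//; have [/andP[sj0 _] _] := gs _ jA.
  rewrite /piece/= in_itv/= ler_pdivrMr// ler_pdivlMr//.
  have /truncn_itv/andP[-> /ltW ->//] : 0 <= s j * n.+1%:R by rewrite mulr_ge0.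
pose G (im : 'I_k * 'I_n.+1) := enorm (mdir im.1 n im.2) *
     \1_(trace (g im.1) n im.2 (morg im.1 n im.2) (mdir im.1 n im.2)) h : R.
have G0 im : 0 <= G im by rewrite /G mulr_ge0 ?enorm_ge0// indicE.
have Gphi (j : 'I_N) : j \in A -> G (phi j) = enorm (dir j).
  move=> jA; have [pj vj _ [u u01 xu]] := Ht _ jA.
  have [s01 gx] := gs _ jA.
  have [e Ee] : exists e, met_edge (phi j).1 n (phi j).2 = Some e.
    rewrite /met_edge; case: pickP => [e _|/(_ j)/asboolP[]]; first by exists e.
    by split => //; exists (s j); [exact: ps|exists u => //; rewrite gx].
  have [ve [t' pt' [u' u'01 gt']]] : v e != 0 /\ exists2 t, piece n (phi j).2 t &
     exists2 s, 0 <= s <= 1 & g (phi j).1 t = pt (cyc p) e s.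
    by move: Ee; rewrite /met_edge; case: pickP => // e' /asboolP + [<-].
  have [y y01 xy] : exists2 u, 0 <= u <= 1 & x j = pt (cyc p) e u.
    apply: contrapT => no.
    apply: (off_n j e jA _ (phi j).2 t' _ (ps _ jA) pt' u' u'01 gt').
      by move=> y y01 xy; apply: no; exists y.
    by rewrite -ltnS.
  have xe : x j = org e + h *: dir e.
    by rewrite -[in RHS](wx _ jA) xy -pt_line.
  have oe : (org j, dir j) = (org e, dir e).
    apply: contrapT => ne; apply: hbad; left; exists (j, e) => //.
  rewrite /G /mdir /morg Ee; case: oe => <- <-.
  rewrite indicE mem_set ?mulr1//; exists (s j); first exact: ps.
  by rewrite gx.
have phi_inj : {in A &, injective phi}.
  move=> j j' jA j'A E1; apply: inj_n => //; first by case: E1.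
  by rewrite -!phi2// E1.
have -> : \sum_(j < N | `[< shadow j h >]) enorm (dir j) = \sum_(j in A) G (phi j).
  rewrite [RHS](eq_bigr (fun j : 'I_N => enorm (dir j))) => [|j]; last exact: Gphi.
  by apply: eq_bigl => j; rewrite inE.
rewrite -(big_imset _ phi_inj) [leRHS](bigID (mem (phi @: A)))/= lerDl.
by apply: sumr_ge0 => im _; exact: (G0 im).
Unshelve. all: by end_near. Qed.

(** An edge and its shadow have lengths of ratio [enorm (dir j)]. *)
Lemma sum_edges : (\sum_(j < N) (enorm (dir j))%:E *
   lebesgue_measure (shadow j `\` bad) = (prefix_len (cyc p) N)%:E)%E.
Proof.
rewrite /prefix_len -sumEFin; apply: eq_bigr => j _; rewrite shadow_measure; last exact: bad_finite.
rewrite -EFinM; congr EFin; have [vj|vj] := eqVneq (v j) 0; last by rewrite edge_len_dir.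
by rewrite /dir /edge_len edistE vj scaler0 enorm0 mul0r.
Qed.

(** The subdivision from which on [pointwise_bound] holds depends on [h];
    Fatou's lemma absorbs this dependence. *)
Lemma chain_le_curves_dir : prefix_len (cyc p) N <= \sum_i L i.
Proof.
rewrite -lee_fin -sum_edges.
pose F h : \bar R := (\sum_(j < N) (enorm (dir j))%:E * (\1_(shadow j `\` bad) h)%:E)%E.
pose f n h : \bar R := (\sum_(im : 'I_k * 'I_n.+1) (enorm (mdir im.1 n im.2))%:E *
     (\1_(trace (g im.1) n im.2 (morg im.1 n im.2) (mdir im.1 n im.2)) h)%:E)%E.
have mbad : measurable bad.
  by apply: countable_measurable => //; exact/finite_set_countable/bad_finite.
have mS j : measurable (shadow j `\` bad).
  by apply: measurableD => //; exact: measurable_shadow.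
have mT n (im : 'I_k * 'I_n.+1) o r : measurable (trace (g im.1) n im.2 o r).
  by apply: measurable_trace => //; rewrite -ltnS.
have ind0 (c : R) S h : 0 <= c -> (0 <= c%:E * (\1_S h)%:E :> \bar R)%E.
  by move=> c0; rewrite mule_ge0// lee_fin// indicE.
have mind (c : R) S : measurable S ->
    measurable_fun setT (fun h : R => (c%:E * (\1_S h)%:E)%E).
  by move=> mS'; apply: measurable_funeM; apply/measurable_EFinP; exact: measurable_indic.
have int_ind (c : R) S : 0 <= c -> measurable S ->
    (\int[lebesgue_measure]_h (c%:E * (\1_S h)%:E) = c%:E * lebesgue_measure S)%E.
  move=> c0 mS'; rewrite ge0_integralZl_EFin//.
  - by rewrite integral_indic// setIT.
  - by apply/measurable_EFinP; exact: measurable_indic.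
have intF : (\int[lebesgue_measure]_h F h = \sum_(j < N) (enorm (dir j))%:E *
   lebesgue_measure (shadow j `\` bad))%E.
  rewrite ge0_integral_sum//.
  - by apply: eq_bigr => j _; apply: int_ind; [exact: enorm_ge0|exact: mS].
  - by move=> j; exact: mind.
  - by move=> j h _; apply: ind0; exact: enorm_ge0.
have f0 n h : (0 <= f n h)%E by apply: sume_ge0 => im _; apply: ind0; exact: enorm_ge0.
have mf n : measurable_fun setT (f n).
  by apply: emeasurable_sum => im; exact: mind.
have intf n : (\int[lebesgue_measure]_h f n h <= (\sum_i L i)%:E)%E.
  rewrite ge0_integral_sum//; last 2 first.
  - by move=> im; exact: mind.
  - by move=> im h _; apply: ind0; exact: enorm_ge0.
  rewrite (eq_bigr (fun im : 'I_k * 'I_n.+1 => ((enorm (mdir im.1 n im.2))%:E *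
     lebesgue_measure (trace (g im.1) n im.2 (morg im.1 n im.2) (mdir im.1 n im.2)))%E)); last first.
    by move=> im _; apply: int_ind; [exact: enorm_ge0|exact: mT].
  rewrite -(pair_bigA _ (fun (i : 'I_k) (m : 'I_n.+1) => ((enorm (mdir i n m))%:E *
     lebesgue_measure (trace (g i) n m (morg i n m) (mdir i n m)))%E))/=.
  rewrite -sumEFin; apply: lee_sum => i _.
  exact: (@length_traces _ _ (g i) (L i) (@gc i) (gL i) n (fun m => morg i n m) (fun m => mdir i n m)).
rewrite -intF.
apply: (@le_trans _ _ (\int[lebesgue_measure]_h limn_einf (f^~ h))%E).
  apply: ge0_le_integral => //.
  - by move=> h _; apply: sume_ge0 => j _; apply: ind0; exact: enorm_ge0.
  - by apply: emeasurable_sum => j; exact: mind.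
  - apply: measurableT_comp => //; apply: measurable_fun_limn_esup => n.
    by apply: measurableT_comp => //; exact: mf.
  move=> h _; have [hb|hb] := pselect (bad h).
    rewrite /F big1 => [|j _]; last by rewrite indicE memNset ?mule0// => -[].
    rewrite limn_einf_lim; apply: lime_ge; first exact: is_cvg_einfs.
    by near=> n; apply: le_ereal_inf_tmp => _ [m _ <-].
  rewrite limn_einf_lim; apply: lime_ge; first exact: is_cvg_einfs.
  have [n0 _ Hn] := pointwise_bound hb.
  near=> n; apply: le_ereal_inf_tmp => _ [m /= nm <-].
  have nm0 : (n0 <= m)%N by apply: leq_trans nm; near: n; exists n0.
  have := Hn _ nm0; rewrite -lee_fin => /le_trans H; rewrite /f.
  have -> : F h = (\sum_(j < N | `[< shadow j h >]) enorm (dir j))%:E.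
    rewrite -sumEFin big_mkcond; apply: eq_bigr => j _; rewrite indicE.
    case: asboolP => sj; first by rewrite mem_set ?mule1.
    by rewrite memNset ?mule0// => -[].
  by apply: H; rewrite -sumEFin; apply: lee_sum => im _; rewrite EFinM.
apply: (le_trans (fatou _ _ _ _)) => //.
rewrite limn_einf_lim; apply: lime_le; first exact: is_cvg_einfs.
near=> n; apply: le_trans (intf n); apply: ereal_inf_lbound; by exists n => /=.
Unshelve. all: by end_near. Qed.

End LowerBound.

(** A functional that is nonzero on all nondegenerate edges exists on the moment
    curve [(1, W, W^2, ...)]: a nonzero vector is the coefficient sequence of a
    nonzero polynomial in [W], and the product of these polynomials has a
    nonroot. *)
Lemma chain_le_curves (R : realType) (d : nat) (p : seq 'rV[R]_d) (k : nat)
    (g : 'I_k -> R -> 'rV[R]_d) (L : 'I_k -> R) :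
  (0 < size p)%N -> (0 < k)%N -> (forall i, closed_curve (g i)) -> covers p g ->
  (forall i, (curve_length (g i) <= (L i)%:E)%E) ->
  prefix_len (cyc p) (size p) <= \sum_i L i.
Proof.
move=> p0 k0 gc [_ [E finE gE]] gL.
pose v j := cyc p j.+1 - cyc p j.
have q0 : \prod_(j < size p | v j != 0) rVpoly (v j) != 0.
  apply/prodf_neq0 => j vj; apply: contraNneq vj => rv0.
  by rewrite -[v j]rVpolyK rv0 linear0.
have [W W0] := poly_nonroot q0.
have Wv j : (j < size p)%N -> v j != 0 -> (rVpoly (v j)).[W] != 0.
  move=> jN vj; apply: contraNneq W0 => Wj; rewrite horner_prod (bigD1 (Ordinal jN)) //=.
  by rewrite Wj mul0r.
have gc' i : {within `[0, 1], continuous (g i)} by case: (gc i).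
exact: (chain_le_curves_dir p0 Wv k0 gc' gL finE gE).
Qed.

(** The largest of [k] lengths is at least their mean. *)
Lemma opt_ge (R : realType) (d : nat) (p : seq 'rV[R]_d) (k : nat) :
  (0 < size p)%N -> (0 < k)%N -> ((prefix_len (cyc p) (size p) / k%:R)%:E <= opt p k)%E.
Proof.
move=> p0 k0; apply: le_ereal_inf_tmp => _ [g [gc gcov] <-].
have len0 i : (0 <= curve_length (g i))%E.
  apply: ereal_sup_ge; exists (inscribed_length (g i) [:: 1])%:E.
    by exists [:: 1] => //=; rewrite /itv_partition/= ltr01.
  by rewrite lee_fin; apply: sumr_ge0 => j _; exact: edist_ge0.
have lem i : (curve_length (g i) <= max_length g)%E.
  by rewrite /max_length (bigD1 i)//= le_max lexx.
have [->|fin] := eqVneq (max_length g) +oo%E; first exact: leey.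
have M0 : (0 <= max_length g)%E by apply: le_trans (lem (Ordinal k0)).
have Mfin : max_length g \is a fin_num by rewrite ge0_fin_numE// ltey.
rewrite -(fineK Mfin) lee_fin ler_pdivrMr ?ltr0n//.
have -> : fine (max_length g) * k%:R = \sum_(i < k) fine (max_length g).
  by rewrite sumr_const card_ord mulr_natr.
by apply: chain_le_curves gcov _ => // i; rewrite fineK.
Qed.

(** * Arc length positions and sums along arcs *)

Section Locate.
Variables (R : realType) (d : nat) (p : seq 'rV[R]_d).
Hypothesis p0 : (0 < size p)%N.
Local Notation n := (size p).
Local Notation V := (cyc p).
Local Notation lam := (prefix_len V).
Local Notation len := (prefix_len V n).

Lemma cyc_period i : V (i + n) = V i.
Proof. by rewrite /cyc modnDr. Qed.

Lemma edge_len_period i : edge_len V (i + n) = edge_len V i.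
Proof. by rewrite /edge_len -addSn !cyc_period. Qed.

Lemma prefix_len_period i : lam (i + n) = lam i + len.
Proof.
elim: i => [|i IH]; first by rewrite add0n [lam 0]/prefix_len big_ord0 add0r.
by rewrite addSn !prefix_lenS IH edge_len_period addrAC.
Qed.

Lemma pt_period i t : pt V (i + n) t = pt V i t.
Proof. by rewrite /pt -addSn !cyc_period. Qed.

Lemma pos_period i t : pos V (i + n) t = pos V i t + len.
Proof. by rewrite /pos prefix_len_period edge_len_period addrAC. Qed.

Lemma ptM_period m i t : pt V (i + m * n) t = pt V i t.
Proof.
by elim: m => [|m IH]; [rewrite mul0n addn0|rewrite mulSnr addnA pt_period].
Qed.

Lemma posM_period m i t : pos V (i + m * n) t = pos V i t + m%:R * len.
Proof.
elim: m => [|m IH]; first by rewrite mul0n addn0 mul0r addr0.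
by rewrite mulSnr addnA pos_period IH -natr1 mulrDl mul1r addrA.
Qed.

(** One of the two points comes before the other, and the path between them has
    the length that is the difference of the positions. *)
Lemma edist_pos i t j u : 0 <= t <= 1 -> 0 <= u <= 1 ->
  edist (pt V i t) (pt V j u) <= `|pos V i t - pos V j u|.
Proof.
wlog bf : i t j u / before i t j u => [H t01 u01|t01 u01].
  have [ij|ji|ij] := ltngtP i j.
  - by apply: H => //; left.
  - by rewrite edistC distrC; apply: H => //; left.
  - have [tu|/ltW ut] := leP t u; first by apply: H => //; right.
    by rewrite edistC distrC; apply: H => //; right.
rewrite edistC distrC; apply: (le_trans (edist_path V bf t01 u01)); exact: ler_norm.
Qed.

Lemma pt_pos_eq i t j u : 0 <= t <= 1 -> 0 <= u <= 1 ->
  pos V i t = pos V j u -> pt V i t = pt V j u.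
Proof.
by move=> t01 u01 E; apply: edist_eq0; apply: (le_trans (edist_pos _ _ t01 u01));
  rewrite E subrr normr0.
Qed.

(** The first edge that does not end before the position [s]; at a vertex this
    is an edge ending there, unless [s] is 0. *)
Definition edge_at (s : R) : nat :=
  if pselect (exists i, s <= lam i.+1) is left e then ex_minn e else 0%N.

(** The two conditions hold for the edge at which a scan stops that moves on
    while the current edge ends before [s]. *)
Lemma edge_at_unique s i : s <= lam i.+1 -> ((0 < i)%N -> lam i < s) -> edge_at s = i.
Proof.
move=> si mini; rewrite /edge_at; case: pselect => [e|[]]; last by exists i.
case: ex_minnP => m sm minm; apply/eqP; rewrite eqn_leq minm//=.
case: (posnP i) => [-> //|i0]; rewrite leqNgt; apply/negP => mi.
have := le_lt_trans (prefix_len_le V mi) (mini i0); by rewrite ltNge sm.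
Qed.

(** A chain of length 0 has no position other than 0. *)
Definition reachable (s : R) := 0 <= s /\ (len = 0 -> s = 0).

Lemma len_ge0 : 0 <= len. Proof. by apply: sumr_ge0 => j _; exact: edge_len_ge0. Qed.

Lemma edge_atP s : reachable s -> [/\ s <= lam (edge_at s).+1, lam (edge_at s) <= s &
  (0 < edge_at s)%N -> lam (edge_at s) < s].
Proof.
move=> [s0 slen].
have ex : exists i, s <= lam i.+1.
  have := len_ge0; rewrite le_eqVlt => /orP[/eqP l0|l0].
    by exists 0%N; rewrite slen// /prefix_len big_ord1 edge_len_ge0.
  pose m := (Num.truncn (s / len)).+1; exists (0 + m * n)%N.
  apply: (@le_trans _ _ (lam (0 + m * n))); last exact: prefix_len_le.
  rewrite -[lam _](pos0 V) posM_period pos0 /prefix_len big_ord0 add0r -/len.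
  by rewrite -ler_pdivrMr//; exact/ltW/truncnS_gt.
rewrite /edge_at; case: pselect => // e; case: ex_minnP => m sm minm.
have lt : (0 < m)%N -> lam m < s.
  case: m sm minm => // m sm minm _; rewrite ltNge; apply/negP => /minm.
  by rewrite ltnn.
split => //; case: (posnP m) => [->|/lt/ltW//]; by rewrite /prefix_len big_ord0.
Qed.

(** A degenerate edge can be found only at position 0; the quotient is then 0,
    and the point is the vertex. *)
Definition edge_frac (s : R) : R := (s - lam (edge_at s)) / edge_len V (edge_at s).
Definition chain_at (s : R) : 'rV[R]_d := pt V (edge_at s) (edge_frac s).

Lemma edge_frac01 s : reachable s -> 0 <= edge_frac s <= 1.
Proof.
move=> /edge_atP[s1 s2 _]; rewrite /edge_frac; have := edge_len_ge0 V (edge_at s).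
rewrite le_eqVlt => /orP[/eqP <-|l0]; first by rewrite invr0 mulr0 lexx ler01.
rewrite divr_ge0 ?subr_ge0 ?(ltW l0)//= ler_pdivrMr// mul1r.
by move: s1; rewrite prefix_lenS; lra.
Qed.

Lemma pos_edge_frac s : reachable s -> pos V (edge_at s) (edge_frac s) = s.
Proof.
move=> /edge_atP[s1 s2 _]; rewrite /pos /edge_frac; have := edge_len_ge0 V (edge_at s).
rewrite le_eqVlt => /orP[/eqP l0|l0]; last by rewrite divfK ?gt_eqF//; lra.
by rewrite -l0 mulr0 addr0; apply/le_anti; rewrite s2 -[leRHS]addr0 l0 -prefix_lenS.
Qed.

Lemma chain_at_lip s u : reachable s -> reachable u -> edist (chain_at s) (chain_at u) <= `|s - u|.
Proof.
move=> rs ru; rewrite -{2}(pos_edge_frac rs) -{2}(pos_edge_frac ru).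
by apply: edist_pos; exact: edge_frac01.
Qed.

Lemma chain_at_pt s i t : reachable s -> 0 <= t <= 1 -> pos V i t = s -> chain_at s = pt V i t.
Proof. by move=> rs t01 E; apply: pt_pos_eq => //; rewrite ?edge_frac01// pos_edge_frac. Qed.

Lemma reachable_period s : reachable s -> reachable (s + len).
Proof.
move=> [s0 sl]; split; first by rewrite addr_ge0// len_ge0.
by move=> l0; rewrite sl// l0 addr0.
Qed.

Lemma chain_at_period s : reachable s -> chain_at (s + len) = chain_at s.
Proof.
move=> rs; rewrite (chain_at_pt (reachable_period rs) (edge_frac01 rs) (i := edge_at s + n)).
  by rewrite pt_period.
by rewrite pos_period pos_edge_frac.
Qed.

Lemma edge_at_le s u : reachable s -> reachable u -> s <= u -> (edge_at s <= edge_at u)%N.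
Proof.
move=> /edge_atP[_ _ s3] /edge_atP[u1 _ _] su; rewrite leqNgt; apply/negP => lt.
have := s3 (leq_ltn_trans (leq0n _) lt); rewrite ltNge.
by rewrite (le_trans su)// (le_trans u1)// prefix_len_le.
Qed.

Lemma before_edge_at s u : reachable s -> reachable u -> s <= u ->
  before (edge_at s) (edge_frac s) (edge_at u) (edge_frac u).
Proof.
move=> rs ru su; have := edge_at_le rs ru su; rewrite leq_eqVlt => /orP[/eqP E|]; last by left.
by right; rewrite /edge_frac E; split => //; rewrite ler_wpM2r ?invr_ge0 ?edge_len_ge0// lerD2r.
Qed.

End Locate.

Lemma cyc_pathsum (R : realType) (d : nat) (M : nmodType) (f : 'rV[R]_d -> 'rV[R]_d -> M) q :
  (0 < size q)%N ->
  \sum_(j < size q) f (cyc q j) (cyc q j.+1) = pathsum f (last 0 q) q.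
Proof.
case: q => // x r _; rewrite big_ord_recr/= /cyc /= modnn /=.
rewrite modn_small// [RHS]addrC; congr (_ + f _ _); last by rewrite (last_nth 0).
rewrite (pathsumE _ 0) big_mkord; apply: eq_bigr => j _.
by rewrite !modn_small//= ltnS // ltnW.
Qed.

Section Arcs.
Variables (R : realType) (d : nat) (V : nat -> 'rV[R]_d).
Variables (M : nmodType) (f : 'rV[R]_d -> 'rV[R]_d -> M).

(** To be used with two quantities that are additive along the path: the
    distance, and the number of times that a given point is passed. *)
Definition cumul (i : nat) (t : R) : M :=
  \sum_(m < i) f (V m) (V m.+1) + f (V i) (pt V i t).

(** The vertices of an arc that starts on the edge [i] and ends on the edge
    [i']. *)
Definition mid (i i' : nat) : seq 'rV[R]_d := [seq V m | m <- iota i.+1 (i' - i)].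

Lemma pathsum_mid i i' x : (i <= i')%N ->
  pathsum f (V i) (rcons (mid i i') x) = 
  \sum_(i <= m < i') f (V m) (V m.+1) + f (V i') x.
Proof.
rewrite /mid; move: {2 3}(i' - i)%N (erefl (i' - i)%N) => D.
elim: D i => [|D IH] i E ii'.
  have -> : i = i' by apply/eqP; rewrite eqn_leq ii' -subn_eq0 E.
  by rewrite big_geq//= addr0 add0r.
have lt : (i < i')%N by rewrite -subn_gt0 E.
rewrite /= IH//; last by rewrite subnS E.
by rewrite addrA -big_ltn.
Qed.

(** Whole edges telescope; the edge on which the arc starts is split there, and
    [f] is additive for this splitting. *)
Lemma cumul_arc i t i' t' : before i t i' t' -> t <= 1 -> t' <= 1 ->
  (forall u, t <= u <= 1 -> f (V i) (pt V i u) = f (V i) (pt V i t) + f (pt V i t) (pt V i u)) ->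
  cumul i t + pathsum f (pt V i t) (rcons (mid i i') (pt V i' t')) = cumul i' t'.
Proof.
move=> bf t1 t'1 add; rewrite /cumul; case: bf => [ii'|[<- tt']]; last first.
  by rewrite /mid subnn /= addr0 -addrA -add// tt'.
have -> : mid i i' = V i.+1 :: mid i.+1 i'.
  by rewrite /mid -(@subnSK i i').
rewrite /= pathsum_mid// -!addrA [X in _ + X]addrA -pt1 -add ?t1 ?lexx// pt1.
rewrite -(big_mkord xpredT (fun m => f (V m) (V m.+1))) addrA -big_nat_recr//=.
by rewrite addrA -big_cat_nat//= big_mkord.
Qed.

End Arcs.

(** * Passages and sides *)

Lemma card_le_inj (T U : Type) (A : set T) (B : set U) (f : T -> U) :
  (forall a, A a -> B (f a)) -> (forall a b, A a -> A b -> f a = f b -> a = b) ->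
  (A #<= B)%card.
Proof.
move=> fAB finj; apply: (@card_le_trans _ _ _ (f @` A)); last first.
  by apply: subset_card_le => _ [a Aa <-]; exact: fAB.
have := @inj_card_eq _ _ A f; rewrite card_eq_le => /(_ _)/andP[|//].
by move=> a b; rewrite !inE; exact: finj.
Qed.

Lemma fin_inj (T U : finType) (A : {set T}) (B : {set U}) (u0 : U) : (#|A| <= #|B|)%N ->
  exists f : T -> U, (forall a, a \in A -> f a \in B) /\ {in A &, injective f}.
Proof.
move=> AB; exists (fun a => nth u0 (enum B) (index a (enum A))).
have idx a : a \in A -> (index a (enum A) < size (enum B))%N.
  by move=> aA; rewrite -cardE (leq_trans _ AB)// cardE index_mem mem_enum.
split=> [a aA|a b aA bA /eqP]; first by rewrite -mem_enum mem_nth// idx.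
rewrite nth_uniq ?enum_uniq ?idx// => /eqP E.
by rewrite -(nth_index a (_ : a \in enum A)) ?mem_enum// E nth_index// mem_enum.
Qed.

Section Sides.
Variables (R : realType) (d : nat).
Implicit Types (x a b : 'rV[R]_d) (q : seq 'rV[R]_d).

Definition inside x a b : bool :=
  `[< a <> b /\ exists2 t, 0 < t < 1 & x = a + t *: (b - a) >].

Lemma segment_inj a b (t u : R) : a <> b -> a + t *: (b - a) = a + u *: (b - a) -> t = u.
Proof.
move=> ab /addrI/eqP; rewrite -subr_eq0 -scalerBl scaler_eq0 !subr_eq0.
by move=> /orP[/eqP//|/eqP ba]; case: ab.
Qed.

Lemma inside_pt (V : nat -> 'rV[R]_d) i (t u : R) x : t <= u -> V i <> V i.+1 ->
  inside x (pt V i t) (pt V i u) = `[< exists2 y, t < y < u & x = pt V i y >].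
Proof.
move=> tu Vi; apply/asboolP/asboolP.
  move=> [ne [s /andP[s0 s1] ->]].
  have {}tu : t < u by rewrite lt_neqAle tu andbT; apply/eqP => E; rewrite E in ne.
  exists (t + s * (u - t)); first by apply/andP; split; nra.
  by rewrite /pt opprD addrACA subrr add0r -scalerBl scalerA -addrA -scalerDl.
move=> [y /andP[ty yu] ->]; have {}tu := lt_trans ty yu; split.
  by move=> /(segment_inj Vi) E; rewrite E ltxx in tu.
have ut0 : 0 < u - t by rewrite subr_gt0.
exists ((y - t) / (u - t)).
  by rewrite divr_gt0 ?subr_gt0//= ltr_pdivrMr// mul1r; lra.
rewrite /pt opprD addrACA subrr add0r -scalerBl scalerA -addrA -scalerDl divfK ?gt_eqF//.
by congr (_ + _ *: _); ring.
Qed.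

(** A point other than the dividing point is inside at most one of the two parts
    of an edge. *)
Lemma inside_pt_add (V : nat -> 'rV[R]_d) i (t u : R) x : 0 <= t -> t <= u -> x <> pt V i t ->
  inside x (V i) (pt V i u) = (inside x (V i) (pt V i t) + inside x (pt V i t) (pt V i u))%N :> nat.
Proof.
move=> t0 tu xt; have [Vi|/eqP Vi] := eqVneq (V i) (V i.+1).
  have ptV y : pt V i y = V i by rewrite /pt -Vi subrr scaler0 addr0.
  by rewrite !ptV; suff -> : inside x (V i) (V i) = false by []; apply/asboolP => -[].
rewrite -[X in inside x X](pt0 V) !inside_pt//; last exact: le_trans tu.
have [[y xy]|no] := pselect (exists y, x = pt V i y); last first.
  by do 3?[case: asboolP => [[y _ xy]|_]; first by case: no; exists y].
have pinj z : x = pt V i z -> z = y by rewrite xy => /(segment_inj Vi).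
have E (s s' : R) : `[< exists2 z, s < z < s' & x = pt V i z >] = (s < y < s').
  by apply/asboolP/idP => [[z zss /pinj <-//]|yss]; exists y.
rewrite !E; have [yt|ty|ty] := ltgtP y t.
- by rewrite (lt_le_trans yt tu) !andbT /= addn0.
- by rewrite (le_lt_trans t0 ty)/=.
- by case: xt; rewrite xy ty.
Qed.

Lemma passage_time q r (t : R) : (r < size q)%N -> 0 <= t < 1 ->
  passages (chain_curve q) (pt (cyc q) r t) ((r%:R + t) / (size q)%:R) /\
  Num.truncn (((r%:R + t) / (size q)%:R) * (size q)%:R) = r.
Proof.
move=> rq /andP[t0 t1]; have q0 : 0 < (size q)%:R :> R by rewrite ltr0n (leq_ltn_trans _ rq).
have tr : Num.truncn (r%:R + t) = r.
  by apply/truncn_def; rewrite -natr1; apply/andP; split; lra.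
rewrite /passages/= divr_ge0 ?addr_ge0//= ltr_pdivrMr// mul1r chain_curveE divfK ?gt_eqF// tr.
split => //; split; last by congr pt; ring.
have : r.+1%:R <= (size q)%:R :> R by rewrite ler_nat.
by rewrite -(natr1 r); lra.
Qed.

Lemma passage_side q r (t : R) : (r < size q)%N -> 0 <= t <= 1 ->
  exists s, passages (chain_curve q) (pt (cyc q) r t) s.
Proof.
move=> rq /andP[t0 t1].
have := t1; rewrite le_eqVlt => /orP[/eqP ->|{}t1]; last first.
  by eexists; apply: (passage_time rq _).1; rewrite t0 t1.
have r'q : (r.+1 %% size q < size q)%N by rewrite ltn_mod (leq_ltn_trans _ rq).
have t00 : 0 <= (0 : R) < 1 by rewrite lexx ltr01.
have [+ _] := passage_time r'q t00.
by rewrite pt0 pt1 /cyc modn_mod => h; eexists; exact: h.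
Qed.

Lemma side_passage q x (s : R) : (0 < size q)%N -> passages (chain_curve q) x s ->
  [/\ (Num.truncn (s * (size q)%:R) < size q)%N,
      0 <= s * (size q)%:R - (Num.truncn (s * (size q)%:R))%:R < 1 &
      x = pt (cyc q) (Num.truncn (s * (size q)%:R))
            (s * (size q)%:R - (Num.truncn (s * (size q)%:R))%:R)].
Proof.
move=> q0 [/andP[s0 s1] <-]; rewrite -chain_curveE.
have sq0 : 0 <= s * (size q)%:R by rewrite mulr_ge0.
have := truncn_itv sq0 => /andP[h1]; rewrite -(natr1 (Num.truncn _)) => h2; split => //.
  rewrite -(ltr_nat R); apply: (le_lt_trans h1).
  by rewrite gtr_pMl// ltr0n.
by apply/andP; split; lra.
Qed.

(** Away from its vertices, a closed chain passes through a point once for each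
    side that has the point inside. So multiplicities can be compared by
    counting sides, and the vertices of the chain join the exceptional set. *)
Lemma covers_sides (k : nat) (p : seq 'rV[R]_d) (Q : 'I_k -> seq 'rV[R]_d) :
  (0 < size p)%N -> (0 < k)%N -> (forall i, (0 < size (Q i))%N) ->
  (forall r t, (r < size p)%N -> 0 <= t <= 1 -> exists i r' t',
     [/\ (r' < size (Q i))%N, 0 <= t' <= 1 & pt (cyc p) r t = pt (cyc (Q i)) r' t']) ->
  (exists2 E : set 'rV[R]_d, finite_set E & forall x, ~ E x ->
     (\sum_(r < size p) inside x (cyc p r) (cyc p r.+1) <=
      \sum_(i < k) \sum_(r < size (Q i)) inside x (cyc (Q i) r) (cyc (Q i) r.+1))%N) ->
  covers p (fun i => chain_curve (Q i)).
Proof.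
move=> p0 k0 Q0 pQ [E0 finE0 cnt]; split.
  move=> x [t /(side_passage p0)[rp /andP[t0 t1] ->]].
  have [|i [r' [t' [r'Q t'01 ->]]]] := pQ _ (t * (size p)%:R - (Num.truncn (t * (size p)%:R))%:R) rp.
    by rewrite t0 ltW.
  by have [s sQ] := passage_side r'Q t'01; exists i, s.
(* A passage through a vertex is inside no side. *)
exists (E0 `|` [set` p]); first by rewrite finite_setU; split => //; exact: finite_seq.
move=> x /not_orP[xE0 xp].
have xV r : x <> cyc p r by move=> E; apply: xp; rewrite /= E mem_nth// ltn_mod.
pose M := (\max_(i < k) size (Q i)).+1.
have QM i : (size (Q i) < M)%N by rewrite ltnS (leq_bigmax i).
pose A : {set 'I_(size p)} := [set r : 'I_(size p) | inside x (cyc p r) (cyc p r.+1)]%SET.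
pose B : {set 'I_k * 'I_M} := [set ir : 'I_k * 'I_M | (ir.2 < size (Q ir.1))%N &&
   inside x (cyc (Q ir.1) ir.2) (cyc (Q ir.1) ir.2.+1)]%SET.
have AB : (#|A| <= #|B|)%N.
  have -> : #|A| = (\sum_(r < size p) inside x (cyc p r) (cyc p r.+1))%N.
    by rewrite -sum1dep_card [LHS]big_mkcond; apply: eq_bigr => r _; case: ifP.
  apply: (leq_trans (cnt _ xE0)); rewrite -sum1dep_card -(pair_big_dep xpredT
    (fun i (r : 'I_M) => (r < size (Q i))%N && inside x (cyc (Q i) r) (cyc (Q i) r.+1))
    (fun=> fun=> 1%N))/=.
  apply: leq_sum => i _.
  rewrite (big_ord_widen _ (fun r => inside x (cyc (Q i) r) (cyc (Q i) r.+1) : nat) (ltnW (QM i))).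
  rewrite big_mkcond [leqRHS]big_mkcond; apply: leq_sum => r _.
  by case: ifP => // _; case: ifP => // ->.
have [phi [phiB phiinj]] := fin_inj (Ordinal k0, ord0) AB.
have /choice[th Hth] : forall ir : 'I_k * 'I_M, exists t : R, ir \in B ->
    0 <= t < 1 /\ x = pt (cyc (Q ir.1)) ir.2 t.
  move=> ir; have [|_] := boolP (ir \in B); last by exists 0.
  rewrite inE => /andP[_ /asboolP[_ [t /andP[t0 t1] xt]]]; exists t => _.
  by rewrite ltW.
pose tr (t : R) := Num.truncn (t * (size p)%:R).
have trA t (pxt : passages (chain_curve p) x t) : exists2 r : 'I_(size p), r \in A & tr t = r.
  have [rp /andP[t0 t1] xE] := side_passage p0 pxt; exists (Ordinal rp) => //.
  rewrite inE/=; apply/asboolP; rewrite -/(tr t) in xE t0 t1 *; split.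
    by move=> E; apply: (xV (tr t)); rewrite {1}xE /pt -E subrr scaler0 addr0.
  exists (t * (size p)%:R - (tr t)%:R); last exact: xE.
  rewrite t1 andbT lt_neqAle t0 andbT; apply/eqP => E; apply: (xV (tr t)).
  by rewrite {1}xE -E pt0.
have /choice[rr Hrr] : forall t, exists r : 'I_(size p),
    passages (chain_curve p) x t -> r \in A /\ tr t = r.
  move=> t; have [/trA[r rA rt]|no] := pselect (passages (chain_curve p) x t); first by exists r.
  by exists (Ordinal p0) => /no.
pose ir t := phi (rr t).
have irB t : passages (chain_curve p) x t -> ir t \in B by move=> /Hrr[rA _]; exact: phiB.
have irQ t : passages (chain_curve p) x t -> ((ir t).2 < size (Q (ir t).1))%N.
  by move=> /irB; rewrite inE => /andP[].
have time t (pxt : passages (chain_curve p) x t) :=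
  passage_time (irQ t pxt) (Hth _ (irB t pxt)).1.
apply: (@card_le_inj _ _ _ _ (fun t =>
  ((ir t).1, ((ir t).2%:R + th (ir t)) / (size (Q (ir t).1))%:R))) => [t pxt|t t' pxt pxt'].
  by rewrite /= {1}(Hth _ (irB t pxt)).2; exact: (time t pxt).1.
move=> [E1 E2]; have {E2} E2 : (ir t).2 = (ir t').2.
  by apply: val_inj; rewrite /= -(time t pxt).2 -(time t' pxt').2 E2 E1.
have {E1 E2} Eir : ir t = ir t'.
  by move: E1 E2; case: (ir t) => ? ?; case: (ir t') => ? ? /= -> ->.
have [rA rt] := Hrr _ pxt; have [rA' rt'] := Hrr _ pxt'.
have Er : rr t = rr t' by exact: phiinj.
have trE : tr t = tr t' by rewrite rt rt' Er.
have [_ _ xt] := side_passage p0 pxt; have [_ _ xt'] := side_passage p0 pxt'.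
rewrite -/(tr t) in xt; rewrite -/(tr t') -trE in xt'.
move: rA; rewrite inE => /asboolP[ne _]; rewrite -rt in ne.
move: xt; rewrite {1}xt' => /(segment_inj ne)/addIr/mulIf -> //.
by rewrite pnatr_eq0 -lt0n.
Qed.

End Sides.

(** * Cutting the chain into closed arcs *)

Section Cuts.
Variables (R : realType) (d : nat) (p : seq 'rV[R]_d).
Hypothesis p0 : (0 < size p)%N.
Local Notation n := (size p).
Local Notation V := (cyc p).
Local Notation len := (prefix_len V n).
Local Notation loc := (edge_at p).
Local Notation tau := (edge_frac p).
Local Notation P := (chain_at p).
Local Notation reachable := (reachable p).

(** The closing side is the one from the end of the arc back to its start. The
    start is written last: the vertices of all arcs in a row are then the
    vertices of the chain, interrupted only by the pair of cuts at the end of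
    each arc. *)
Definition arc (s u : R) : seq 'rV[R]_d := mid V (loc s) (loc u) ++ [:: P u; P s].

Lemma size_arc s u : size (arc s u) = (loc u - loc s).+2.
Proof. by rewrite size_cat size_map size_iota addn2. Qed.

Lemma arc_sides (M : nmodType) (f : 'rV[R]_d -> 'rV[R]_d -> M) s u :
  \sum_(r < size (arc s u)) f (cyc (arc s u) r) (cyc (arc s u) r.+1) =
  pathsum f (P s) (rcons (mid V (loc s) (loc u)) (P u)) + f (P u) (P s).
Proof.
rewrite cyc_pathsum ?size_arc// /arc last_cat/= -cat_rcons pathsum_cat last_rcons/=.
by rewrite addr0.
Qed.

Lemma arc_length s u : reachable s -> reachable u -> s <= u ->
  prefix_len (cyc (arc s u)) (size (arc s u)) = u - s + edist (P s) (P u).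
Proof.
move=> rs ru su; pose f (a b : 'rV[R]_d) := edist b a.
have /andP[s0 s1] := edge_frac01 rs; have /andP[u0 u1] := edge_frac01 ru.
rewrite /prefix_len (arc_sides f); congr (_ + _).
have fpt i y : 0 <= y -> f (V i) (pt V i y) = y * edge_len V i.
  by move=> y0; rewrite /f -[X in edist _ X](pt0 V) edist_pt subr0 ger0_norm.
have cpos i y : 0 <= y -> cumul V f i y = pos V i y.
  by move=> y0; rewrite /cumul fpt.
have := @cumul_arc _ _ V _ f _ _ _ _ (before_edge_at rs ru su) s1 u1.
rewrite !cpos// !pos_edge_frac// -/(P s) -/(P u) => E.
apply: (addrI s); rewrite E; first by rewrite addrC subrK.
move=> y /andP[ty y1]; rewrite !fpt//; last exact: le_trans ty.
by rewrite /f edist_pt ger0_norm ?subr_ge0// -mulrDl addrC subrK.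
Qed.

Lemma nth_arc s u r : (r < loc u - loc s)%N -> nth 0 (arc s u) r = V (loc s + r).+1.
Proof.
move=> rD; rewrite nth_cat size_map size_iota rD (nth_map 0%N) ?size_iota//.
by rewrite nth_iota.
Qed.

Lemma segment_between i (t y t' : R) : t <= y <= t' ->
  exists2 th : R, 0 <= th <= 1 & pt V i y = pt V i t + th *: (pt V i t' - pt V i t).
Proof.
move=> /andP[ty yt']; have := le_trans ty yt'; rewrite le_eqVlt => /orP[/eqP E|tt'].
  exists 0; first by rewrite lexx ler01.
  by rewrite scale0r addr0; congr pt; apply: le_anti; rewrite ty E yt'.
have t0 : 0 < t' - t by rewrite subr_gt0.
exists ((y - t) / (t' - t)); first by rewrite divr_ge0 ?subr_ge0 ?(ltW tt')//= ler_pdivrMr// mul1r lerD2r.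
rewrite /pt [in RHS]opprD [in RHS](addrACA (V i)) subrr add0r -scalerBl scalerA -addrA -scalerDl.
by rewrite divfK ?gt_eqF//; congr (_ + _ *: _); ring.
Qed.

(** Which side of the arc contains the point depends on whether a cut lies on
    the same edge: at its beginning, at its end, on both sides or on neither. *)
Lemma arc_covers s y u : reachable s -> reachable y -> reachable u -> s <= y <= u ->
  exists r t, [/\ (r < size (arc s u))%N, 0 <= t <= 1 & P y = pt (cyc (arc s u)) r t].
Proof.
move=> rs ry ru /andP[sy yu].
have /andP[s0 s1] := edge_frac01 rs; have /andP[u0 u1] := edge_frac01 ru.
have /andP[y0 y1] := edge_frac01 ry.
set D := (loc u - loc s)%N; have szD := size_arc s u; rewrite -/D in szD.
have nthD : nth 0 (arc s u) D = P u.
  by rewrite nth_cat size_map size_iota -/D ltnn subnn.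
have cyS : cyc (arc s u) D.+1 = P s.
  by rewrite /cyc szD modn_small// nth_cat size_map size_iota -/D ltnNge leqnSn/= subSnn.
have cy0 : cyc (arc s u) D.+2 = nth 0 (arc s u) 0 by rewrite /cyc szD modnn.
have cyr r : (r <= D)%N -> cyc (arc s u) r = nth 0 (arc s u) r.
  by move=> rD; rewrite /cyc szD modn_small// ltnS (leq_trans rD).
have mk r i t t' : (r < D.+2)%N -> loc y = i -> t <= tau y <= t' ->
    cyc (arc s u) r = pt V i t -> cyc (arc s u) r.+1 = pt V i t' ->
    exists r t, [/\ (r < size (arc s u))%N, 0 <= t <= 1 & P y = pt (cyc (arc s u)) r t].
  move=> rD iE /(segment_between i)[th th01 E] E1 E2; exists r, th; split => //.
    by rewrite szD.
  by rewrite /P iE E /pt E1 E2.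
have sl := edge_at_le rs ry sy; have lu := edge_at_le ry ru yu.
have [bsy|bsy] := before_edge_at rs ry sy; have [byu|byu] := before_edge_at ry ru yu.
- have r1 : (loc y - loc s < D)%N by rewrite ltn_sub2r// (leq_ltn_trans sl).
  have r0 : ((loc y - loc s).-1 < D)%N by rewrite (leq_ltn_trans (leq_pred _)).
  have rp : (loc y - loc s).-1.+1 = (loc y - loc s)%N by rewrite prednK// subn_gt0.
  apply: (mk (loc y - loc s).-1 (loc y) 0 1) => //; first exact: (leq_trans r0 (leqW (leqnSn _))).
  + by rewrite y0.
  + by rewrite cyr ?(ltnW r0)// nth_arc// -addnS rp subnKC// pt0.
  + by rewrite rp cyr ?(ltnW r1)// nth_arc// subnKC// pt1.
- move: byu => [E yu'].
  have D0 : (0 < D)%N by rewrite /D subn_gt0 -E.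
  apply: (mk D.-1 (loc y) 0 (tau u)) => //; first by rewrite prednK// -addn2 leq_addr.
  + by rewrite y0.
  + rewrite cyr ?leq_pred// nth_arc; last by rewrite prednK.
    by rewrite -addnS prednK// /D -E subnKC// pt0.
  + by rewrite prednK// cyr// nthD /P E.
- move: bsy => [E sy'].
  have D0 : (0 < D)%N by rewrite /D subn_gt0 E.
  apply: (mk D.+1 (loc y) (tau s) 1) => //; first by rewrite sy'.
  + by rewrite cyS /P E.
  + by rewrite cy0 nth_arc// addn0 E pt1.
- move: bsy byu => [E sy'] [E' yu'].
  have D0 : D = 0%N by rewrite /D -E' -E subnn.
  apply: (mk D.+1 (loc y) (tau s) (tau u)) => //; first by rewrite sy'.
  + by rewrite cyS /P E.
  + by rewrite cy0; move: nthD; rewrite D0 => ->; rewrite /P E'.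
Qed.

Lemma cumul_period (M : nmodType) (f : 'rV[R]_d -> 'rV[R]_d -> M) i t :
  cumul V f (i + n) t = cumul V f i t + \sum_(r < n) f (V r) (V r.+1).
Proof.
rewrite /cumul pt_period cyc_period -!addrA; rewrite [in RHS](addrC (f _ _)) addrA.
congr (_ + _); elim: i => [|i IH]; first by rewrite add0n big_ord0 add0r.
by rewrite addSn !big_ord_recr/= IH -addSn !cyc_period addrAC.
Qed.

Variables (k : nat) (b : nat -> R).
Hypothesis k0 : (0 < k)%N.
Hypothesis rb : forall j, (j <= k)%N -> reachable (b j).
Hypothesis bS : forall j, (j < k)%N -> b j <= b j.+1.
Hypothesis b0 : len <= b 0.
Hypothesis bk : b 0 + len <= b k.

(** False at position 0, where the edge found is the first one and not one that
    ends there; cuts lie beyond the first lap. *)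
Lemma edge_at_period s : reachable s -> 0 < s -> loc (s + len) = (loc s + n)%N.
Proof.
move=> rs s0; have [s1 s2 s3] := edge_atP rs; apply: edge_at_unique => //.
  by rewrite -addSn prefix_len_period// lerD2r.
move=> _; rewrite prefix_len_period// ltrD2r; case: (posnP (loc s)) => [->|/s3//].
by rewrite /prefix_len big_ord0.
Qed.

(** Without their closing sides, the arcs run from [b 0] to [b k] along the
    chain, which is at least one lap. So every point of the chain is on an arc;
    and, at a point that is not a cut, the number of sides passed, accumulated
    by [cumul], grows along a lap by the number of edges of the chain through
    the point. *)
Lemma arcs_cover : covers p (fun i : 'I_k => chain_curve (arc (b i) (b i.+1))).
Proof.
have l0 : 0 <= len by exact: len_ge0.
apply: covers_sides => //.
- by move=> i; rewrite size_arc.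
- move=> r t rn /andP[t0 t1].
  have [s sE] : exists s, s = pos V r t by eexists.
  have sl : 0 <= s <= len.
    rewrite sE /pos addr_ge0 ?mulr_ge0 ?edge_len_ge0//=; last by rewrite sumr_ge0// => j _; exact: edge_len_ge0.
    apply: le_trans (prefix_len_le V rn); rewrite prefix_lenS lerD2l.
    by rewrite ler_piMl// edge_len_ge0.
  have [u [bu ub ru Pu]] : exists u, [/\ b 0 <= u, u <= b k, reachable u & P u = pt V r t].
    move: sl => /andP[s0 sl]; move: l0; rewrite le_eqVlt => /orP[/eqP l0|l0].
      have [_ b00] := rb (leq0n k); have [_ bk0] := rb (leqnn k).
      have {}s0 : s = 0 by apply: le_anti; rewrite s0 l0 sl.
      have r0 : reachable 0 by split.
      exists 0; split; rewrite ?(b00 (esym l0)) ?(bk0 (esym l0))//; apply: chain_at_pt => //.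
        by rewrite t0 t1.
      by rewrite -sE.
    pose z := (b 0 - s) / len.
    have bs0 : 0 <= b 0 - s by rewrite subr_ge0; exact: (le_trans sl b0).
    have z0 : 0 <= z by rewrite /z divr_ge0// ltW.
    have zl : z * len = b 0 - s by rewrite /z divfK// gt_eqF.
    have /truncn_itv/andP[z1 z2] := z0.
    pose m := (Num.truncn z).+1; exists (s + m%:R * len).
    have u1 : b 0 <= s + m%:R * len.
      by have := ler_wpM2r (ltW l0) (ltW z2); rewrite zl -/m; lra.
    have u2 : s + m%:R * len <= b 0 + len.
      have := ler_wpM2r (ltW l0) z1; rewrite zl /m -(natr1 (Num.truncn z)); lra.
    have ru : reachable (s + m%:R * len).
      by split; [apply: le_trans u1; lra|move=> E; rewrite E ltxx in l0].
    split => //; first exact: le_trans bk.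
    rewrite (chain_at_pt (i := r + m * n) (t := t) ru) ?t0 ?t1//; first by rewrite ptM_period.
    by rewrite posM_period sE.
  have [j jk /andP[bj bj1]] : exists2 j, (j < k)%N & b j <= u <= b j.+1.
    have : (0 < k)%N by []; move: ub.
    elim: (k) => // j IH uj _; have [uj'|ju] := leP u (b j).
      have [j0|j0] := posnP j.
        by exists 0%N; rewrite // bu (le_trans uj')// j0 bS.
      have [i ij iu] := IH uj' j0.
      by exists i => //; exact: ltnW.
    by exists j; rewrite // (ltW ju).
  have [|r' [t' [r'D t'01 E]]] := arc_covers (rb (ltnW jk)) ru (rb jk) (y := u); first by rewrite bj.
  by exists (Ordinal jk), r', t'; rewrite -Pu.
- exists [set x | exists2 j, (j <= k)%N & x = P (b j)].
    rewrite (_ : [set x | _] = (fun j => P (b j)) @` [set j | (j <= k)%N]).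
      by apply: finite_image; exact: finite_II k.+1.
    by apply/seteqP; split => x [j jk xE]; exists j.
  move=> x xE; pose f := fun a c : 'rV[R]_d => inside x a c : nat.
  have add i t : 0 <= t -> x <> pt V i t -> forall u, t <= u <= 1 ->
    f (V i) (pt V i u) = f (V i) (pt V i t) + f (pt V i t) (pt V i u).
    by move=> t0 xt u /andP[tu _]; exact: inside_pt_add.
  pose c j := cumul V f (loc (b j)) (tau (b j)).
  have addP s : reachable s -> x <> P s -> forall u, tau s <= u <= 1 ->
      f (V (loc s)) (pt V (loc s) u) = f (V (loc s)) (P s) + f (P s) (pt V (loc s) u).
    by move=> /edge_frac01/andP[s0 _]; exact: add.
  pose S j := \sum_(r < size (arc (b j) (b j.+1)))
     f (cyc (arc (b j) (b j.+1)) r) (cyc (arc (b j) (b j.+1)) r.+1).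
  have xb j : (j <= k)%N -> x <> P (b j) by move=> jk E; apply: xE; exists j.
  have step j : (j < k)%N -> (c j.+1 <= c j + S j)%N.
    move=> jk; have jk' := ltnW jk.
    have /andP[_ s1] := edge_frac01 (rb jk'); have /andP[_ u1] := edge_frac01 (rb jk).
    have E := cumul_arc (before_edge_at (rb jk') (rb jk) (bS jk)) s1 u1 (addP _ (rb jk') (xb _ jk')).
    by rewrite /c -E /S arc_sides leq_add2l leq_addr.
  have total j : (j <= k)%N -> (c j <= c 0%N + \sum_(i < j) S i)%N.
    elim: j => [|j IH] jk; first by rewrite big_ord0 addn0.
    apply: (leq_trans (step _ jk)); rewrite big_ord_recr/= addnA leq_add2r.
    exact: (IH (ltnW jk)).
  rewrite -(leq_add2l (c 0%N)); apply: (leq_trans _ (total _ (leqnn k))).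
  move: l0; rewrite le_eqVlt => /orP[/eqP l0|l0].
    rewrite big1 => [|r _].
      have b0k : b 0 <= b k by move: bk; rewrite -l0 addr0.
      have /andP[_ s1] := edge_frac01 (rb (leq0n k)); have /andP[_ u1] := edge_frac01 (rb (leqnn k)).
      have E := cumul_arc (before_edge_at (rb (leq0n k)) (rb (leqnn k)) b0k) s1 u1
        (addP _ (rb (leq0n k)) (xb _ (leq0n k))).
      by rewrite addn0 /c -E; exact: leq_addr.
    have /eqP : edge_len V r = 0.
      by move/esym/psumr_eq0P: l0 => ->// j _; exact: edge_len_ge0.
    rewrite /f/= /inside => er0; case: asboolP => // -[]; case.
    by apply: edist_eq0; rewrite edistC -/(edge_len V r) (eqP er0).
  have r0 := rb (leq0n k); have b00 : 0 < b 0 by exact: lt_le_trans b0.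
  have rp := reachable_period r0.
  have E := edge_at_period r0 b00.
  have tE : tau (b 0 + len) = tau (b 0).
    by rewrite /edge_frac E prefix_len_period edge_len_period; congr (_ / _); ring.
  have Ec : cumul V f (loc (b 0 + len)) (tau (b 0 + len)) = (c 0%N + \sum_(r < n) f (V r) (V r.+1))%N.
    by rewrite E tE cumul_period.
  rewrite -Ec.
  have /andP[_ s1] := edge_frac01 rp; have /andP[_ u1] := edge_frac01 (rb (leqnn k)).
  have xrp : x <> P (b 0 + len) by rewrite (chain_at_period r0); exact: xb.
  have Ek := cumul_arc (before_edge_at rp (rb (leqnn k)) bk) s1 u1 (addP _ rp xrp).
  by rewrite /c -Ek; exact: leq_addr.
Qed.

End Cuts.

(** * Balancing the arcs *)

Section Balance.
Variables (R : realType) (k : nat) (w : R) (dl : nat -> R).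
Hypothesis k0 : (0 < k)%N.
Hypothesis dl0 : forall j, 0 <= dl j.
Hypothesis dlw : forall j, dl j <= w.
Hypothesis dlP : forall j, dl (j + k) = dl j.

Definition gain : R := 2 * (\sum_(j < k) dl j) / (k%:R * (k%:R + 1)).

(** The larger of the two shifts for which the arc over the window [i] satisfies
    the bound of [arc_short]. The start value 0 is at most the value after one
    round ([shift_ge0]), so the shifts increase from round to round. *)
Fixpoint shift (j : nat) : R :=
  if j is i.+1 then Num.max ((dl i - gain) / 2) (shift i - gain / 2) else 0.

Let kR : 0 < k%:R :> R. Proof. by rewrite ltr0n. Qed.

Lemma gain_ge0 : 0 <= gain.
Proof.
by rewrite /gain divr_ge0 ?mulr_ge0 ?sumr_ge0 ?addr_ge0// ?ltW.
Qed.

Lemma w_ge0 : 0 <= w. Proof. exact: le_trans (dl0 0) (dlw 0). Qed.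

Lemma gain_le : gain <= w.
Proof.
rewrite /gain ler_pdivrMr ?mulr_gt0 ?addr_gt0//.
apply: (@le_trans _ _ (2 * (w * k%:R))).
  rewrite ler_pM2l// mulr_natr -[k in _ *+ k]card_ord -sumr_const.
  by apply: ler_sum => j _; exact: dlw.
have : 0 <= w * k%:R * (k%:R - 1).
  by rewrite !mulr_ge0 ?w_ge0 ?subr_ge0 ?ler1n// ltW.
by move: (k%:R) => K; nra.
Qed.

Lemma shift_le j : shift j <= w / 2.
Proof.
have g0 := gain_ge0; have w0 := w_ge0.
elim: j => [|j IH] /=; first by lra.
have dj := dlw j; rewrite ge_max; apply/andP; split; last by lra.
by rewrite ler_pM2r// ?invr_gt0//; lra.
Qed.

Lemma shiftS_ge j : shift j - gain / 2 <= shift j.+1.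
Proof. by rewrite /= le_max lexx orbT. Qed.

(** Used below for the last [k] windows, which all force a lower bound on the
    same shift. *)
Lemma shift_ge_window j i : (dl j - gain) / 2 - i%:R * (gain / 2) <= shift (j.+1 + i).
Proof.
elim: i => [|i IH]; first by rewrite addn0 mul0r subr0 /= le_max lexx.
rewrite addnS; apply: le_trans (shiftS_ge _); rewrite -(natr1 i); lra.
Qed.

Lemma sum_dl_shift a : \sum_(i < k) dl (a + i) = \sum_(i < k) dl i.
Proof.
elim: a => [|a IH]; first by apply: eq_bigr => i _; rewrite add0n.
rewrite -IH -(@sum_shift _ (fun i => dl (a + i))) ?addn0//.
by apply: eq_bigr => i _; rewrite addSnnS.
Qed.

(** The term [m - i], and not [m - i - 1], because a window loses [gain / 2]
    once for itself and once for each of the [m - i - 1] arcs that follow it. *)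
Lemma sum_countdown m : \sum_(i < m) (m%:R - i%:R) = m%:R * (m%:R + 1) / 2 :> R.
Proof.
rewrite sumrB sumr_const card_ord.
have -> : \sum_(i < m) i%:R = m%:R * (m%:R - 1) / 2 :> R.
  elim: m => [|m IH]; first by rewrite big_ord0; lra.
  by rewrite big_ord_recr/= IH -(natr1 m); field.
by rewrite -mulr_natr; field.
Qed.

(** By [shift_ge_window] for the [k] preceding windows, the shift has [k] lower
    bounds. Their mean is 0, by the choice of [gain]. *)
Lemma shift_ge0 j : 0 <= shift (k + j).
Proof.
have : \sum_(i < k) ((dl (j + i) - (k%:R - i%:R) * gain) / 2) <= \sum_(i < k) shift (k + j).
  apply: ler_sum => i _.
  have := shift_ge_window (j + i) (k - i.+1).
  have -> : ((j + i).+1 + (k - i.+1) = k + j)%N.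
    by rewrite -addnS -addnA subnKC// addnC.
  by apply: le_trans; rewrite natrB// -(natr1 i); lra.
rewrite sumr_const card_ord -mulr_suml sumrB sum_dl_shift -mulr_suml sum_countdown.
have -> : \sum_(i < k) dl i = k%:R * (k%:R + 1) / 2 * gain.
  by rewrite /gain; field; rewrite !gt_eqF// addr_gt0.
by rewrite subrr mul0r pmulrn_lge0.
Qed.

(** The recursion is monotone and its input periodic; [shift_ge0] compares the
    two start values. *)
Lemma shift_period j : shift j <= shift (k + j).
Proof.
elim: j => [|j IH]; first by rewrite shift_ge0.
by rewrite addnS /= [(k + j)%N]addnC dlP addnC le_max2// lerD2r.
Qed.

End Balance.

Section Windows.
Variables (R : realType) (d : nat) (p : seq 'rV[R]_d) (k : nat).
Hypothesis p0 : (0 < size p)%N.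
Hypothesis k3 : (3 <= k)%N.
Local Notation len := (prefix_len (cyc p) (size p)).
Let w : R := len / k%:R.

Definition window_pt (j : nat) : 'rV[R]_d := chain_at p (j%:R * (len / (3 * k)%:R)).

(** The chord of the window of length [w], i.e. three steps, that starts at the
    point [j]. *)
Definition chord (j : nat) : R := edist (window_pt (j + 3)) (window_pt j).

Let k0 : (0 < k)%N. Proof. exact: leq_trans k3. Qed.
Let kR : 0 < k%:R :> R. Proof. by rewrite ltr0n. Qed.
Let l0 : 0 <= len. Proof. exact: len_ge0. Qed.
Let w0 : 0 <= w. Proof. by rewrite divr_ge0. Qed.
Let w3E : len / (3 * k)%:R = w / 3.
Proof. by rewrite /w natrM; field; rewrite gt_eqF. Qed.
Let wk : w * k%:R = len. Proof. by rewrite /w divfK// gt_eqF. Qed.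

Lemma window_pt_reachable (j : nat) : reachable p (j%:R * (len / (3 * k)%:R)).
Proof.
split; first by rewrite mulr_ge0// divr_ge0.
by move=> ->; rewrite mul0r mulr0.
Qed.

Lemma window_pt_lip j m : edist (window_pt (j + m)) (window_pt j) <= m%:R * (w / 3).
Proof.
apply: (le_trans (chain_at_lip (window_pt_reachable _) (window_pt_reachable _))).
rewrite w3E natrD mulrDl addrAC subrr add0r ger0_norm// mulr_ge0// divr_ge0//.
Qed.

Lemma chord_le j : chord j <= w.
Proof. by apply: (le_trans (window_pt_lip _ _)); lra. Qed.

Lemma window_pt_period j : window_pt (j + 3 * k) = window_pt j.
Proof.
rewrite /window_pt -(chain_at_period (window_pt_reachable j)) natrD mulrDl; congr (chain_at p (_ + _)).
by rewrite mulrC divfK// pnatr_eq0 muln_eq0/= -lt0n.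
Qed.

Lemma chord_period j : chord (j + 3 * k) = chord j.
Proof. by rewrite /chord addnAC !window_pt_period. Qed.

(** [wirtinger3] for each coordinate of the steps, whose sum over a lap is
    zero. *)
Lemma wirtinger_chord :
  \sum_(j < 3 * k) chord j ^+ 2 <= (3 - 4 / k%:R ^+ 2) ^+ 2 *
    \sum_(j < 3 * k) edist (window_pt j.+1) (window_pt j) ^+ 2.
Proof.
pose x c j := window_pt j.+1 ord0 c - window_pt j ord0 c.
have E (a b : 'rV[R]_d) : edist a b ^+ 2 = \sum_(c < d) (a ord0 c - b ord0 c) ^+ 2.
  by rewrite edistE enorm_sq; apply: eq_bigr => c _; rewrite !mxE.
rewrite (eq_bigr (fun j : 'I_(3 * k) => \sum_(c < d) (x c j + x c j.+1 + x c j.+2) ^+ 2)); last first.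
  move=> j _; rewrite /chord E addn3; apply: eq_bigr => c _; congr (_ ^+ 2); rewrite /x; ring.
rewrite exchange_big [X in _ <= _ * X](eq_bigr (fun j : 'I_(3 * k) => \sum_(c < d) x c j ^+ 2)); last first.
  by move=> j _; rewrite E.
rewrite [X in _ <= _ * X]exchange_big mulr_sumr; apply: ler_sum => c _ /=.
apply: wirtinger3 => //.
  by move=> j; rewrite /x -addSn !window_pt_period.
rewrite /x -(big_mkord xpredT (fun j => window_pt j.+1 ord0 c - window_pt j ord0 c)) telescope_sumr//.
by rewrite -[(3 * k)%N in X in X - _]add0n window_pt_period subrr.
Qed.

(** Cauchy-Schwarz passes from squares to chords, and each step is at most
    [w / 3]. *)
Lemma sum_chord : \sum_(j < 3 * k) chord j <= (3 - 4 / k%:R ^+ 2) * len.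
Proof.
have q0 : 0 <= 3 - 4 / k%:R ^+ 2 :> R.
  have q1 : k%:R^-1 <= 1 :> R by rewrite invf_le1// ler1n.
  have q2 : 0 <= k%:R^-1 :> R by rewrite invr_ge0 ltW.
  have q3 : k%:R^-1 <= 3^-1 :> R by rewrite lef_pV2 ?posrE// ler_nat.
  have := ler_pM q2 q2 q3 q1.
  by rewrite -exprVn expr2; move: (k%:R^-1) q3 => q q3; lra.
rewrite -ler_sqr ?nnegrE ?mulr_ge0//; last by rewrite sumr_ge0// => j _; exact: edist_ge0.
have := cauchy_schwarz (fun j : 'I_(3 * k) => chord j) (fun=> 1).
rewrite (eq_bigr (fun j : 'I_(3 * k) => chord j)) => [|j _]; last by rewrite mulr1.
move=> /le_trans; apply.
rewrite [X in _ * X](eq_bigr (fun=> 1)) => [|j _]; last by rewrite expr1n.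
rewrite sumr_const card_ord.
apply: (@le_trans _ _ ((3 - 4 / k%:R ^+ 2) ^+ 2 * ((3 * k)%:R * (w / 3) ^+ 2) * (3 * k)%:R)).
  rewrite ler_wpM2r//; apply: (le_trans wirtinger_chord); rewrite ler_wpM2l ?sqr_ge0//.
  rewrite mulr_natl -[X in _ <= _ *+ X](card_ord (3 * k)) -sumr_const; apply: ler_sum => j _.
  have := window_pt_lip j 1; rewrite addn1 mul1r => h.
  by rewrite ler_sqr ?nnegrE ?edist_ge0// divr_ge0.
by rewrite exprMn -wk natrM; lra.
Qed.

Definition family_sum (f : nat) : R := \sum_(j < k) chord (3 * j + f).

Lemma sum_families : \sum_(j < 3 * k) chord j = family_sum 0 + family_sum 1 + family_sum 2.
Proof.
rewrite /family_sum; elim: (k) => [|m IH]; first by rewrite !big_ord0 !addr0.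
by rewrite mulnS addnC addn3 !big_ord_recr/= IH addn0 addn1 addn2; ring.
Qed.

Variable f : nat.
Hypothesis fmin : forall f', (f' < 3)%N -> family_sum f <= family_sum f'.
Hypothesis f3 : (f < 3)%N.

Definition deficit (j : nat) : R := w - chord (3 * j + f).

(** Cuts use the shifts of the second round, which are nonnegative. *)
Definition cut (j : nat) : R :=
  (3 * (k + j) + f)%:R * (len / (3 * k)%:R) + shift k deficit (k + j).

Lemma deficit_ge0 j : 0 <= deficit j. Proof. by rewrite subr_ge0 chord_le. Qed.

Lemma deficit_le j : deficit j <= w.
Proof. by rewrite gerBl; exact: edist_ge0. Qed.

Lemma deficit_period j : deficit (j + k) = deficit j.
Proof. by rewrite /deficit mulnDr addnAC chord_period. Qed.

Let sh0 j : 0 <= shift k deficit (k + j).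
Proof. exact: (shift_ge0 k0 deficit_period). Qed.

Let shw j : shift k deficit j <= w / 2.
Proof. exact: (shift_le k deficit_ge0 deficit_le). Qed.

Let g0 : 0 <= gain k deficit. Proof. exact: (gain_ge0 k deficit_ge0). Qed.

Lemma sum_deficit : \sum_(j < k) deficit j = len - family_sum f.
Proof. by rewrite sumrB sumr_const card_ord -mulr_natr wk. Qed.

(** The best of the three families has at most a third of the sum of all
    chords. *)
Lemma gain_lower : 8 / (3 * k%:R ^+ 2 * (k%:R + 1)) * w <= gain k deficit.
Proof.
have F : family_sum f <= (1 - 4 / (3 * k%:R ^+ 2)) * len.
  have := fmin (isT : (0 < 3)%N); have := fmin (isT : (1 < 3)%N).
  have := fmin (isT : (2 < 3)%N); have := sum_chord; rewrite sum_families.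
  have -> : 4 / (3 * k%:R ^+ 2) = 4 / k%:R ^+ 2 / 3 :> R by field; rewrite gt_eqF.
  by move: (family_sum f) (family_sum 0) (family_sum 1) (family_sum 2) (4 / _) => *; lra.
rewrite /gain sum_deficit ler_pdivlMr ?mulr_gt0 ?addr_gt0//.
have -> : 8 / (3 * k%:R ^+ 2 * (k%:R + 1)) * w * (k%:R * (k%:R + 1)) =
    2 * (4 / (3 * k%:R ^+ 2) * len).
  by rewrite -wk; field; rewrite !gt_eqF// addr_gt0.
by rewrite ler_pM2l//; lra.
Qed.

Lemma cutE j : cut j = (k%:R + j%:R) * w + f%:R * (w / 3) + shift k deficit (k + j).
Proof. by rewrite /cut w3E natrD natrM natrD; congr (_ + _); field. Qed.

Lemma cut_reachable j : reachable p (cut j).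
Proof.
split; first by rewrite addr_ge0// mulr_ge0// divr_ge0.
move=> E; rewrite /cut E mul0r mulr0 add0r; apply: le_anti; rewrite sh0 andbT.
by apply: le_trans (shw _) _; rewrite /w E !mul0r.
Qed.

Lemma cutS j : cut j.+1 = cut j + w + shift k deficit (k + j).+1 - shift k deficit (k + j).
Proof.
have e : (3 * (k + j.+1) + f = 3 * (k + j) + f + 3)%N by lia.
rewrite /cut e (addnS k j) (natrD _ _ 3) w3E; by field.
Qed.

Lemma cut_le j : cut j <= cut j.+1.
Proof.
rewrite cutS; have := shiftS_ge k deficit (k + j).
have := gain_le k0 deficit_ge0 deficit_le; have := w0; rewrite -/w; lra.
Qed.

Lemma cut_ge : len <= cut 0.
Proof.
have := sh0 0; have : 0 <= f%:R * (w / 3) by rewrite mulr_ge0// divr_ge0.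
by rewrite cutE addr0 [k%:R * w]mulrC wk; lra.
Qed.

(** The last cut comes at least one lap after the first, since its shift is one
    round later. *)
Lemma cut_period : cut 0 + len <= cut k.
Proof.
have := shift_period k0 deficit_period k.
by rewrite !cutE addr0 mulrDl [k%:R * w]mulrC wk addn0; lra.
Qed.

(** One lap before the first window, at most one lap of windows, and the offset
    of the family and the shift, which together are at most [3 w <= L]. *)
Lemma cut_le3 j : (j <= k)%N -> cut j <= 3 * len.
Proof.
move=> jk; have := shw (k + j); have f2 : f%:R <= 2 :> R by rewrite ler_nat -ltnS.
have := ler_wpM2r w0 (_ : j%:R <= k%:R); rewrite ler_nat => /(_ jk).
have := ler_wpM2r w0 f2; have := ler_wpM2r w0 (_ : 3 <= k%:R); rewrite ler_nat => /(_ k3).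
by move: w0; rewrite cutE mulrDl -wk; lra.
Qed.

(** Either the next shift is smaller by [gain / 2], and the arc itself is short;
    or the next shift is governed by the deficit of the window, and the chord of
    the arc exceeds that of the window by at most the two shifts. *)
Lemma arc_short j : cut j.+1 - cut j + edist (chain_at p (cut j)) (chain_at p (cut j.+1)) <=
  2 * w - gain k deficit.
Proof.
have E := cutS j; set y := shift k deficit (k + j) in E *.
set y' := shift k deficit (k + j).+1 in E *.
have y'E : y' = Num.max ((deficit (k + j) - gain k deficit) / 2) (y - gain k deficit / 2) by [].
have ch1 : edist (chain_at p (cut j)) (chain_at p (cut j.+1)) <= cut j.+1 - cut j.
  apply: (le_trans (chain_at_lip (cut_reachable _) (cut_reachable _))).
  by rewrite distrC ger0_norm// subr_ge0 cut_le.
have ch2 : edist (chain_at p (cut j)) (chain_at p (cut j.+1)) <= y + (w - deficit (k + j)) + y'.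
  have wj : window_pt (3 * (k + j) + f) = chain_at p (cut j - y).
    by rewrite /window_pt /cut addrK.
  have cw : cut j.+1 - y' = (3 * (k + j) + f + 3)%:R * (len / (3 * k)%:R).
    have cj : cut j = (3 * (k + j) + f)%:R * (w / 3) + y by rewrite /cut w3E.
    by rewrite E cj (natrD _ _ 3) w3E; lra.
  have wj3 : window_pt (3 * (k + j) + f + 3) = chain_at p (cut j.+1 - y') by rewrite /window_pt cw.
  apply: (le_trans (edist_triangle (window_pt (3 * (k + j) + f)) _ _)).
  rewrite -addrA; apply: lerD.
    rewrite wj; apply: (le_trans (chain_at_lip (cut_reachable _) _)).
      by rewrite /cut addrK; exact: window_pt_reachable.
    by rewrite subKr ger0_norm// sh0.
  apply: (le_trans (edist_triangle (window_pt (3 * (k + j) + f + 3)) _ _)); apply: lerD.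
    by rewrite /deficit subKr edistC.
  rewrite wj3; apply: (le_trans (chain_at_lip _ (cut_reachable _))).
    rewrite cw; exact: window_pt_reachable.
  by rewrite distrC subKr ger0_norm// /y' -addnS sh0.
have [h|h] : y' = (deficit (k + j) - gain k deficit) / 2 \/ y' = y - gain k deficit / 2.
  by rewrite y'E; case: leP; [right|left].
- by move: ch1 ch2; rewrite E h; lra.
- by move: ch1 ch2; rewrite E h; lra.
Qed.

Definition curves : k.-tuple (seq 'rV[R]_d) :=
  [tuple arc p (cut i) (cut i.+1) | i < k].

Lemma curves_approximation (rho : R) :
  2 - 8 / (3 * k%:R ^+ 2 * (k%:R + 1)) <= rho ->
  is_approximation rho p (chain_curves curves).
Proof.
move=> hrho.
have cE : chain_curves curves = fun i : 'I_k => chain_curve (arc p (cut i) (cut i.+1)).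
  by apply/funext => i; rewrite /chain_curves tnth_mktuple.
have arc0 i : (0 < size (arc p (cut i) (cut i.+1)))%N by rewrite size_arc.
have e2 : 8 / (3 * k%:R ^+ 2 * (k%:R + 1)) <= 2 :> R.
  rewrite ler_pdivrMr ?mulr_gt0 ?addr_gt0 ?exprn_gt0//.
  have : 1 <= k%:R :> R by rewrite ler1n.
  move: (k%:R) => K K1; have : 1 <= K ^+ 2 by rewrite expr2; nra.
  by move: (K ^+ 2) => K2; nra.
have w2 : (w%:E <= opt p k)%E by exact: opt_ge.
rewrite cE; split=> [i||i].
- by split; [exact: chain_continuous|exact: chain_closed].
- by apply: arcs_cover => // [j _|j _||]; [exact: cut_reachable|exact: cut_le|exact: cut_ge|exact: cut_period].
- apply: (le_trans (chain_length _)).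
  rewrite arc_length; [|exact: cut_reachable|exact: cut_reachable|exact: cut_le].
  apply: (@le_trans _ _ (rho * w)%:E).
    rewrite lee_fin; apply: (le_trans (arc_short i)).
    apply: (@le_trans _ _ ((2 - 8 / (3 * k%:R ^+ 2 * (k%:R + 1))) * w)).
      by have := gain_lower; rewrite mulrBl; lra.
    by rewrite ler_wpM2r.
  by rewrite EFinM lee_wpmul2l// lee_fin (le_trans _ hrho)// subr_ge0.
Qed.

End Windows.

(** The inequality reduces to [3 (k + 1) <= 32 k]. *)
Lemma ratio_general (R : realType) (k : nat) : (3 <= k)%N ->
  2 - 8 / (3 * k%:R ^+ 2 * (k%:R + 1)) <= 2 - 1 / (4 * k%:R ^+ 3) :> R.
Proof.
move=> k3; have k1 : 1 <= k%:R :> R by rewrite ler1n (leq_trans _ k3).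
have k0 : 0 < k%:R :> R by exact: lt_le_trans k1.
rewrite lerD2l lerN2 ler_pdivlMr ?mulr_gt0 ?addr_gt0 ?exprn_gt0//.
rewrite mul1r mulrC ler_pdivrMr ?mulr_gt0 ?exprn_gt0//.
have -> : 8 * (4 * k%:R ^+ 3) = 3 * k%:R ^+ 2 * (32 / 3 * k%:R) :> R by field.
by rewrite ler_pM2l ?mulr_gt0 ?exprn_gt0//; lra.
Qed.

Lemma ratio_small (R : realType) (k : nat) (rho : R) : (k, rho) \in small_ratios R ->
  2 - 8 / (3 * k%:R ^+ 2 * (k%:R + 1)) <= rho.
Proof.
rewrite /small_ratios !inE !xpair_eqE.
by do ![case/orP]; move=> /andP[/eqP -> /eqP ->]; rewrite lerBlDr -lerBlDl ?ler_pdivlMr//; lra.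
Qed.

(** * Programs and their running time *)

Section Hoare.
Variable R : realType.
Implicit Types (s : state R) (c : cmd).

Fixpoint straight c : bool :=
  match c with
  | Seq c1 c2 | If _ c1 c2 => straight c1 && straight c2
  | While _ _ => false
  | _ => true
  end.

(** The effect of a command without loops. *)
Fixpoint run s c : state R :=
  match c with
  | NSet a i e => State (update (nmem s) a (neval s i) (neval s e)) (rmem s) (nout s) (rout s)
  | RSet a i e => State (nmem s) (update (rmem s) a (neval s i) (reval s e)) (nout s) (rout s)
  | NOut e => State (nmem s) (rmem s) (rcons (nout s) (neval s e)) (rout s)
  | ROut e => State (nmem s) (rmem s) (nout s) (rcons (rout s) (reval s e))
  | Seq c1 c2 => run (run s c1) c2
  | If b c1 c2 => if beval s b then run s c1 else run s c2
  | _ => s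
  end.

Fixpoint csize c : nat :=
  match c with
  | Seq c1 c2 => csize c1 + csize c2
  | If _ c1 c2 => (csize c1 + csize c2).+1
  | While _ c1 => csize c1
  | _ => 1
  end.

Lemma exec_run c s : straight c -> exists2 t, exec c s t (run s c) & (t <= csize c)%N.
Proof.
elim: c s => [|a i e|a i e|e|e|c1 IH1 c2 IH2|b c1 IH1 c2 IH2|b c1 IH1] s //=;
  try by (move=> _; exists 1%N => //; constructor).
- move=> /andP[/IH1-/(_ s)[t1 e1 l1] /IH2-/(_ (run s c1))[t2 e2 l2]].
  by exists (t1 + t2)%N; [exact: ExecSeq e1 e2|exact: leq_add].
- move=> /andP[/IH1-/(_ s)[t1 e1 l1] /IH2-/(_ s)[t2 e2 l2]].
  case: ifPn => bs; [exists t1.+1; first exact: ExecIfT|exists t2.+1; first exact: ExecIfF].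
    by rewrite ltnS (leq_trans l1)// leq_addr.
  by rewrite ltnS (leq_trans l2)// leq_addl.
Qed.

Fixpoint nwrites c (a : nat) : bool :=
  match c with
  | NSet a' _ _ => a == a'
  | Seq c1 c2 | If _ c1 c2 => nwrites c1 a || nwrites c2 a
  | While _ c1 => nwrites c1 a
  | _ => false
  end.

Fixpoint rwrites c (a : nat) : bool :=
  match c with
  | RSet a' _ _ => a == a'
  | Seq c1 c2 | If _ c1 c2 => rwrites c1 a || rwrites c2 a
  | While _ c1 => rwrites c1 a
  | _ => false
  end.

Fixpoint outputs c : bool :=
  match c with
  | NOut _ | ROut _ => true
  | Seq c1 c2 | If _ c1 c2 => outputs c1 || outputs c2
  | While _ c1 => outputs c1
  | _ => false
  end.

(** Frame condition: it carries the facts about memory from one phase of the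
    program to the next. *)
Definition agree c s s' : Prop :=
  [/\ forall a i, ~~ nwrites c a -> nmem s' a i = nmem s a i,
      forall a i, ~~ rwrites c a -> rmem s' a i = rmem s a i &
      ~~ outputs c -> nout s' = nout s /\ rout s' = rout s].

Lemma agree_refl c s : agree c s s. Proof. by []. Qed.

Lemma agree_trans c s1 s2 s3 : agree c s1 s2 -> agree c s2 s3 -> agree c s1 s3.
Proof.
move=> [n1 r1 o1] [n2 r2 o2]; split.
- by move=> a i h; rewrite n2// n1.
- by move=> a i h; rewrite r2// r1.
- by move=> h; have [-> ->] := o2 h; exact: o1.
Qed.

Lemma agree_sub c c' s s' : (forall a, nwrites c a -> nwrites c' a) ->
  (forall a, rwrites c a -> rwrites c' a) -> (outputs c -> outputs c') ->
  agree c s s' -> agree c' s s'.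
Proof.
move=> sn sr so [n1 r1 o1]; split.
- by move=> a i h; apply: n1; apply: contra h; exact: sn.
- by move=> a i h; apply: r1; apply: contra h; exact: sr.
- by move=> h; apply: o1; apply: contra h.
Qed.

Lemma exec_agree c s t s' : exec c s t s' -> agree c s s'.
Proof.
elim=> {c s t s'} //=.
- move=> a i e s; split => //= a' i' h; by rewrite /update (negbTE h).
- move=> a i e s; split => //= a' i' h; by rewrite /update (negbTE h).
- move=> c1 c2 s1 s2 s3 t1 t2 _ a1 _ a2; apply: agree_trans.
    by apply: agree_sub a1 => /= [a ->|a ->|->].
  by apply: agree_sub a2 => /= [a ->|a ->|->]; rewrite orbT.
- by move=> b c1 c2 s t s' _ _; apply: agree_sub => /= [a ->|a ->|->].
- by move=> b c1 c2 s t s' _ _; apply: agree_sub => /= [a ->|a ->|->]; rewrite orbT.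
- by move=> b c s1 s2 s3 t1 t2 _ _ a1 _ a2; exact: agree_trans a1 a2.
Qed.

(** The step may use [agree c s0 s], so that the invariant has to describe only
    what the loop changes. *)
Lemma while_rule b c (Inv : state R -> Prop) (mu : state R -> nat) s0 :
  straight c -> Inv s0 ->
  (forall s, agree c s0 s -> Inv s -> beval s b -> Inv (run s c) /\ (mu (run s c) < mu s)%N) ->
  exists t s', [/\ exec (While b c) s0 t s', (t <= (csize c).+1 * mu s0 + 1)%N,
    agree c s0 s', Inv s' & ~~ beval s' b].
Proof.
move=> sc inv0 step.
suff H m s : (mu s <= m)%N -> agree c s0 s -> Inv s -> exists t s',
    [/\ exec (While b c) s t s', (t <= (csize c).+1 * mu s + 1)%N,
      agree c s0 s', Inv s' & ~~ beval s' b].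
  exact: (H _ _ (leqnn _) (agree_refl c s0) inv0).
elim: m s => [|m IH] s sm as0 invs; have [bs|bs] := boolP (beval s b);
  try by (exists 1%N, s; split => //; [exact: ExecWhileF|rewrite leq_addl]).
  by have [_] := step _ as0 invs bs; move: sm; rewrite leqn0 => /eqP ->; rewrite ltn0.
have [inv' lt] := step _ as0 invs bs; have [t1 e1 l1] := exec_run s sc.
have as1 := agree_trans as0 (exec_agree e1).
have [t2 [s' [e2 l2 a2 i2 b2]]] := IH _ (leq_trans lt sm) as1 inv'.
exists (t1 + t2).+1, s'; split => //; first exact: ExecWhileT e1 e2.
apply: (@leq_trans ((csize c).+1 * (mu (run s c)).+1 + 1)); last first.
  by rewrite leq_add2r leq_mul2l lt orbT.
by rewrite mulnS -addnA -addSn leq_add.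
Qed.

Lemma update_same (T : Type) (m : nat -> nat -> T) a i v : update m a i v a i = v.
Proof. by rewrite /update !eqxx. Qed.

Lemma neval_mem nm rm o1 o2 o1' o2' e :
  neval (State nm rm o1 o2 : state R) e = neval (State nm rm o1' o2' : state R) e.
Proof. by elim: e => //= [a i ->|e1 -> e2 ->|e1 -> e2 ->]. Qed.

Lemma reval_mem nm rm o1 o2 o1' o2' e :
  reval (State nm rm o1 o2 : state R) e = reval (State nm rm o1' o2' : state R) e.
Proof.
by elim: e => //= [i|a i|e1 -> e2 ->|e1 -> e2 ->|e1 -> e2 ->|e1 -> e2 ->|e1 ->] //;
  rewrite (neval_mem nm rm o1 o2 o1' o2').
Qed.

Variable d : nat.

Definition out_coords (E : 'I_d -> rexp) : cmd := foldr Seq Skip [seq ROut (E j) | j <- enum 'I_d].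

Lemma straight_out_coords E : straight (out_coords E).
Proof. by rewrite /out_coords; elim: (enum 'I_d) => //= j r ->. Qed.

Lemma run_out_coords E s : run s (out_coords E) =
  State (nmem s) (rmem s) (nout s) (rout s ++ [seq reval s (E j) | j <- enum 'I_d]).
Proof.
rewrite /out_coords; elim: (enum 'I_d) s => [|j r IH] s /=; first by rewrite cats0; case: s.
rewrite IH /= cat_rcons; congr (State _ _ _ (_ ++ _ :: _)); apply: eq_map => i.
by case: s => nm rm o1 o2 /=; exact: reval_mem.
Qed.

Lemma out_coords_writes E : (forall a, nwrites (out_coords E) a = false) /\
  (forall a, rwrites (out_coords E) a = false).
Proof.
by split=> a; rewrite /out_coords; elim: (enum 'I_d) => //= j r ->.
Qed.

Definition dist_exp (E1 E2 : 'I_d -> rexp) : rexp :=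
  RSqrt (foldr RAdd (RNat (NLit 0))
    [seq RMul (RSub (E1 j) (E2 j)) (RSub (E1 j) (E2 j)) | j <- enum 'I_d]).

Lemma reval_dist s E1 E2 (x y : 'rV[R]_d) :
  (forall j, reval s (E1 j) = x ord0 j) -> (forall j, reval s (E2 j) = y ord0 j) ->
  reval s (dist_exp E1 E2) = edist x y.
Proof.
move=> h1 h2; rewrite /dist_exp /= /Defs.edist; congr Num.sqrt.
rewrite -big_enum/=; elim: (enum 'I_d) => [|j r IH] /=; first by rewrite big_nil.
by rewrite big_cons IH h1 h2 expr2.
Qed.

End Hoare.

Lemma nth_coords (R : realType) (d : nat) (p : seq 'rV[R]_d) i (j : 'I_d) :
  (i < size p)%N -> nth 0 (coords p) (i * d + j) = nth 0 p i ord0 j.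
Proof.
elim: p i => // x p IH [|i] /=; rewrite /coords/= nth_cat size_map size_enum_ord.
  by move=> _; rewrite mul0n add0n ltn_ord (nth_map j) ?size_enum_ord// nth_ord_enum.
rewrite ltnS => ip; rewrite mulSn -addnA ltnNge leq_addr/= addKn; exact: IH.
Qed.

(** * The program and its phases *)

Definition loop (init : cmd) (b : bexp) (body : cmd) : cmd := Seq init (While b body).

(** The factor 10 serves all loops of the program, whose variants start at no
    more than [10 (n + k)]. *)
Definition loop_cost (init body : cmd) : nat := (csize init + 10 * (csize body).+1).+1.

Lemma loop_rule (R : realType) init b body (Inv : state R -> Prop) (mu : state R -> nat)
    (m : nat) (s : state R) :
  straight init -> straight body -> (0 < m)%N ->
  Inv (run s init) -> (mu (run s init) <= 10 * m)%N ->
  (forall s', agree (loop init b body) s s' -> Inv s' -> beval s' b ->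
     Inv (run s' body) /\ (mu (run s' body) < mu s')%N) ->
  exists t s', [/\ exec (loop init b body) s t s', (t <= loop_cost init body * m)%N,
    agree (loop init b body) s s', Inv s' & ~~ beval s' b].
Proof.
move=> si sb m0 inv0 mu0 step; have [t1 e1 l1] := exec_run s si.
have a1 : agree (loop init b body) s (run s init).
  by apply: agree_sub (exec_agree e1) => /= [a ->|a ->|->].
have [|t2 [s' [e2 l2 a2 i2 b2]]] := while_rule (b := b) (mu := mu) sb inv0.
  move=> s' as' inv' bs'; apply: step => //; apply: agree_trans a1 _.
  by apply: agree_sub as' => /= [a ->|a ->|->]; rewrite orbT.
exists (t1 + t2)%N, s'; split => //; first exact: ExecSeq e1 e2.
  apply: (leq_trans (leq_add l1 l2)); rewrite /loop_cost.
  move: mu0 m0; move: (mu _) (csize init) (csize body) => u x y; nia.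
apply: agree_trans a1 _.
by apply: agree_sub a2 => /= [a ->|a ->|->]; rewrite orbT.
Qed.

Definition phase_cost (c : cmd) : nat :=
  if c is Seq init (While _ body) then loop_cost init body else csize c.

Lemma loop_phase (R : realType) init b body (Inv Post : state R -> Prop)
    (mu : state R -> nat) (m : nat) (s : state R) :
  straight init -> straight body -> (0 < m)%N ->
  Inv (run s init) -> (mu (run s init) <= 10 * m)%N ->
  (forall s', agree (loop init b body) s s' -> Inv s' -> beval s' b ->
     Inv (run s' body) /\ (mu (run s' body) < mu s')%N) ->
  (forall s', agree (loop init b body) s s' -> Inv s' -> ~~ beval s' b -> Post s') ->
  exists t s', [/\ exec (loop init b body) s t s',
    (t <= phase_cost (loop init b body) * m)%N, agree (loop init b body) s s' & Post s'].
Proof.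
move=> si sb m0 inv0 mu0 step post.
have [t [s' [e l a i nb]]] := loop_rule si sb m0 inv0 mu0 step.
by exists t, s'; split => //; exact: post.
Qed.

Section Program.
Variable d : nat.

Local Notation lit := NLit.
Local Notation "x :+ y" := (NAdd x y) (at level 50, left associativity).
Local Notation var a := (NGet a (NLit 0)).
Local Notation setv a e := (NSet a (NLit 0) e).
Local Notation incr a := (NSet a (NLit 0) (NAdd (NGet a (NLit 0)) (NLit 1))).
Local Notation nx := (NGet 0 (NLit 0)).
Local Notation kx := (NGet 0 (NLit 1)).

(** Arrays of integers: 1 and 2 hold the loop counters, 3 the running input
    offset, 4 the chosen family, 5 the input offsets of the vertices, 6 and 7 the
    edges of the window points and of the cuts.  Arrays of reals: 1 holds the
    prefix lengths, 2 the chord sums, 3 the shifts, 4 the gain. *)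
Definition n3x : nexp := nx :+ (nx :+ nx).
Definition k3x : nexp := kx :+ (kx :+ kx).
Definition lamx (e : nexp) : rexp := RGet 1 e.
Definition vx (e : nexp) (j : 'I_d) : rexp := RGet 0 (NGet 5 e :+ lit j).
Definition ptx (e : nexp) (b : rexp) (j : 'I_d) : rexp :=
  RAdd (vx e j) (RMul (RDiv (RSub b (lamx e)) (RSub (lamx (e :+ lit 1)) (lamx e)))
                      (RSub (vx (e :+ lit 1) j) (vx e j))).
Definition stepx : rexp := RDiv (lamx nx) (RNat k3x).
Definition winx (e : nexp) : rexp := RMul (RNat e) stepx.
Definition windowx (e : nexp) : 'I_d -> rexp := ptx (NGet 6 e) (winx e).
Definition chordx (e : nexp) : rexp := dist_exp (windowx (e :+ lit 3)) (windowx e).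
Definition cutx (e : nexp) : rexp :=
  RAdd (winx ((kx :+ e) :+ ((kx :+ e) :+ (kx :+ e)) :+ var 4)) (RGet 3 (kx :+ e)).
Definition cptx (e : nexp) : 'I_d -> rexp := ptx (NGet 7 e) (cutx e).

(** Index expressions have neither products nor remainders, so the offset of the
    vertex [i mod n] among the coordinates is found by repeated addition, or
    copied from one lap before. *)
Definition offsets : cmd :=
  loop (Seq (setv 1 (lit 0)) (setv 3 (lit 0))) (BNLe (var 1) n3x)
    (Seq (If (BNLe (var 1 :+ lit 1) nx) (NSet 5 (var 1) (var 3))
             (NSet 5 (var 1) (NGet 5 (NSub (var 1) nx))))
      (Seq (setv 3 (var 3 :+ lit d)) (incr 1))).

Definition prefix_lengths : cmd :=
  loop (Seq (setv 1 (lit 0)) (RSet 1 (lit 0) (RNat (lit 0))))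
    (BNLe (var 1 :+ lit 1) n3x)
    (Seq (RSet 1 (var 1 :+ lit 1)
           (RAdd (lamx (var 1)) (dist_exp (vx (var 1 :+ lit 1)) (vx (var 1)))))
         (incr 1)).

(** The positions are nondecreasing, so each test either moves to the next edge
    or finishes a position, and the scan is linear. *)
Definition locate (X : nat) (lim : nexp) (bx : nexp -> rexp) : cmd :=
  loop (Seq (setv 1 (lit 0)) (setv 2 (lit 0))) (BNLe (var 2) lim)
    (If (BNot (BRLe (bx (var 2)) (lamx (var 1 :+ lit 1)))) (incr 1)
        (Seq (NSet X (var 2) (var 1)) (incr 2))).

(** The recursion adds the chord [j] to the entry [j] and stores the result
    three entries later. The three families thus share one loop, and their sums
    end up in the entries [3 k], [3 k + 1] and [3 k + 2]. *)
Definition chord_sums : cmd :=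
  loop (Seq (setv 2 (lit 0)) (Seq (RSet 2 (lit 0) (RNat (lit 0)))
         (Seq (RSet 2 (lit 1) (RNat (lit 0))) (RSet 2 (lit 2) (RNat (lit 0))))))
    (BNLe (var 2 :+ lit 1) k3x)
    (Seq (RSet 2 (var 2 :+ lit 3) (RAdd (RGet 2 (var 2)) (chordx (var 2)))) (incr 2)).

Definition sumx (e : nexp) : rexp := RGet 2 (k3x :+ e).

Definition choose_family : cmd :=
  Seq (setv 4 (lit 0))
    (Seq (If (BRLe (sumx (lit 1)) (sumx (var 4))) (setv 4 (lit 1)) Skip)
      (Seq (If (BRLe (sumx (lit 2)) (sumx (var 4))) (setv 4 (lit 2)) Skip)
        (RSet 4 (lit 0) (RDiv (RMul (RNat (lit 2)) (RSub (lamx nx) (sumx (var 4))))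
                              (RMul (RNat kx) (RAdd (RNat kx) (RNat (lit 1)))))))).

Definition by_deficit : rexp :=
  RDiv (RSub (RSub (RDiv (lamx nx) (RNat kx))
                   (chordx (var 2 :+ (var 2 :+ var 2) :+ var 4)))
             (RGet 4 (lit 0))) (RNat (lit 2)).

Definition by_decrease : rexp :=
  RSub (RGet 3 (var 2)) (RDiv (RGet 4 (lit 0)) (RNat (lit 2))).

Definition shifts : cmd :=
  loop (Seq (setv 2 (lit 0)) (RSet 3 (lit 0) (RNat (lit 0))))
    (BNLe (var 2 :+ lit 1) (kx :+ kx))
    (Seq (If (BRLe by_deficit by_decrease) (RSet 3 (var 2 :+ lit 1) by_decrease)
             (RSet 3 (var 2 :+ lit 1) by_deficit)) (incr 2)).

(** A single loop for all arcs: its state is the current vertex and the current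
    arc, and each iteration writes a vertex or finishes an arc. This makes the
    total cost linear without any sum over the arcs. *)
Definition output_arcs : cmd :=
  loop (Seq (setv 1 (NGet 7 (lit 0))) (setv 2 (lit 0))) (BNLe (var 2 :+ lit 1) kx)
    (If (BNLe (var 1 :+ lit 1) (NGet 7 (var 2 :+ lit 1)))
        (Seq (incr 1) (out_coords (vx (var 1))))
        (Seq (NOut (NSub (NGet 7 (var 2 :+ lit 1)) (NGet 7 (var 2)) :+ lit 2))
          (Seq (out_coords (cptx (var 2 :+ lit 1)))
            (Seq (out_coords (cptx (var 2))) (incr 2))))).

Definition program : cmd :=
  Seq offsets (Seq prefix_lengths
    (Seq (locate 6 (k3x :+ (k3x :+ lit 2)) winx) (Seq chord_sums
      (Seq choose_family (Seq shifts (Seq (locate 7 kx cutx) output_arcs)))))).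

End Program.

Section Correct.
Variables (R : realType) (d : nat) (p : seq 'rV[R]_d) (k : nat).
Hypothesis p0 : (0 < size p)%N.
Hypothesis k3 : (3 <= k)%N.
Local Notation n := (size p).
Local Notation V := (cyc p).
Local Notation lam := (prefix_len (cyc p)).
Local Notation len := (prefix_len (cyc p) (size p)).
Implicit Types s : state R.

Definition has_input s : Prop :=
  [/\ nmem s 0 0 = n, nmem s 0 1 = k & forall i, rmem s 0 i = nth 0 (coords p) i].
Definition has_offsets s : Prop :=
  forall i, (i <= 3 * n)%N -> nmem s 5 i = (i %% n * d)%N.
Definition has_lengths s : Prop := forall i, (i <= 3 * n)%N -> rmem s 1 i = lam i.

(** The last chord used belongs to the point [3 (2 k - 1) + 2] and ends three
    points later. *)
Definition has_windows s : Prop :=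
  forall j, (j <= 6 * k + 2)%N -> nmem s 6 j = edge_at p (j%:R * (len / (3 * k)%:R)).

(** The chords with index below [t] and congruent to [t] modulo 3. *)
Definition chord_sum (t : nat) : R := \sum_(i < t %/ 3) chord p k (3 * i + t %% 3).
Definition has_sums s : Prop := forall t, (t < 3 * k + 3)%N -> rmem s 2 t = chord_sum t.
Definition has_family f s : Prop :=
  nmem s 4 0 = f /\ rmem s 4 0 = gain k (deficit p k f).
Definition has_shifts f s : Prop :=
  forall j, (j <= 2 * k)%N -> rmem s 3 j = shift k (deficit p k f) j.
Definition has_cuts f s : Prop :=
  forall j, (j <= k)%N -> nmem s 7 j = edge_at p (cut p k f j).

Lemma has_input_agree c s s' : agree c s s' -> ~~ nwrites c 0 -> ~~ rwrites c 0 ->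
  has_input s -> has_input s'.
Proof.
by move=> [a1 a2 _] h1 h2 [e1 e2 e3]; split; [rewrite a1|rewrite a1|move=> i; rewrite a2].
Qed.

Lemma has_offsets_agree c s s' : agree c s s' -> ~~ nwrites c 5 ->
  has_offsets s -> has_offsets s'.
Proof. by move=> [a _ _] h H i ile; rewrite a// H. Qed.

Lemma has_lengths_agree c s s' : agree c s s' -> ~~ rwrites c 1 ->
  has_lengths s -> has_lengths s'.
Proof. by move=> [_ a _] h H i ile; rewrite a// H. Qed.

Lemma has_windows_agree c s s' : agree c s s' -> ~~ nwrites c 6 ->
  has_windows s -> has_windows s'.
Proof. by move=> [a _ _] h H i ile; rewrite a// H. Qed.

Lemma has_family_agree f c s s' : agree c s s' -> ~~ nwrites c 4 -> ~~ rwrites c 4 ->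
  has_family f s -> has_family f s'.
Proof. by move=> [a1 a2 _] h1 h2 [e1 e2]; split; [rewrite a1|rewrite a2]. Qed.

Lemma has_shifts_agree f c s s' : agree c s s' -> ~~ rwrites c 3 ->
  has_shifts f s -> has_shifts f s'.
Proof. by move=> [_ a _] h H i ile; rewrite a// H. Qed.

Lemma has_cuts_agree f c s s' : agree c s s' -> ~~ nwrites c 7 ->
  has_cuts f s -> has_cuts f s'.
Proof. by move=> [a _ _] h H i ile; rewrite a// H. Qed.

Let nk0 : (0 < n + k)%N. Proof. by rewrite addn_gt0 p0. Qed.

Lemma prefix_len3 : lam (3 * n) = 3 * len.
Proof.
have := posM_period p 3 0 0; rewrite add0n !pos0 => ->.
by rewrite /prefix_len big_ord0 add0r.
Qed.

Lemma edge_at_lt u : u <= 3 * len -> reachable p u -> (edge_at p u < 3 * n)%N.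
Proof.
move=> u3 /edge_atP[_ _ lt]; rewrite ltnNge; apply/negP => le.
have l0 : (0 < edge_at p u)%N by apply: leq_trans le; rewrite muln_gt0.
by have := lt l0; rewrite ltNge (le_trans u3)// -prefix_len3 prefix_len_le.
Qed.

Lemma vx_val s e (j : 'I_d) : has_input s -> has_offsets s -> (neval s e <= 3 * n)%N ->
  reval s (vx e j) = V (neval s e) ord0 j.
Proof.
move=> [_ _ inp] off le; rewrite /vx /= inp off// nth_coords// ltn_mod//.
Qed.

Opaque vx.

Lemma ptx_val s e b u (j : 'I_d) : has_input s -> has_offsets s -> has_lengths s ->
  neval s e = edge_at p u -> reval s b = u -> reachable p u -> u <= 3 * len ->
  reval s (ptx e b j) = chain_at p u ord0 j.
Proof.
move=> inp off lens ee be ru u3; have lt := edge_at_lt u3 ru.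
have e1 : neval s (NAdd e (NLit 1)) = (edge_at p u).+1 by rewrite /= ee addn1.
rewrite /ptx /= !vx_val ?e1 ?ee//; last exact: ltnW.
rewrite addn1 be !lens//; last exact: ltnW.
by rewrite /chain_at /pt !mxE /edge_frac prefix_lenS [lam _ + _]addrC addrK.
Qed.

Opaque ptx.

Lemma winx_val s e : has_input s -> has_lengths s ->
  reval s (winx e) = (neval s e)%:R * (len / (3 * k)%:R).
Proof.
move=> [e1 e2 _] lens; rewrite /winx /stepx /= e1 e2 lens ?leq_pmull//.
by congr (_ * (_ / _%:R)); lia.
Qed.

Opaque winx.

Lemma window_le3 (m : nat) : (m <= 6 * k + 2)%N -> m%:R * (len / (3 * k)%:R) <= 3 * len.
Proof.
move=> m6; have k0 : 0 < (3 * k)%:R :> R by rewrite ltr0n muln_gt0 (leq_trans _ k3).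
rewrite mulrCA [leRHS]mulrC ler_wpM2l ?len_ge0// ler_pdivrMr// -natrM ler_nat.
by apply: (leq_trans m6); lia.
Qed.

Lemma chordx_val s e : has_input s -> has_offsets s -> has_lengths s -> has_windows s ->
  (neval s e + 3 <= 6 * k + 2)%N -> reval s (chordx d e) = chord p k (neval s e).
Proof.
move=> inp off lens win le; have le3 := window_le3.
rewrite /chordx; apply: reval_dist => j.
  rewrite /windowx (@ptx_val _ _ _ ((neval s e + 3)%:R * (len / (3 * k)%:R)))//.
  - by rewrite /= win.
  - by rewrite winx_val.
  - exact: window_pt_reachable.
  - exact: le3.
rewrite /windowx (@ptx_val _ _ _ ((neval s e)%:R * (len / (3 * k)%:R)))//.
- by rewrite /= win// (leq_trans _ le)// leq_addr.
- by rewrite winx_val.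
- exact: window_pt_reachable.
- by apply: le3; rewrite (leq_trans _ le)// leq_addr.
Qed.

Opaque chordx.

Lemma cutx_val f s e : has_input s -> has_lengths s -> has_family f s -> has_shifts f s ->
  (neval s e <= k)%N -> reval s (cutx e) = cut p k f (neval s e).
Proof.
move=> inp lens [f1 _] sh le; have [_ e2 _] := inp.
rewrite /cutx /= winx_val//= e2 f1 sh; last by lia.
by rewrite /cut; congr (_%:R * _ + _); lia.
Qed.

Opaque cutx.

Lemma offsets_ok s : has_input s -> exists t s',
  [/\ exec (offsets d) s t s', (t <= phase_cost (offsets d) * (n + k))%N,
      agree (offsets d) s s' & has_offsets s'].
Proof.
move=> inp.
apply: (loop_phase (Inv := fun s' => [/\ (nmem s' 1 0 <= 3 * n + 1)%N,
    nmem s' 3 0 = (nmem s' 1 0 * d)%N &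
    forall i, (i < nmem s' 1 0)%N -> nmem s' 5 i = (i %% n * d)%N])
  (mu := fun s' => (3 * n + 1 - nmem s' 1 0)%N)) => //=.
- by rewrite /update/=; lia.
- move=> s' a [i1 i2 i3]; have [e1 e2 _] := has_input_agree a isT isT inp.
  rewrite /n3x /= e1 => i4; case: ifPn => h /=; rewrite /update/= ?e1 i2; split; try lia;
    split; try lia; (rewrite addn1 => i; rewrite ltnS leq_eqVlt => /orP[/eqP ->|lt]).
  + by rewrite eqxx modn_small//; lia.
  + by rewrite ltn_eqF// i3.
  + rewrite eqxx i3; last by lia.
    by rewrite -[in RHS](subnK (_ : n <= nmem s' 1 0)%N) ?modnDr//; lia.
  + by rewrite ltn_eqF// i3.
- move=> s' a [i1 i2 i3]; have [e1 e2 _] := has_input_agree a isT isT inp.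
  by rewrite /n3x /= e1 => i4 i ile; apply: i3; lia.
Qed.

Lemma prefix_lengths_ok s : has_input s -> has_offsets s -> exists t s',
  [/\ exec (prefix_lengths d) s t s', (t <= phase_cost (prefix_lengths d) * (n + k))%N,
      agree (prefix_lengths d) s s' & has_lengths s'].
Proof.
move=> inp off.
apply: (loop_phase (Inv := fun s' => (nmem s' 1 0 <= 3 * n)%N /\
    forall i, (i <= nmem s' 1 0)%N -> rmem s' 1 i = lam i)
  (mu := fun s' => (3 * n - nmem s' 1 0)%N)) => //=.
- split; rewrite /update//= => i; rewrite leqn0 => /eqP ->.
  by rewrite /prefix_len big_ord0.
- by rewrite /update/=; lia.
- move=> s' a [i1 i2]; have inp' := has_input_agree a isT isT inp.
  have off' := has_offsets_agree a isT off; have [e1 e2 _] := inp'.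
  rewrite /n3x /= e1 => i4; rewrite /update/=; split; last by lia.
  split; first by lia.
  rewrite addn1 => i; rewrite leq_eqVlt => /orP[/eqP ->|lt]; last by rewrite ltn_eqF// i2.
  rewrite eqxx prefix_lenS i2//; congr (_ + _); apply: reval_dist => j; rewrite vx_val//=; last by lia.
    by rewrite addn1.
- move=> s' a [i1 i2]; have [e1 e2 _] := has_input_agree a isT isT inp.
  by rewrite /n3x /= e1 => i4 i ile; apply: i2; lia.
Qed.

(** The scan stays below the end of the third lap, because every position does.
    The clause of the invariant on [lam] is the second hypothesis of
    [edge_at_unique]; it survives the step to the next position by
    monotonicity. *)
Lemma locate_ok (X : nat) lim bx (b : nat -> R) (m : nat) s :
  (4 < X)%N -> X != 5%N -> (m <= 6 * k + 2)%N -> has_input s -> has_lengths s ->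
  (forall s', agree (locate X lim bx) s s' -> neval s' lim = m) ->
  (forall s', agree (locate X lim bx) s s' -> (nmem s' 2 0 <= m)%N ->
     reval s' (bx (NGet 2 (NLit 0))) = b (nmem s' 2 0)) ->
  (forall j, (j <= m)%N -> reachable p (b j) /\ b j <= 3 * len) ->
  (forall j, (j < m)%N -> b j <= b j.+1) ->
  exists t s', [/\ exec (locate X lim bx) s t s', (t <= phase_cost (locate X lim bx) * (n + k))%N,
      agree (locate X lim bx) s s' & forall j, (j <= m)%N -> nmem s' X j = edge_at p (b j)].
Proof.
move=> X4 X5 m6 inp lens limE bE b3 bS.
have X1 : (1 == X)%N = false by lia.
have X2 : (2 == X)%N = false by lia.
have X1' : (X == 1)%N = false by lia.
have X2' : (X == 2)%N = false by lia.
have X0 : (0 == X)%N = false by lia.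
apply: (loop_phase (Inv := fun s' => [/\ (nmem s' 2 0 <= m.+1)%N, (nmem s' 1 0 < 3 * n)%N,
    forall j, (j < nmem s' 2 0)%N -> nmem s' X j = edge_at p (b j) &
    (0 < nmem s' 1 0)%N -> (nmem s' 2 0 <= m)%N -> lam (nmem s' 1 0) < b (nmem s' 2 0)])
  (mu := fun s' => (m.+1 - nmem s' 2 0 + (3 * n - nmem s' 1 0))%N)) => //=.
- by split; rewrite /update//= muln_gt0.
- by rewrite /update/=; lia.
- move=> s' a [i1 i2 i3 i4]; have lens' : has_lengths s' by exact: (has_lengths_agree a isT lens).
  rewrite (limE _ a) => jm; rewrite (bE _ a jm) lens'; last by lia.
  have [/b3[rb bl]] := jm; rewrite addn1.
  case: ifPn => h /=; rewrite /update/= ?X1 ?X2 ?X1' ?X2' /=.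
    rewrite -ltNge in h.
    have i5 : ((nmem s' 1 0).+1 < 3 * n)%N.
      have : lam (nmem s' 1 0).+1 < lam (3 * n) by rewrite prefix_len3 (lt_le_trans h).
      by rewrite ltnNge; apply: contraTN => le; rewrite -leNgt prefix_len_le.
    by split; [split => //; rewrite ?addn1//|lia].
  rewrite negbK in h.
  have E : edge_at p (b (nmem s' 2 0)) = nmem s' 1 0.
    by apply: edge_at_unique => // i0; exact: i4.
  split; last by lia.
  split => //; rewrite ?addn1//.
    move=> j; rewrite ltnS leq_eqVlt => /orP[/eqP ->|lt]; first by rewrite !eqxx /= E.
    by rewrite eqxx/= ltn_eqF// i3.
  move=> i0 jm'; apply: (lt_le_trans (i4 i0 jm)); exact: bS.
- move=> s' a [i1 i2 i3 i4]; rewrite (limE _ a) => jm j jle; apply: i3; lia.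
Qed.

Lemma windows_ok s : has_input s -> has_offsets s -> has_lengths s -> exists t s',
  [/\ exec (locate 6 (NAdd k3x (NAdd k3x (NLit 2))) winx) s t s',
      (t <= phase_cost (locate 6 (NAdd k3x (NAdd k3x (NLit 2))) winx) * (n + k))%N,
      agree (locate 6 (NAdd k3x (NAdd k3x (NLit 2))) winx) s s' & has_windows s'].
Proof.
move=> inp off lens; apply: locate_ok => //.
- by move=> s' a; have [_ e2 _] := has_input_agree a isT isT inp; rewrite /k3x /= e2; lia.
- move=> s' a _; apply: winx_val; first exact: has_input_agree a isT isT inp.
  exact: has_lengths_agree a isT lens.
- by move=> j j6; split; [exact: window_pt_reachable|exact: window_le3].
- by move=> j _; rewrite ler_wpM2r ?divr_ge0 ?len_ge0// ler_nat.
Qed.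

Lemma chord_sum_small t : (t < 3)%N -> chord_sum t = 0.
Proof. by move=> t3; rewrite /chord_sum divn_small// big_ord0. Qed.

Lemma chord_sumD3 t : chord_sum (t + 3) = chord_sum t + chord p k t.
Proof.
have e1 : ((t + 3) %/ 3 = (t %/ 3).+1)%N by lia.
have e2 : ((t + 3) %% 3 = t %% 3)%N by lia.
by rewrite /chord_sum e1 e2 big_ord_recr/=; congr (_ + chord _ _ _); lia.
Qed.

Lemma chord_sums_ok s : has_input s -> has_offsets s -> has_lengths s -> has_windows s ->
  exists t s', [/\ exec (chord_sums d) s t s', (t <= phase_cost (chord_sums d) * (n + k))%N,
      agree (chord_sums d) s s' & has_sums s'].
Proof.
move=> inp off lens win.
apply: (loop_phase (Inv := fun s' => (nmem s' 2 0 <= 3 * k)%N /\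
    forall t, (t < nmem s' 2 0 + 3)%N -> rmem s' 2 t = chord_sum t)
  (mu := fun s' => (3 * k - nmem s' 2 0)%N)) => //=.
- split; rewrite /update//= => t t3; rewrite chord_sum_small//.
  by move: t t3 => [|[|[|]]].
- by rewrite /update/=; lia.
- move=> s' a [i1 i2]; have inp' := has_input_agree a isT isT inp.
  have off' := has_offsets_agree a isT off; have lens' := has_lengths_agree a isT lens.
  have win' := has_windows_agree a isT win; have [e1 e2 _] := inp'.
  rewrite /k3x /= e2 => i4; rewrite /update/=; split; last by lia.
  split; first by lia.
  rewrite addnAC addn1 => t; rewrite ltnS leq_eqVlt => /orP[/eqP ->|lt].
    by rewrite eqxx chord_sumD3 i2 ?chordx_val//=; lia.
  by rewrite ltn_eqF// i2.
- move=> s' a [i1 i2]; have [_ e2 _] := has_input_agree a isT isT inp.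
  by rewrite /k3x /= e2 => i4 t tlt; apply: i2; lia.
Qed.

Lemma sumx_val s e : has_input s -> has_sums s -> (neval s e < 3)%N ->
  reval s (sumx e) = family_sum p k (neval s e).
Proof.
move=> [_ e2 _] sums e3; rewrite /sumx /k3x /= e2.
have -> : (k + (k + k) + neval s e = 3 * k + neval s e)%N by lia.
rewrite sums; last by lia.
rewrite /chord_sum /family_sum.
have -> : ((3 * k + neval s e) %/ 3 = k)%N by lia.
by have -> : ((3 * k + neval s e) %% 3 = neval s e)%N by lia.
Qed.

Opaque sumx.

Lemma keep_smaller v s f : has_input s -> has_lengths s -> has_sums s -> nmem s 4 0 = f ->
  (f < 3)%N -> (v < 3)%N ->
  let s' := run s (If (BRLe (sumx (NLit v)) (sumx (NGet 4 (NLit 0))))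
                      (NSet 4 (NLit 0) (NLit v)) Skip) in
  [/\ has_input s', has_lengths s', has_sums s' &
      exists f', [/\ nmem s' 4 0 = f', (f' < 3)%N, family_sum p k f' <= family_sum p k f &
        family_sum p k f' <= family_sum p k v]].
Proof.
move=> inp lens sums sf f3 v3 /=; rewrite !sumx_val//= ?sf//.
case: leP => h; split => //; first by exists v.
by exists f; split => //; exact: ltW.
Qed.

Lemma choose_family_ok s : has_input s -> has_lengths s -> has_sums s -> exists t s' f,
  [/\ exec choose_family s t s', (t <= phase_cost choose_family * (n + k))%N,
      agree choose_family s s', (f < 3)%N /\
      (forall f', (f' < 3)%N -> family_sum p k f <= family_sum p k f') & has_family f s'].
Proof.
move=> inp lens sums; have [t e l] := exec_run s (isT : straight choose_family).
exists t, (run s choose_family).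
have := @keep_smaller 1 (run s (NSet 4 (NLit 0) (NLit 0))) 0 inp lens sums erefl isT isT.
rewrite /choose_family; set c1 := If _ _ _; set c2 := If _ _ _; set c3 := RSet _ _ _.
set c0 := NSet _ _ _ => -[inp1 lens1 sums1 [f1 [sf1 f13 f10 f11]]].
have := @keep_smaller 2 (run (run s c0) c1) f1 inp1 lens1 sums1 sf1 f13 isT.
move=> [inp2 lens2 sums2 [f [sf f3 ff1 f2]]].
exists f; split => //.
- by apply: (leq_trans l); rewrite leq_pmulr.
- exact: exec_agree e.
- split => // -[|[|[|]]] // _; exact: le_trans ff1 _.
split; first by rewrite -sf.
have -> : run s (Seq c0 (Seq c1 (Seq c2 c3))) = run (run (run (run s c0) c1) c2) c3 by [].
move: inp2 lens2 sums2 sf; rewrite -/c2; move: (run (run (run s c0) c1) c2) => s2.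
move=> inp2 lens2 sums2 sf; have [e1 e2 _] := inp2.
rewrite /= update_same sumx_val//= ?sf// e1 e2 lens2 ?leq_pmull//.
by rewrite /gain sum_deficit.
Qed.

Lemma by_deficit_val f s : has_input s -> has_offsets s -> has_lengths s ->
  has_windows s -> has_family f s -> (f < 3)%N -> (nmem s 2 0 < 2 * k)%N ->
  reval s (by_deficit d) = (deficit p k f (nmem s 2 0) - gain k (deficit p k f)) / 2.
Proof.
move=> inp off lens win [f1 g1] f3 lt; have [e1 e2 _] := inp.
have cE : (nmem s 2 0 + (nmem s 2 0 + nmem s 2 0) + f = 3 * nmem s 2 0 + f)%N by lia.
rewrite /by_deficit /= chordx_val//= ?f1 ?cE; last by lia.
by rewrite e1 e2 g1 lens ?leq_pmull.
Qed.

Lemma by_decrease_val f s : has_family f s ->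
  reval s by_decrease = rmem s 3 (nmem s 2 0) - gain k (deficit p k f) / 2.
Proof. by move=> [_ g1]; rewrite /by_decrease /= g1. Qed.

Opaque by_deficit by_decrease.

Lemma shifts_ok f s : (f < 3)%N -> has_input s -> has_offsets s -> has_lengths s ->
  has_windows s -> has_family f s ->
  exists t s', [/\ exec (shifts d) s t s', (t <= phase_cost (shifts d) * (n + k))%N,
      agree (shifts d) s s' & has_shifts f s'].
Proof.
move=> f3 inp off lens win fam.
apply: (loop_phase (Inv := fun s' => (nmem s' 2 0 <= 2 * k)%N /\
    forall j, (j <= nmem s' 2 0)%N -> rmem s' 3 j = shift k (deficit p k f) j)
  (mu := fun s' => (2 * k - nmem s' 2 0)%N)) => //=.
- by split; rewrite /update//= => j; rewrite leqn0 => /eqP ->.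
- by rewrite /update/=; lia.
- move=> s' a [i1 i2]; have inp' := has_input_agree a isT isT inp.
  have off' := has_offsets_agree a isT off; have lens' := has_lengths_agree a isT lens.
  have win' := has_windows_agree a isT win; have [e1 e2 _] := inp'.
  rewrite e2 => i4.
  have fam' := has_family_agree a isT isT fam.
  have jlt : (nmem s' 2 0 < 2 * k)%N by lia.
  have defE := by_deficit_val inp' off' lens' win' fam' f3 jlt; have decE := by_decrease_val fam'; rewrite i2// in decE.
  rewrite defE decE; case: ifPn => h /=; rewrite ?defE ?decE /update/=; split; try lia;
    (split; first by lia); rewrite addn1 => j; rewrite leq_eqVlt => /orP[/eqP ->|lt].
  + by rewrite eqxx /= max_r.
  + by rewrite ltn_eqF// i2.
  + by rewrite eqxx /= max_l//; apply: ltW; rewrite ltNge.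
  + by rewrite ltn_eqF// i2.
- move=> s' a [i1 i2]; have [_ e2 _] := has_input_agree a isT isT inp.
  by rewrite e2 => i4 j jle; apply: i2; lia.
Qed.

Section Cuts.
Variable f : nat.
Hypothesis f3 : (f < 3)%N.
Local Notation cut := (cut p k f).

Lemma cuts_ok s : has_input s -> has_offsets s -> has_lengths s -> has_family f s ->
  has_shifts f s ->
  exists t s', [/\ exec (locate 7 (NGet 0 (NLit 1)) cutx) s t s',
      (t <= phase_cost (locate 7 (NGet 0 (NLit 1)) cutx) * (n + k))%N,
      agree (locate 7 (NGet 0 (NLit 1)) cutx) s s' & has_cuts f s'].
Proof.
move=> inp off lens fam sh; apply: locate_ok => //.
- by lia.
- by move=> s' a; have [_ e2 _] := has_input_agree a isT isT inp.
- move=> s' a jk; apply: cutx_val => //; first exact: has_input_agree a isT isT inp.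
  + exact: has_lengths_agree a isT lens.
  + exact: has_family_agree a isT isT fam.
  + exact: has_shifts_agree a isT sh.
- by move=> j jk; split; [exact: cut_reachable|exact: cut_le3].
- by move=> j _; exact: cut_le.
Qed.

Lemma cptx_val s e (j : 'I_d) : has_input s -> has_offsets s -> has_lengths s ->
  has_family f s -> has_shifts f s -> has_cuts f s -> (neval s e <= k)%N ->
  reval s (cptx e j) = chain_at p (cut (neval s e)) ord0 j.
Proof.
move=> inp off lens fam sh cuts le.
rewrite /cptx (@ptx_val _ _ _ (cut (neval s e)))//.
- by rewrite /= cuts.
- by rewrite (cutx_val (f := f)).
- exact: cut_reachable.
- exact: cut_le3.
Qed.

Definition arcs (m : nat) : seq (seq 'rV[R]_d) :=
  [seq arc p (cut j) (cut j.+1) | j <- iota 0 m].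

Lemma iotaSr a m : iota a m.+1 = iota a m ++ [:: (a + m)%N].
Proof. by rewrite -addn1 iotaD. Qed.

Lemma arcsS m : arcs m.+1 = rcons (arcs m) (arc p (cut m) (cut m.+1)).
Proof. by rewrite /arcs iotaSr map_cat cats1. Qed.

Lemma coords_cat (q r : seq 'rV[R]_d) : coords (q ++ r) = coords q ++ coords r.
Proof. by rewrite /coords map_cat flatten_cat. Qed.

Lemma coords1 (x : 'rV[R]_d) : coords [:: x] = [seq x ord0 j | j <- enum 'I_d].
Proof. by rewrite /coords /= cats0. Qed.

Opaque cptx.

Lemma output_arcs_ok s : has_input s -> has_offsets s -> has_lengths s ->
  has_family f s -> has_shifts f s -> has_cuts f s -> nout s = [::] -> rout s = [::] ->
  exists t s', [/\ exec (output_arcs d) s t s', (t <= phase_cost (output_arcs d) * (n + k))%N,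
      agree (output_arcs d) s s' &
      nout s' = [seq size q | q <- arcs k] /\ rout s' = coords (flatten (arcs k))].
Proof.
move=> inp off lens fam sh cuts no ro.
have loc_mono j : (j < k)%N -> (edge_at p (cut j) <= edge_at p (cut j.+1))%N.
  by move=> jk; apply: edge_at_le; [exact: cut_reachable|exact: cut_reachable|exact: cut_le].
have loc3 j : (j <= k)%N -> (edge_at p (cut j) < 3 * n)%N.
  by move=> jk; apply: edge_at_lt; [exact: cut_le3|exact: cut_reachable].
apply: (loop_phase (Inv := fun s' => [/\ (nmem s' 2 0 <= k)%N,
    (edge_at p (cut (nmem s' 2 0)) <= nmem s' 1 0)%N,
    (nmem s' 1 0 <= edge_at p (cut (minn (nmem s' 2 0).+1 k)))%N,
    nout s' = [seq size q | q <- arcs (nmem s' 2 0)] &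
    rout s' = coords (flatten (arcs (nmem s' 2 0)) ++
       mid V (edge_at p (cut (nmem s' 2 0))) (nmem s' 1 0))] )
  (mu := fun s' => (k - nmem s' 2 0 + (3 * n - nmem s' 1 0))%N)) => //=.
- by rewrite !straight_out_coords.
- rewrite /update/= cuts//; have kp : (1 <= k)%N by lia.
  split => //; first by rewrite (minn_idPl kp) loc_mono.
  by rewrite ro /mid subnn.
- by rewrite /update/=; lia.
- move=> s' a [i1 i2 i3 i4 i5].
  have w1 E : (forall a, nwrites (out_coords (d := d) E) a = false) := (out_coords_writes E).1.
  have w2 E : (forall a, rwrites (out_coords (d := d) E) a = false) := (out_coords_writes E).2.
  have inp' : has_input s' by apply: has_input_agree a _ _ inp; rewrite /= !(w1, w2).
  have off' : has_offsets s' by apply: has_offsets_agree a _ off; rewrite /= !(w1, w2).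
  have lens' : has_lengths s' by apply: has_lengths_agree a _ lens; rewrite /= !(w1, w2).
  have fam' : has_family f s' by apply: has_family_agree a _ _ fam; rewrite /= !(w1, w2).
  have sh' : has_shifts f s' by apply: has_shifts_agree a _ sh; rewrite /= !(w1, w2).
  have cuts' : has_cuts f s' by apply: has_cuts_agree a _ cuts; rewrite /= !(w1, w2).
  have [e1 e2 _] := inp'; rewrite e2 addn1 => jk; have := i3; rewrite (minn_idPl jk) => i3'.
  rewrite addn1 cuts'//; case: ifPn => h.
    rewrite /= run_out_coords /= /update/=; split; last by have := loc3 _ jk; lia.
    split => //; first exact: leqW.
      by rewrite (minn_idPl jk).
    rewrite i5 (eq_map (g := fun j : 'I_d => V (nmem s' 1 0).+1 ord0 j)); last first.
      move=> j; rewrite vx_val//=; rewrite /update/= ?addn1//.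
      by have := loc3 _ jk; lia.
    rewrite -coords1 -coords_cat -catA; congr (coords (_ ++ _)).
    rewrite /mid subSn// iotaSr map_cat/=; congr (_ ++ [:: V _]); lia.
  have iE : nmem s' 1 0 = edge_at p (cut (nmem s' 2 0).+1) by lia.
  rewrite /= !run_out_coords /= /update/= addn1; split; last by lia.
  have := loc_mono (nmem s' 2 0) jk; rewrite -iE => lm.
  split => //.
  + have [k1|k1] := ltnP (nmem s' 2 0).+1 k; first by rewrite (minn_idPl k1) iE loc_mono.
    by rewrite (minn_idPr (leqW k1)) iE (_ : (nmem s' 2 0).+1 = k)//; lia.
  + by rewrite arcsS map_rcons i4 size_arc !cuts'// ?(ltnW jk)// iE addn2.
  rewrite (eq_map (g := fun j : 'I_d => chain_at p (cut (nmem s' 2 0).+1) ord0 j)); last first.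
    by move=> j; rewrite cptx_val//= addn1.
  rewrite [X in _ ++ X](eq_map (g := fun j : 'I_d => chain_at p (cut (nmem s' 2 0)) ord0 j)); last first.
    by move=> j; rewrite cptx_val//= ltnW.
  rewrite i5 -!coords1 -!coords_cat arcsS flatten_rcons /mid iE subnn cats0.
  by rewrite /arc /mid -!catA.
- move=> s' a [i1 i2 i3 i4 i5].
  have w1 E : (forall a, nwrites (out_coords (d := d) E) a = false) := (out_coords_writes E).1.
  have w2 E : (forall a, rwrites (out_coords (d := d) E) a = false) := (out_coords_writes E).2.
  have [_ e2 _] : has_input s' by apply: has_input_agree a _ _ inp; rewrite /= !(w1, w2).
  rewrite e2 addn1 -leqNgt => kj; have kE : nmem s' 2 0 = k by apply/eqP; rewrite eqn_leq i1.
  move: i2 i3; rewrite kE (minn_idPr (leqnSn k)) => i2 i3.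
  rewrite i4 i5 kE; split => //; rewrite /mid.
  have -> : (nmem s' 1 0 - edge_at p (cut k) = 0)%N by lia.
  by rewrite cats0.
Qed.

End Cuts.

End Correct.

(** * The theorem *)

Definition time_factor (d : nat) : nat :=
  phase_cost (offsets d) + (phase_cost (prefix_lengths d) +
  (phase_cost (locate 6 (NAdd k3x (NAdd k3x (NLit 2))) winx) +
  (phase_cost (chord_sums d) + (phase_cost choose_family + (phase_cost (shifts d) +
  (phase_cost (locate 7 (NGet 0 (NLit 1)) cutx) + phase_cost (output_arcs d))))))).

Lemma program_correct (R : realType) (d : nat) (p : seq 'rV[R]_d) (k : nat) :
  (0 < size p)%N -> (3 <= k)%N -> exists f,
  [/\ (f < 3)%N, forall f', (f' < 3)%N -> family_sum p k f <= family_sum p k f' &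
      computes_within (program d) p (time_factor d * (size p + k)) (curves p k f)].
Proof.
move=> p0 k3; pose s0 := input p k.
have inp0 : has_input p k s0 by [].
have [t1 [s1 [e1 l1 a1 off1]]] := offsets_ok p0 k3 inp0.
have inp1 := has_input_agree a1 isT isT inp0.
have [t2 [s2 [e2 l2 a2 lens2]]] := prefix_lengths_ok p0 k3 inp1 off1.
have inp2 := has_input_agree a2 isT isT inp1; have off2 := has_offsets_agree a2 isT off1.
have [t3 [s3 [e3 l3 a3 win3]]] := windows_ok p0 k3 inp2 off2 lens2.
have inp3 := has_input_agree a3 isT isT inp2; have off3 := has_offsets_agree a3 isT off2.
have lens3 := has_lengths_agree a3 isT lens2.
have [t4 [s4 [e4 l4 a4 sums4]]] := chord_sums_ok p0 k3 inp3 off3 lens3 win3.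
have inp4 := has_input_agree a4 isT isT inp3; have off4 := has_offsets_agree a4 isT off3.
have lens4 := has_lengths_agree a4 isT lens3; have win4 := has_windows_agree a4 isT win3.
have [t5 [s5 [f [e5 l5 a5 [f3 fmin] fam5]]]] := choose_family_ok p0 k3 inp4 lens4 sums4.
have inp5 := has_input_agree a5 isT isT inp4; have off5 := has_offsets_agree a5 isT off4.
have lens5 := has_lengths_agree a5 isT lens4; have win5 := has_windows_agree a5 isT win4.
have [t6 [s6 [e6 l6 a6 sh6]]] := shifts_ok p0 k3 f3 inp5 off5 lens5 win5 fam5.
have inp6 := has_input_agree a6 isT isT inp5; have off6 := has_offsets_agree a6 isT off5.
have lens6 := has_lengths_agree a6 isT lens5.
have fam6 := has_family_agree a6 isT isT fam5.
have [t7 [s7 [e7 l7 a7 cuts7]]] := cuts_ok p0 k3 f3 inp6 off6 lens6 fam6 sh6.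
have inp7 := has_input_agree a7 isT isT inp6; have off7 := has_offsets_agree a7 isT off6.
have lens7 := has_lengths_agree a7 isT lens6.
have fam7 := has_family_agree a7 isT isT fam6.
have sh7 := has_shifts_agree a7 isT sh6.
have [no7 ro7] : nout s7 = [::] /\ rout s7 = [::].
  case: a7 => _ _ /(_ isT)[-> ->]; case: a6 => _ _ /(_ isT)[-> ->].
  case: a5 => _ _ /(_ isT)[-> ->]; case: a4 => _ _ /(_ isT)[-> ->].
  case: a3 => _ _ /(_ isT)[-> ->]; case: a2 => _ _ /(_ isT)[-> ->].
  by case: a1 => _ _ /(_ isT)[-> ->].
have [t8 [s8 [e8 l8 _ [no8 ro8]]]] :=
  output_arcs_ok p0 k3 f3 inp7 off7 lens7 fam7 sh7 cuts7 no7 ro7.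
exists f; split => //.
have curvesE : tval (curves p k f) = arcs p k f k.
  by rewrite /arcs -val_enum_ord -map_comp.
exists (t1 + (t2 + (t3 + (t4 + (t5 + (t6 + (t7 + t8)))))))%N, s8; split.
- by do 7![apply: ExecSeq; first eassumption].
- rewrite /time_factor; move: l1 l2 l3 l4 l5 l6 l7 l8.
  do 8![move: (phase_cost _) => ?]; rewrite !mulnDl => *.
  by do 7![apply: leq_add => //].
- by rewrite no8 curvesE.
- by rewrite ro8 curvesE.
Qed.

Theorem theorem4 (R : realType) (d : nat) :
  exists (c : cmd) (A : nat),
    forall (p : seq 'rV[R]_d) (k : nat), (0 < size p)%N -> (3 <= k)%N ->
      exists Q : k.-tuple (seq 'rV[R]_d),
        [/\ computes_within c p (A * (size p + k))%N Q,
            [::] \notin Q,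
            is_approximation (2 - 1 / (4 * k%:R ^+ 3)) p (chain_curves Q) &
            forall rho : R, (k, rho) \in small_ratios R ->
              is_approximation rho p (chain_curves Q)].
Proof.
exists (program d), (time_factor d) => p k p0 k3.
have [f [f3 fmin comp]] := program_correct p0 k3.
exists (curves p k f); split => //.
- apply/negP => /mapP[i _ E].
  by have := size_arc p (cut p k f i) (cut p k f i.+1); rewrite -E.
- by apply: curves_approximation => //; exact: ratio_general.
- by move=> rho hrho; apply: curves_approximation => //; exact: ratio_small.
Qed.
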